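(* Let $0<\xi<1$ and let $(z,z')$ be in the principal or complementary series. Then the kernel $\underline K_{z,z',\xi}(x,y)=\sum_{a\in\mathbb Z'_+}\psi_a(x;z,z',\xi)\psi_a(y;z,z',\xi)$, $x,y\in\mathbb Z'$, can also be written as $$\underline K_{z,z',\xi}(x,y)=\frac{\sqrt{zz'\xi}}{1-\xi}\;\frac{\psi_{-\frac12}(x)\psi_{\frac12}(y)-\psi_{\frac12}(x)\psi_{-\frac12}(y)}{x-y},$$ where $\psi_{\pm\frac12}(\,\cdot\,)=\psi_{\pm\frac12}(\,\cdot\,;z,z',\xi)$, and for $x=y$ the right-hand side is understood by extending $\psi_{\pm\frac12}$ analytically to a neighborhood of $\mathbb Z'$ in $\mathbb C$ (by the defining formula) and resolving the indeterminacy $0/0$ by l'Hospital's rule.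
   Context: $\mathbb Z'=\mathbb Z+\frac12$, $\mathbb Z'_+=\{\frac12,\frac32,\dots\}$. The pair $(z,z')$ is in the principal series if $z,z'$ are not real and are complex conjugate to each other; in the complementary series if $z,z'$ are both real and lie in the same open interval $(m,m+1)$ with $m\in\mathbb Z$. (In both cases $zz'>0$, and the positive root $\sqrt{zz'\xi}$ is taken.) $F(A,B;C;w)$ is the Gauss hypergeometric function ${}_2F_1$ (continued to $w\in\mathbb C\setminus[1,\infty)$); $F(A,B;C;w)/\Gamma(C)$ is understood as its extension by continuity to all $C\in\mathbb C$. For $a,x\in\mathbb Z'$, $$\psi_a(x;z,z',\xi)=\left(\frac{\Gamma(x+z+\frac12)\Gamma(x+z'+\frac12)}{\Gamma(z-a+\frac12)\Gamma(z'-a+\frac12)}\right)^{\frac12}\xi^{\frac12(x+a)}(1-\xi)^{\frac12(z+z')-a}\,\frac{F(-z+a+\frac12,-z'+a+\frac12;x+a+1;\frac{\xi}{\xi-1})}{\Gamma(x+a+1)},$$ where for $x\in\mathbb Z'$ the quantity under the square root is positive and the positive root is taken. The same formula makes sense for complex $x$ sufficiently close to a point of $\mathbb Z'$ (with the branch of the root continued analytically from the positive root at the lattice point), so $\psi_a$ is viewed as an analytic function in a neighborhood of $\mathbb Z'$. *)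

(* Defs.v *)
From Stdlib Require Import Reals ZArith.
From Coquelicot Require Import Coquelicot.

Open Scope R_scope.
Open Scope C_scope.

Definition Cexp (s : C) : C :=
  RtoC (exp (Re s)) * (cos (Im s), sin (Im s)).

(* [Rcpow t s] is t^s = exp (s ln t), meaningful for t > 0 only. *)
Definition Rcpow (t : R) (s : C) : C := Cexp (s * RtoC (ln t)).

(* Principal square root: Re (Csqrt w) >= 0, holomorphic off (-oo, 0], and the
   positive root when w is a positive real. *)
Definition Csqrt (w : C) : C :=
  (sqrt ((Cmod w + Re w) / 2),
   if Rlt_dec (Im w) 0 then (- sqrt ((Cmod w - Re w) / 2))%R
   else sqrt ((Cmod w - Re w) / 2)).

Definition Climit {T : Type} (F : (T -> Prop) -> Prop) (u : T -> C) : C :=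
  @iota C_CompleteNormedModule
    (fun v : C => filterlim u F (@locally C_UniformSpace v)).

Definition Cis_series (u : nat -> C) (v : C) : Prop :=
  @is_series C_AbsRing C_NormedModule u v.

Definition Cis_derive (f : C -> C) (x d : C) : Prop :=
  @is_derive C_AbsRing C_NormedModule f x d.

(* Pochhammer symbol (s)_n = s (s+1) ... (s+n-1). *)
Fixpoint Cpoch (s : C) (n : nat) : C :=
  match n with
  | O => 1
  | S m => Cpoch s m * (s + RtoC (INR m))
  end.

(* Gauss' product formula
     Gamma(s) = lim_n  n! n^s / (s (s+1) ... (s+n)),
   valid for every s other than 0, -1, -2, ...; no meaning at these poles. *)
Definition CGamma (s : C) : C :=
  Climit eventually
    (fun n : nat => RtoC (INR (fact n)) * Rcpow (INR n) s / Cpoch s (S n)).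

Definition hyp_coef (A B c : C) (n : nat) : C :=
  Cpoch A n * Cpoch B n / (Cpoch c n * RtoC (INR (fact n))).

Definition analytic_at (f : C -> C) (w0 : C) : Prop :=
  exists c : nat -> C,
    @locally C_UniformSpace w0
      (fun w => Cis_series (fun n => c n * (w - w0) ^ n) (f w)).

Definition slit_plane (w : C) : Prop := ~ (Im w = 0%R /\ (1 <= Re w)%R).

Definition star_shaped (U : C -> Prop) : Prop :=
  U 0 /\ forall (w : C) (t : R), U w -> (0 <= t <= 1)%R -> U (RtoC t * w).

(* [v] is the value at [w] of the continuation of the Gauss series to
   C \ [1, +oo).  Any domain U of continuation that is star-shaped about 0 is
   allowed, among them C \ [1, +oo) itself; star-shapedness makes the value
   independent of U and f (both are determined along the segment [0, w]). *)
Definition is_hyp2F1 (A B c w v : C) : Prop :=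
  exists (U : C -> Prop) (f : C -> C),
    @open C_UniformSpace U /\ star_shaped U /\
    (forall u, U u -> slit_plane u) /\
    (forall u, U u -> analytic_at f u) /\
    (forall u, U u -> (Cmod u < 1)%R ->
       Cis_series (fun n => hyp_coef A B c n * u ^ n) (f u)) /\
    U w /\ f w = v.

(* F(A, B; c; w), for c not in {0, -1, -2, ...} and w in C \ [1, +oo). *)
Definition hyp2F1 (A B c w : C) : C :=
  @iota C_CompleteNormedModule (is_hyp2F1 A B c w).

(* F(A, B; c; w) / Gamma(c) extended by continuity to all c: the limit over
   c' -> c with c' <> c, where c' eventually avoids 0, -1, -2, ... *)
Definition hyp2F1_reg (A B c w : C) : C :=
  Climit (@locally' C_UniformSpace c)
    (fun c' => hyp2F1 A B c' w / CGamma c').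

(* n |-> n + 1/2 parametrises Z' = Z + 1/2; n >= 0 gives Z'_+. *)
Definition half (n : Z) : C := RtoC (IZR n + / 2).

Definition principal_series (z z' : C) : Prop :=
  Im z <> 0%R /\ Im z' <> 0%R /\ z' = Cconj z.

Definition complementary_series (z z' : C) : Prop :=
  Im z = 0%R /\ Im z' = 0%R /\
  exists m : Z, (IZR m < Re z < IZR m + 1)%R /\ (IZR m < Re z' < IZR m + 1)%R.

(* For x in Z' the argument of [Csqrt] is a positive real, so near Z' the
   principal root is the analytic continuation of the positive root. *)
Definition psi (z z' : C) (xi : R) (a x : C) : C :=
  Csqrt (CGamma (x + z + / 2) * CGamma (x + z' + / 2)
         / (CGamma (z - a + / 2) * CGamma (z' - a + / 2)))
  * Rcpow xi ((x + a) / 2)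
  * Rcpow (1 - xi) ((z + z') / 2 - a)
  * hyp2F1_reg (- z + a + / 2) (- z' + a + / 2) (x + a + 1)
      (RtoC (xi / (xi - 1))).

(* The series sum_{a in Z'_+} psi_a(x) psi_a(y) converges to [v]. *)
Definition is_kernel (z z' : C) (xi : R) (x y v : C) : Prop :=
  Cis_series (fun k : nat => psi z z' xi (half (Z.of_nat k)) x
                             * psi z z' xi (half (Z.of_nat k)) y) v.

(* Main.v *)
Require Import Defs.
From Stdlib Require Import Reals ZArith.
From Coquelicot Require Import Coquelicot.
From Stdlib Require Import Lra Lia Psatz ClassicalEpsilon.
Open Scope R_scope.
Open Scope C_scope.

(** The proof is a Christoffel-Darboux summation over [a].  By Pfaff's transformation
    psi_a(x) is, up to a factor that does not depend on [a], the product of an amplitude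
    in [a] alone and of the series
      sum_n (A)_n (x+z'+1/2)_n / (n! Gamma(x+a+1+n)) xi^n,   A = a+1/2-z.
    Passing from [a] to [a+1] shifts all parameters of the hypergeometric function by
    one, as differentiation does, so the hypergeometric equation becomes a three-term
    relation between psi_(a-1), psi_a and psi_(a+1) ([psi_core_three_term]):
      (1-xi) x psi_a = alpha_(a-1) psi_(a-1) + alpha_a psi_(a+1) - beta_a psi_a,
    with alpha_a the square root of xi (a+1/2-z)(a+1/2-z').  Multiplying by psi_a(y) and
    antisymmetrising in x, y makes (1-xi)(x-y) psi_a(x) psi_a(y) a difference of
    consecutive boundary terms ([Christoffel_Darboux]).  The boundary term at a = -1/2 is
    the numerator of the asserted formula, with alpha_(-1/2) the square root of z z' xi;
    the one at infinity vanishes because psi_a(x) decays geometrically in [a]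
    ([psi_core_decay]).  The whole argument is valid for complex x, and the decay is
    locally uniform in x, so the diagonal values follow by letting x tend to y: the
    series tends to the diagonal series and the quotient to a Wronskian
    ([psi_core_kernel_diag]).

    Both series of pairs (z, z') enter only through [admissible]: z + z' is real and
    (z+k)(z'+k) is positive for every integer k.  This makes all quantities under square
    roots positive.

    The analytic foundations are built from absolutely convergent series, and
    [Tannery] is the one tool for exchanging limits.
    - 1/Gamma is Gauss' product, whose factors and their Lipschitz constants are
      summable; it is therefore differentiable everywhere and vanishes only at the poles
      of Gamma ([Cder_recip_Gamma], [recip_Gamma_neq0]).
    - The value of the continued hypergeometric function at xi/(xi-1) is found by
      exhibiting one continuation, Pfaff's right-hand side on a disc around that point,
      and showing that any two continuations agree along a segment from 0
      ([hyp2F1_value], [identity_on_segment]).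
    - Divided by Gamma(c), this value is a series differentiable in c for every c, so it
      is also the extension by continuity ([hyp2F1_reg_value]). *)

(** * Limits and series of complex numbers *)

Ltac tri := eapply Rle_trans; [apply Cmod_triangle|].
Ltac tri_l := eapply Rle_trans; [apply Rplus_le_compat_r, Cmod_triangle|].

Lemma Cmod_pos (r : R) : 0 <= r -> Cmod r = r.
Proof. intros Hr. rewrite Cmod_R. now apply Rabs_pos_eq. Qed.

Definition Clim {T : Type} (F : (T -> Prop) -> Prop) (f : T -> C) (l : C) : Prop :=
  forall eps : R, (0 < eps) -> F (fun t => (Cmod (f t - l) < eps)).

Lemma Clim_filterlim {T : Type} (F : (T -> Prop) -> Prop) {FF : Filter F}
  (f : T -> C) (l : C) :
  Clim F f l <-> filterlim f F (@locally C_UniformSpace l).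
Proof.
  split.
  - intros H.
    apply (proj2 (@filterlim_locally_ball_norm C_AbsRing T C_NormedModule F FF f l)).
    intros eps. generalize (H eps (cond_pos eps)). apply filter_imp.
    intros t Ht. exact Ht.
  - intros H eps Heps.
    generalize (proj1 (@filterlim_locally_ball_norm C_AbsRing T C_NormedModule F FF f l)
      H (mkposreal eps Heps)).
    apply filter_imp. intros t Ht. exact Ht.
Qed.

Lemma Clim_unique {T : Type} (F : (T -> Prop) -> Prop) {FF : ProperFilter F}
  (f : T -> C) (l l' : C) : Clim F f l -> Clim F f l' -> l = l'.
Proof.
  intros H H'.
  apply (@filterlim_locally_unique T C_AbsRing C_NormedModule F _ f l l');
    apply Clim_filterlim; auto; apply FF.
Qed.

Lemma Climit_eq {T : Type} (F : (T -> Prop) -> Prop) {FF : ProperFilter F}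
  (f : T -> C) (l : C) : Clim F f l -> Climit F f = l.
Proof.
  intros H. unfold Climit.
  apply (@iota_filterlim_locally C_AbsRing C_CompleteNormedModule T F _ f l).
  apply Clim_filterlim; auto. apply FF.
Qed.

Lemma Clim_ext_loc {T : Type} (F : (T -> Prop) -> Prop) {FF : Filter F}
  (f g : T -> C) (l : C) :
  F (fun t => f t = g t) -> Clim F f l -> Clim F g l.
Proof.
  intros E H eps Heps. generalize (filter_and _ _ E (H eps Heps)).
  apply filter_imp. intros t [Et Ht]. now rewrite <- Et.
Qed.

Lemma Clim_ext {T : Type} (F : (T -> Prop) -> Prop) {FF : Filter F}
  (f g : T -> C) (l : C) :
  (forall t, f t = g t) -> Clim F f l -> Clim F g l.
Proof. intros E. apply Clim_ext_loc; auto. now apply filter_forall. Qed.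

Lemma Clim_const {T : Type} (F : (T -> Prop) -> Prop) {FF : Filter F} (l : C) :
  Clim F (fun _ => l) l.
Proof.
  intros eps Heps. apply filter_forall. intros _.
  replace (l - l) with (RtoC 0) by ring. now rewrite Cmod_0.
Qed.

Lemma Clim_plus {T : Type} (F : (T -> Prop) -> Prop) {FF : Filter F}
  (f g : T -> C) (l m : C) :
  Clim F f l -> Clim F g m -> Clim F (fun t => f t + g t) (l + m).
Proof.
  intros Hf Hg eps Heps.
  assert (He : 0 < eps / 2) by lra.
  generalize (filter_and _ _ (Hf _ He) (Hg _ He)). apply filter_imp.
  intros t [H1 H2]. replace (f t + g t - (l + m)) with ((f t - l) + (g t - m)) by ring.
  eapply Rle_lt_trans; [apply Cmod_triangle|]. lra.
Qed.

Lemma Clim_mult {T : Type} (F : (T -> Prop) -> Prop) {FF : Filter F}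
  (f g : T -> C) (l m : C) :
  Clim F f l -> Clim F g m -> Clim F (fun t => f t * g t) (l * m).
Proof.
  intros Hf Hg eps Heps.
  set (K := (1 + Cmod l + Cmod m)%R).
  assert (Hl := Cmod_ge_0 l). assert (Hm := Cmod_ge_0 m).
  assert (HK : 0 < K) by (unfold K; lra).
  set (e := Rmin 1 (eps / (2 * K))).
  assert (He0 : 0 < eps / (2 * K)) by (apply Rdiv_lt_0_compat; lra).
  assert (He : 0 < e) by (unfold e; apply Rmin_pos; lra).
  generalize (filter_and _ _ (Hf _ He) (Hg _ He)). apply filter_imp.
  intros t [H1 H2].
  replace (f t * g t - l * m)
    with ((f t - l) * (g t - m) + ((f t - l) * m + l * (g t - m))) by ring.
  eapply Rle_lt_trans; [apply Cmod_triangle|].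
  eapply Rle_lt_trans; [apply Rplus_le_compat_l, Cmod_triangle|].
  rewrite !Cmod_mult.
  assert (e <= 1) by apply Rmin_l.
  assert (e <= eps / (2 * K)) by apply Rmin_r.
  assert (e * K <= eps / 2).
  { apply Rle_trans with (eps / (2 * K) * K)%R.
    - apply Rmult_le_compat_r; lra.
    - right. field. lra. }
  assert (P1 := Cmod_ge_0 (f t - l)). assert (P2 := Cmod_ge_0 (g t - m)).
  set (x := Cmod (f t - l)) in *. set (y := Cmod (g t - m)) in *.
  assert (x * y <= e * 1) by (apply Rmult_le_compat; lra).
  assert (x * Cmod m <= e * Cmod m) by (apply Rmult_le_compat_r; lra).
  assert (Cmod l * y <= Cmod l * e) by (apply Rmult_le_compat_l; lra).
  unfold K in *. nra.
Qed.

Lemma Clim_scal {T : Type} (F : (T -> Prop) -> Prop) {FF : Filter F}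
  (c : C) (f : T -> C) (l : C) : Clim F f l -> Clim F (fun t => c * f t) (c * l).
Proof. intros H. apply Clim_mult; auto. now apply Clim_const. Qed.

Lemma Clim_inv {T : Type} (F : (T -> Prop) -> Prop) {FF : Filter F}
  (f : T -> C) (l : C) : l <> 0 -> Clim F f l -> Clim F (fun t => / f t) (/ l).
Proof.
  intros Hl Hf eps Heps.
  assert (Hm : 0 < Cmod l) by now apply Cmod_gt_0.
  set (m := Cmod l) in *.
  set (e := Rmin (m / 2) (eps * (m * m) / 2)).
  assert (Hmm : 0 < m * m) by nra.
  assert (He : 0 < e) by (unfold e; apply Rmin_pos; nra).
  generalize (Hf _ He). apply filter_imp. intros t Ht.
  assert (E1 : e <= m / 2) by apply Rmin_l.
  assert (E2 : e <= eps * (m * m) / 2) by apply Rmin_r.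
  assert (B : m / 2 < Cmod (f t)).
  { assert (m <= Cmod (f t) + Cmod (f t - l)).
    { unfold m. replace l with (f t + - (f t - l)) at 1 by ring.
      tri. rewrite Cmod_opp. lra. }
    lra. }
  assert (Hft : f t <> 0) by (apply Cmod_gt_0; lra).
  replace (/ f t - / l) with (- ((f t - l) * (/ f t * / l))) by (field; auto).
  rewrite Cmod_opp, !Cmod_mult, !Cmod_inv; auto. fold m.
  assert (/ Cmod (f t) <= 2 / m).
  { replace (2 / m)%R with (/ (m / 2))%R by (field; lra).
    apply Rinv_le_contravar; lra. }
  assert (0 < / m) by now apply Rinv_0_lt_compat.
  assert (0 < / Cmod (f t)) by (apply Rinv_0_lt_compat; lra).
  assert (/ Cmod (f t) * / m <= 2 / m * / m) by (apply Rmult_le_compat_r; lra).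
  apply Rlt_le_trans with (e * (2 / m * / m))%R.
  - apply Rle_lt_trans with (Cmod (f t - l) * (2 / m * / m))%R.
    + apply Rmult_le_compat_l; [apply Cmod_ge_0|auto].
    + apply Rmult_lt_compat_r; auto. 
      apply Rmult_lt_0_compat; auto. apply Rdiv_lt_0_compat; lra.
  - apply Rle_trans with (eps * (m * m) / 2 * (2 / m * / m))%R.
    + apply Rmult_le_compat_r; auto. left.
      apply Rmult_lt_0_compat; auto. apply Rdiv_lt_0_compat; lra.
    + right. field. lra.
Qed.

Fixpoint Csum (u : nat -> C) (n : nat) : C :=
  match n with O => 0 | S m => Csum u m + u m end.

Lemma sum_n_Csum (u : nat -> C) (n : nat) :
  @sum_n C_AbelianMonoid u n = Csum u (S n).
Proof.
  induction n as [|n IH].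
  - rewrite sum_O. simpl. ring.
  - rewrite sum_Sn, IH. reflexivity.
Qed.

Lemma Cis_series_Clim (u : nat -> C) (v : C) :
  Cis_series u v <-> Clim eventually (Csum u) v.
Proof.
  assert (E : Cis_series u v <-> Clim eventually (fun n => Csum u (S n)) v).
  { unfold Cis_series, is_series. split; intros H.
    - apply Clim_filterlim; [apply eventually_filter|].
      eapply filterlim_ext; [|exact H]. intros n. apply sum_n_Csum.
    - eapply filterlim_ext; [|apply Clim_filterlim; [apply eventually_filter|exact H]].
      intros n. symmetry. apply sum_n_Csum. }
  rewrite E. split; intros H eps Heps; destruct (H eps Heps) as [N HN].
  - exists (S N). intros [|n] Hn; [lia|]. apply HN. lia.
  - exists N. intros n Hn. apply HN. lia.
Qed.

Lemma Cis_series_unique (u : nat -> C) (v w : C) :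
  Cis_series u v -> Cis_series u w -> v = w.
Proof.
  rewrite !Cis_series_Clim. apply Clim_unique. apply eventually_filter.
Qed.

Definition CSeries (u : nat -> C) : C :=
  (Series (fun n => Re (u n)), Series (fun n => Im (u n))).

Definition Csummable (u : nat -> C) : Prop := ex_series (fun n => Cmod (u n)).

Lemma im_le_Cmod (c : C) : (Rabs (Im c) <= Cmod c).
Proof. eapply Rle_trans; [|apply Rmax_Cmod]. apply Rmax_r. Qed.

Lemma ex_series_Rle (a b : nat -> R) :
  (forall n, (Rabs (a n) <= b n)) -> ex_series b -> ex_series a.
Proof. intros H. apply (@ex_series_le R_AbsRing R_CompleteNormedModule a b H). Qed.

Lemma Csummable_Re (u : nat -> C) : Csummable u -> ex_series (fun n => Re (u n)).
Proof. apply ex_series_Rle. intros n. apply re_le_Cmod. Qed.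

Lemma Csummable_Im (u : nat -> C) : Csummable u -> ex_series (fun n => Im (u n)).
Proof. apply ex_series_Rle. intros n. apply im_le_Cmod. Qed.

Lemma Csummable_le (u : nat -> C) (b : nat -> R) :
  (forall n, (Cmod (u n) <= b n)) -> ex_series b -> Csummable u.
Proof.
  intros H. apply ex_series_Rle. intros n.
  rewrite Rabs_pos_eq; [apply H | apply Cmod_ge_0].
Qed.

Lemma Csummable_ext (u v : nat -> C) :
  (forall n, u n = v n) -> Csummable u -> Csummable v.
Proof. intros E. apply ex_series_ext. intros n. now rewrite E. Qed.

Lemma CSeries_ext (u v : nat -> C) :
  (forall n, u n = v n) -> CSeries u = CSeries v.
Proof. intros E. unfold CSeries. f_equal; apply Series_ext; intros n; now rewrite E. Qed.

Lemma Csummable_plus (u v : nat -> C) :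
  Csummable u -> Csummable v -> Csummable (fun n => u n + v n).
Proof.
  intros Hu Hv. apply Csummable_le with (fun n => Cmod (u n) + Cmod (v n))%R.
  - intros n. apply Cmod_triangle.
  - exact (ex_series_plus _ _ Hu Hv).
Qed.

Lemma Csummable_scal (c : C) (u : nat -> C) :
  Csummable u -> Csummable (fun n => c * u n).
Proof.
  intros Hu. apply Csummable_le with (fun n => Cmod c * Cmod (u n))%R.
  - intros n. rewrite Cmod_mult. lra.
  - exact (ex_series_scal_l (Cmod c) _ Hu).
Qed.

Lemma Csummable_shift (u : nat -> C) :
  Csummable u <-> Csummable (fun n => u (S n)).
Proof. apply (ex_series_incr_1 (fun n => Cmod (u n))). Qed.

Lemma CSeries_plus (u v : nat -> C) : Csummable u -> Csummable v ->
  CSeries (fun n => u n + v n) = CSeries u + CSeries v.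
Proof.
  intros Hu Hv. unfold CSeries, Cplus. simpl.
  f_equal; rewrite <- Series_plus; auto using Csummable_Re, Csummable_Im.
Qed.

Lemma CSeries_scal (c : C) (u : nat -> C) : Csummable u ->
  CSeries (fun n => c * u n) = c * CSeries u.
Proof.
  intros Hu. unfold CSeries.
  assert (Hr := Csummable_Re _ Hu). assert (Hi := Csummable_Im _ Hu).
  assert (Er : forall k : R, ex_series (fun n => k * Re (u n))%R)
    by (intros k; exact (ex_series_scal_l k _ Hr)).
  assert (Ei : forall k : R, ex_series (fun n => k * Im (u n))%R)
    by (intros k; exact (ex_series_scal_l k _ Hi)).
  apply injective_projections; simpl.
  - rewrite (Series_ext _ (fun n => Re c * Re (u n) - Im c * Im (u n))%R) by reflexivity.
    rewrite Series_minus, !Series_scal_l; auto.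
  - rewrite (Series_ext _ (fun n => Re c * Im (u n) + Im c * Re (u n))%R) by reflexivity.
    rewrite Series_plus, !Series_scal_l; auto.
Qed.

Lemma CSeries_minus (u v : nat -> C) : Csummable u -> Csummable v ->
  CSeries (fun n => u n - v n) = CSeries u - CSeries v.
Proof.
  intros Hu Hv.
  rewrite (CSeries_ext _ (fun n => u n + (RtoC (-1)) * v n)).
  - rewrite CSeries_plus, CSeries_scal; auto using Csummable_scal.
    apply injective_projections; simpl; ring.
  - intros n. apply injective_projections; simpl; ring.
Qed.

Lemma CSeries_shift (u : nat -> C) : Csummable u ->
  CSeries u = u O + CSeries (fun n => u (S n)).
Proof.
  intros Hu. unfold CSeries.
  apply injective_projections; simpl.
  - apply (Series_incr_1 (fun n => Re (u n))). now apply Csummable_Re.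
  - apply (Series_incr_1 (fun n => Im (u n))). now apply Csummable_Im.
Qed.

Lemma CSeries_0 : CSeries (fun _ => 0) = 0.
Proof.
  unfold CSeries. simpl.
  assert (E : Series (fun _ => 0%R) = 0%R).
  { rewrite (Series_ext _ (fun _ => 0 * 0)%R) by (intros; ring).
    rewrite Series_scal_l. ring. }
  now rewrite E.
Qed.

Lemma CSeries_correct (u : nat -> C) : Csummable u -> Cis_series u (CSeries u).
Proof.
  intros Hu. apply Cis_series_Clim. intros eps Heps.
  assert (Hr := Series_correct _ (Csummable_Re _ Hu)).
  assert (Hi := Series_correct _ (Csummable_Im _ Hu)).
  assert (He : 0 < eps / 2) by lra.
  destruct (proj1 (filterlim_locally _ _) Hr (mkposreal _ He)) as [N1 H1].
  destruct (proj1 (filterlim_locally _ _) Hi (mkposreal _ He)) as [N2 H2].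
  assert (ER : forall n, Re (Csum u (S n)) = sum_n (fun n => Re (u n)) n).
  { induction n as [|n IH]; [rewrite sum_O; unfold Re; simpl; ring|].
    rewrite sum_Sn, <- IH. reflexivity. }
  assert (EI : forall n, Im (Csum u (S n)) = sum_n (fun n => Im (u n)) n).
  { induction n as [|n IH]; [rewrite sum_O; unfold Im; simpl; ring|].
    rewrite sum_Sn, <- IH. reflexivity. }
  exists (S (N1 + N2)). intros [|n] Hn; [lia|].
  assert (A1 := H1 n ltac:(lia)). assert (A2 := H2 n ltac:(lia)).
  rewrite <- ER in A1. rewrite <- EI in A2.
  change (Rabs (Re (Csum u (S n)) - Series (fun n => Re (u n))) < eps / 2) in A1.
  change (Rabs (Im (Csum u (S n)) - Series (fun n => Im (u n))) < eps / 2) in A2.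
  set (d := Csum u (S n) - CSeries u).
  change (Rabs (Re d) < eps / 2) in A1. change (Rabs (Im d) < eps / 2) in A2.
  assert (Ed : d = RtoC (Re d) + Ci * RtoC (Im d)).
  { destruct d; apply injective_projections; simpl; ring. }
  rewrite Ed. eapply Rle_lt_trans; [apply Cmod_triangle|].
  rewrite Cmod_mult, Cmod_Ci, !Cmod_R. lra.
Qed.

Lemma CSeries_unique (u : nat -> C) (v : C) :
  Csummable u -> Cis_series u v -> CSeries u = v.
Proof. intros Hu Hv. eapply Cis_series_unique; eauto. now apply CSeries_correct. Qed.

Lemma Cmod_Csum_le (u : nat -> C) (n : nat) : Csummable u ->
  (Cmod (Csum u n) <= Series (fun k => Cmod (u k))).
Proof.
  revert u. induction n as [|n IH]; intros u Hu.
  - simpl. rewrite Cmod_0. replace 0%R with (Series (fun _ => 0 * 0)%R).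
    + apply Series_le; auto. intros k. split; [lra|]. rewrite Rmult_0_l. apply Cmod_ge_0.
    + rewrite Series_scal_l. ring.
  - assert (E : forall u m, Csum u (S m) = u O + Csum (fun k => u (S k)) m).
    { intros w m. induction m as [|m IHm]; [cbn [Csum]; ring|].
      change (Csum w (S (S m))) with (Csum w (S m) + w (S m)).
      rewrite IHm. cbn [Csum]. ring. }
    rewrite E, Series_incr_1; auto.
    tri. apply Rplus_le_compat_l.
    apply (IH (fun k => u (S k))). now apply Csummable_shift in Hu.
Qed.

Lemma Cmod_CSeries_le (u : nat -> C) : Csummable u ->
  (Cmod (CSeries u) <= Series (fun n => Cmod (u n))).
Proof.
  intros Hu. apply le_epsilon. intros eps Heps.
  destruct (proj1 (Cis_series_Clim _ _) (CSeries_correct u Hu) eps Heps) as [N HN].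
  specialize (HN N (Nat.le_refl N)).
  replace (CSeries u) with (Csum u N + - (Csum u N - CSeries u)) by ring.
  tri. rewrite Cmod_opp.
  assert (B := Cmod_Csum_le u N Hu). lra.
Qed.

Lemma Csum_CSeries (u : nat -> C) (n : nat) : 
  (forall k, (n <= k)%nat -> u k = 0) -> Csummable u /\ CSeries u = Csum u n.
Proof.
  intros Hz.
  assert (Hs : Csummable u).
  { apply (ex_series_incr_n (fun n => Cmod (u n)) n).
    apply ex_series_ext with (fun k => 0 * (1 / 2) ^ k)%R.
    - intros k. rewrite Hz by lia. rewrite Cmod_0. apply Rmult_0_l.
    - apply (ex_series_scal_l 0 (fun k => (1 / 2) ^ k)%R).
      apply ex_series_geom. rewrite Rabs_pos_eq; lra. }
  split; auto. apply CSeries_unique; auto. apply Cis_series_Clim.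
  intros eps Heps. exists n. intros m Hm.
  replace (Csum u m) with (Csum u n).
  - replace (Csum u n - Csum u n) with (RtoC 0) by ring. now rewrite Cmod_0.
  - induction Hm as [|m Hm IH]; auto. simpl. rewrite <- IH, Hz by lia. ring.
Qed.

(** Tannery's theorem, i.e. dominated convergence for series, along an
    arbitrary filter.  Every exchange of limits below goes through it: double
    series, continuity and differentiability in a parameter, and the passage
    from the off-diagonal to the diagonal of the kernel. *)
Lemma Tannery {T : Type} (F : (T -> Prop) -> Prop) {FF : Filter F}
  (u : T -> nat -> C) (v : nat -> C) (M : nat -> R) :
  ex_series M ->
  F (fun t => forall n, (Cmod (u t n) <= M n)) ->
  (forall n, (Cmod (v n) <= M n)) ->
  (forall n, Clim F (fun t => u t n) (v n)) ->
  Clim F (fun t => CSeries (u t)) (CSeries v).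
Proof.
  intros HM Hu Hv Hlim eps Heps.
  (* Terms are split off one at a time until the tail of the majorant is small. *)
  assert (Key : forall N (d : T -> nat -> R) (M : nat -> R) e s, (0 < s) ->
    ex_series M -> F (fun t => forall n, (0 <= d t n <= M n)) ->
    (forall n e, (0 < e) -> F (fun t => (d t n < e))) ->
    (Series (fun k => M (N + k)%nat) < e) ->
    F (fun t => (Series (d t) < e + s))).
  { clear - FF. induction N as [|N IH]; intros d M e s Hs HM Hd Hl HN.
    - generalize Hd. apply filter_imp. intros t Ht.
      change (Series M < e) in HN.
      apply Rle_lt_trans with (Series M); [now apply Series_le|]. lra.
    - assert (G : F (fun t => (Series (fun k => d t (S k)) < e + s / 2))).
      { apply (IH (fun t k => d t (S k)) (fun k => M (S k))); auto.
        - lra.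
        - now apply (ex_series_incr_1 M).
        - generalize Hd. apply filter_imp. intros t Ht n. apply Ht. }
      assert (G0 := Hl O (s / 2)%R ltac:(lra)).
      generalize (filter_and _ _ Hd (filter_and _ _ G G0)). apply filter_imp.
      intros t [H1 [H2 H3]]. rewrite Series_incr_1.
      + lra.
      + apply ex_series_Rle with M; auto. intros n.
        destruct (H1 n). rewrite Rabs_pos_eq; lra. }
  assert (HM2 : ex_series (fun n => 2 * M n)%R) by exact (ex_series_scal_l 2 M HM).
  assert (Htail : exists N, (Series (fun k => 2 * M (N + k)%nat) < eps / 2)%R).
  { assert (H := Series_correct _ HM2).
    assert (He : 0 < eps / 2) by lra.
    destruct (proj1 (filterlim_locally _ _) H (mkposreal _ He)) as [N HN].
    exists (S N). specialize (HN N (Nat.le_refl N)).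
    change (Rabs (sum_n (fun n => 2 * M n)%R N - Series (fun n => 2 * M n)%R) < eps / 2)%R
      in HN.
    rewrite (Series_incr_n (fun n => 2 * M n)%R (S N)) in HN; [|lia|auto].
    rewrite <- sum_n_Reals in HN. simpl pred in HN.
    apply Rabs_def2 in HN. destruct HN as [_ HN].
    change (Series (fun k => 2 * M (S N + k)%nat) < eps / 2)%R.
    lra. }
  destruct Htail as [N HN].
  assert (Hfin := Key N (fun t n => Cmod (u t n - v n)) (fun n => 2 * M n)%R
    (eps / 2)%R (eps / 2)%R ltac:(lra) HM2).
  assert (Hsv : Csummable v) by (apply Csummable_le with M; auto).
  assert (Hb : F (fun t => forall n, (0 <= Cmod (u t n - v n) <= 2 * M n))).
  { generalize Hu. apply filter_imp. intros t Ht n. split; [apply Cmod_ge_0|].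
    unfold Cminus. tri. rewrite Cmod_opp.
    specialize (Ht n). specialize (Hv n). lra. }
  specialize (Hfin Hb (fun n e He => Hlim n e He) HN).
  generalize (filter_and _ _ Hu (filter_and _ _ Hb Hfin)). apply filter_imp.
  intros t [Ht [Hbt Hft]].
  assert (Hsu : Csummable (u t)) by (apply Csummable_le with M; auto).
  rewrite <- CSeries_minus by auto.
  eapply Rle_lt_trans; [apply Cmod_CSeries_le|].
  - apply Csummable_le with (fun n => 2 * M n)%R; auto. intros n. apply Hbt.
  - lra.
Qed.

Lemma ex_series_bounded (u : nat -> R) (B : R) :
  (forall n, (0 <= u n)) -> (forall n, (sum_n u n <= B)) -> ex_series u.
Proof.
  intros Hu HB. apply ex_finite_lim_seq_incr with B; auto.
  intros n. rewrite sum_Sn. specialize (Hu (S n)).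
  unfold plus; simpl. lra.
Qed.

Lemma Series_le_bound (u : nat -> R) (B : R) :
  ex_series u -> (forall n, (sum_n u n <= B)) -> (Series u <= B).
Proof.
  intros Hu HB. 
  assert (H := is_lim_seq_le (sum_n u) (fun _ => B) (Series u) B HB).
  apply H; [|apply is_lim_seq_const]. now apply Series_correct.
Qed.

Lemma Rle_Series_term (u : nat -> R) (n : nat) :
  (forall n, (0 <= u n)) -> ex_series u -> (u n <= Series u).
Proof.
  revert u. induction n as [|n IH]; intros u Hu Hs; rewrite Series_incr_1 by auto.
  - assert (0 <= Series (fun k => u (S k))); [|lra].
    replace 0%R with (Series (fun _ => 0 * 0)%R) by (rewrite Series_scal_l; ring).
    apply Series_le; [|now apply (ex_series_incr_1 u)].
    intros k. specialize (Hu (S k)). lra.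
  - specialize (IH (fun k => u (S k)) (fun k => Hu (S k))
      (proj1 (ex_series_incr_1 u) Hs)). specialize (Hu O). simpl in IH. lra.
Qed.

Lemma sum_n_Series_swap (a : nat -> nat -> R) (N : nat) :
  (forall j, ex_series (fun i => a i j)) ->
  ex_series (fun i => sum_n (a i) N) /\
  Series (fun i => sum_n (a i) N) = sum_n (fun j => Series (fun i => a i j)) N.
Proof.
  intros H. induction N as [|N [IH1 IH2]].
  - split.
    + apply ex_series_ext with (fun i => a i O); auto. intros i. now rewrite sum_O.
    + rewrite sum_O. apply Series_ext. intros i. now rewrite sum_O.
  - split.
    + apply ex_series_ext with (fun i => sum_n (a i) N + a i (S N))%R.
      * intros i. now rewrite sum_Sn.
      * exact (ex_series_plus _ _ IH1 (H (S N))).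
    + rewrite sum_Sn, <- IH2. rewrite <- Series_plus; auto.
      apply Series_ext. intros i. now rewrite sum_Sn.
Qed.

(** Fubini for absolutely convergent double series: the partial sums in [j] may be
    taken inside the sum over [i], and dominated convergence does the rest. *)
Lemma CSeries_Fubini (a : nat -> nat -> C) (b : nat -> R) :
  (forall i, Csummable (a i)) ->
  (forall i, (Series (fun j => Cmod (a i j)) <= b i)) -> ex_series b ->
  (forall j, Csummable (fun i => a i j)) /\
  Csummable (fun j => CSeries (fun i => a i j)) /\
  ex_series (fun j => Series (fun i => Cmod (a i j))) /\
  (Series (fun j => Series (fun i => Cmod (a i j))) <= Series b) /\
  CSeries (fun j => CSeries (fun i => a i j)) = CSeries (fun i => CSeries (a i)).
Proof.
  intros Ha Hab Hb.
  assert (Hrow : forall i n, (sum_n (fun j => Cmod (a i j)) n <= b i)).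
  { intros i n. eapply Rle_trans; [|apply Hab].
    clear - Ha. specialize (Ha i).
    assert (P : forall j, (0 <= Cmod (a i j))) by (intros; apply Cmod_ge_0).
    rewrite (Series_incr_n _ (S n)); [|lia|exact Ha]. simpl pred. rewrite sum_n_Reals.
    assert (0 <= Series (fun k => Cmod (a i (S n + k)%nat))); [|lra].
    assert (Hs : ex_series (fun k => Cmod (a i (S n + k)%nat)))
      by now apply (ex_series_incr_n (fun j => Cmod (a i j))).
    apply Rle_trans with (Cmod (a i (S n + 0)%nat)); [apply P|].
    apply (Rle_Series_term (fun k => Cmod (a i (S n + k)%nat)) O); auto. }
  assert (Hcol : forall j, Csummable (fun i => a i j)).
  { intros j. apply Csummable_le with b; auto. intros i.
    eapply Rle_trans; [|apply Hab].
    apply (Rle_Series_term (fun j => Cmod (a i j))); [intros; apply Cmod_ge_0|apply Ha]. }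
  assert (Hpart : forall n,
    (sum_n (fun j => Series (fun i => Cmod (a i j))) n <= Series b)).
  { intros n.
    destruct (sum_n_Series_swap (fun i j => Cmod (a i j)) n Hcol) as [H1 H2].
    rewrite <- H2. apply Series_le; auto. intros i. split; [|apply Hrow].
    clear. induction n as [|n IH]; [rewrite sum_O; apply Cmod_ge_0|].
    rewrite sum_Sn. unfold plus; simpl. assert (P := Cmod_ge_0 (a i (S n))). lra. }
  assert (Habs : ex_series (fun j => Series (fun i => Cmod (a i j)))).
  { apply ex_series_bounded with (Series b); auto.
    intros j. eapply Rle_trans; [apply Cmod_ge_0|].
    apply (Cmod_CSeries_le _ (Hcol j)). }
  assert (Hc : Csummable (fun j => CSeries (fun i => a i j))).
  { apply Csummable_le with (fun j => Series (fun i => Cmod (a i j))); auto.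
    intros j. now apply Cmod_CSeries_le. }
  split; [auto|]. split; [auto|]. split; [auto|]. split; [now apply Series_le_bound|].
  apply CSeries_unique; auto. apply Cis_series_Clim.
  assert (Hswap : forall n, Csummable (fun i => Csum (a i) n) /\
    CSeries (fun i => Csum (a i) n) = Csum (fun j => CSeries (fun i => a i j)) n).
  { induction n as [|n [IH1 IH2]].
    - simpl. split.
      + apply (Csum_CSeries (fun _ => 0) O); auto.
      + apply CSeries_0.
    - simpl. split; [now apply Csummable_plus|].
      rewrite CSeries_plus, IH2; auto. }
  apply Clim_ext with (fun n => CSeries (fun i => Csum (a i) n)).
  { apply eventually_filter. }
  { intros n. apply Hswap. }
  apply (Tannery eventually) with b; auto using eventually_filter.
  - exists O. intros n _ i. eapply Rle_trans; [now apply Cmod_Csum_le|]. apply Hab.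
  - intros i. eapply Rle_trans; [now apply Cmod_CSeries_le|]. apply Hab.
  - intros i. apply Cis_series_Clim. now apply CSeries_correct.
Qed.

Lemma CSeries_shift_zeros (u : nat -> C) (n : nat) :
  (forall k, (k < n)%nat -> u k = 0) -> CSeries u = CSeries (fun k => u (n + k)%nat).
Proof.
  intros H. unfold CSeries.
  f_equal.
  - apply (Series_incr_n_aux (fun k => Re (u k))). intros k Hk. now rewrite H.
  - apply (Series_incr_n_aux (fun k => Im (u k))). intros k Hk. now rewrite H.
Qed.

Lemma Csum_ext (u v : nat -> C) (n : nat) :
  (forall k, (k < n)%nat -> u k = v k) -> Csum u n = Csum v n.
Proof.
  intros H. induction n as [|n IH]; cbn [Csum]; auto. rewrite IH, H; auto.
Qed.

Lemma Csum_scal_r (u : nat -> C) (c : C) (n : nat) :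
  Csum (fun k => u k * c) n = Csum u n * c.
Proof. induction n as [|n IH]; cbn [Csum]; [ring|]. rewrite IH. ring. Qed.

(** The form in which double series occur below: Cauchy products, and substitutions in
    power series, collect a double series along its antidiagonals. *)
Lemma CSeries_triangle (g : nat -> nat -> C) (b : nat -> R) :
  (forall i, Csummable (g i)) ->
  (forall i, (Series (fun k => Cmod (g i k)) <= b i)) -> ex_series b ->
  let diag := fun n => Csum (fun i => g i (n - i)%nat) (S n) in
  Csummable diag /\ (Series (fun n => Cmod (diag n)) <= Series b) /\
  CSeries diag = CSeries (fun i => CSeries (g i)).
Proof.
  intros Hg Hgb Hb diag.
  set (c := fun i n => if le_dec i n then g i (n - i)%nat else 0).
  assert (H1 : forall i k, (k < i)%nat -> c i k = 0)
    by (intros i k Hk; unfold c; destruct (le_dec i k); [lia|auto]).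
  assert (H2 : forall i k, c i (i + k)%nat = g i k).
  { intros i k. unfold c. destruct (le_dec i (i + k)); [|lia]. f_equal. lia. }
  assert (Hcol : forall n, CSeries (fun i => c i n) = diag n).
  { intros n. destruct (Csum_CSeries (fun i => c i n) (S n)) as [_ ->].
    - intros k Hk. apply H1. lia.
    - apply Csum_ext. intros k Hk. unfold c. destruct (le_dec k n); [auto|lia]. }
  assert (Hrs : forall i, Csummable (c i)).
  { intros i. apply (ex_series_incr_n (fun n => Cmod (c i n)) i).
    apply (Csummable_ext (g i)); auto. }
  assert (Hrn : forall i, (Series (fun n => Cmod (c i n)) <= b i)).
  { intros i. rewrite (Series_incr_n_aux _ i) by (intros k Hk; rewrite H1, Cmod_0; auto).
    rewrite (Series_ext _ (fun k => Cmod (g i k))) by (intros k; now rewrite H2). auto. }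
  destruct (CSeries_Fubini c b Hrs Hrn Hb) as (F1 & F2 & F2' & F3 & F4).
  split; [now apply (Csummable_ext _ _ Hcol)|split].
  - eapply Rle_trans; [|apply F3]. apply Series_le; auto.
    intros n. split; [apply Cmod_ge_0|]. rewrite <- Hcol. now apply Cmod_CSeries_le.
  - rewrite <- (CSeries_ext _ _ Hcol), F4. apply CSeries_ext. intros i.
    rewrite (CSeries_shift_zeros _ i) by auto. now apply CSeries_ext.
Qed.

(** * Complex derivatives *)

Definition Cpunct (P : C -> Prop) : Prop :=
  exists delta : R, (0 < delta) /\ forall h : C, (0 < Cmod h < delta) -> P h.

Global Instance Cpunct_filter : ProperFilter Cpunct.
Proof.
  constructor.
  - intros P (d & Hd & H). exists (RtoC (d / 2)). apply H.
    rewrite Cmod_pos; lra.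
  - constructor.
    + exists 1%R. split; [lra|auto].
    + intros P Q (d & Hd & H) (d' & Hd' & H').
      exists (Rmin d d'). split; [now apply Rmin_pos|].
      intros h Hh. assert (A := Rmin_l d d'). assert (B := Rmin_r d d').
      split; [apply H | apply H']; lra.
    + intros P Q HPQ (d & Hd & H). exists d. split; auto.
Qed.

(** The derivative as a limit of difference quotients; in this form [Tannery]
    differentiates series term by term. *)
Definition Cder (f : C -> C) (x d : C) : Prop :=
  Clim Cpunct (fun h => (f (x + h) - f x) / h) d.

Lemma Cpunct_neq0 : Cpunct (fun h => h <> 0).
Proof. exists 1%R. split; [lra|]. intros h [Hh _]. now apply Cmod_gt_0. Qed.

Lemma Clim_Cpunct_id : Clim Cpunct (fun h => h) 0.
Proof.
  intros eps Heps. exists eps. split; auto. intros h [_ Hh].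
  now replace (h - 0) with h by ring.
Qed.

Lemma Cder_cont (f : C -> C) (x d : C) :
  Cder f x d -> Clim Cpunct (fun h => f (x + h)) (f x).
Proof.
  intros H.
  replace (f x) with (f x + 0 * d) at 1 by ring.
  apply Clim_ext_loc with (fun h => f x + h * ((f (x + h) - f x) / h)).
  - apply Cpunct_filter.
  - generalize Cpunct_neq0. apply filter_imp. intros h Hh. field. auto.
  - apply Clim_plus; try apply Cpunct_filter.
    + apply Clim_const, Cpunct_filter.
    + apply Clim_mult; auto using Clim_Cpunct_id. apply Cpunct_filter.
Qed.

Lemma Cder_ext_loc (f g : C -> C) (x d : C) :
  f x = g x -> Cpunct (fun h => f (x + h) = g (x + h)) -> Cder f x d -> Cder g x d.
Proof.
  intros E0 E. apply Clim_ext_loc; [apply Cpunct_filter|].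
  generalize E. apply filter_imp. intros h Hh. now rewrite Hh, E0.
Qed.

Lemma Cder_ext (f g : C -> C) (x d : C) :
  (forall y, f y = g y) -> Cder f x d -> Cder g x d.
Proof. intros E. apply Cder_ext_loc; auto. now apply filter_forall. Qed.

Lemma Cder_const (c x : C) : Cder (fun _ => c) x 0.
Proof.
  apply Clim_ext_loc with (fun _ => RtoC 0); try apply Cpunct_filter.
  - generalize Cpunct_neq0. apply filter_imp. intros h Hh. field. auto.
  - apply Clim_const, Cpunct_filter.
Qed.

Lemma Cder_id (x : C) : Cder (fun y => y) x 1.
Proof.
  apply Clim_ext_loc with (fun _ => RtoC 1); try apply Cpunct_filter.
  - generalize Cpunct_neq0. apply filter_imp. intros h Hh. field. auto.
  - apply Clim_const, Cpunct_filter.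
Qed.

Lemma Cder_plus (f g : C -> C) (x d e : C) :
  Cder f x d -> Cder g x e -> Cder (fun y => f y + g y) x (d + e).
Proof.
  intros Hf Hg.
  apply Clim_ext_loc with
    (fun h => (f (x + h) - f x) / h + (g (x + h) - g x) / h); try apply Cpunct_filter.
  - generalize Cpunct_neq0. apply filter_imp. intros h Hh. field. auto.
  - apply Clim_plus; auto. apply Cpunct_filter.
Qed.

Lemma Cder_mult (f g : C -> C) (x d e : C) :
  Cder f x d -> Cder g x e -> Cder (fun y => f y * g y) x (d * g x + f x * e).
Proof.
  intros Hf Hg.
  apply Clim_ext_loc with
    (fun h => (f (x + h) - f x) / h * g (x + h) + f x * ((g (x + h) - g x) / h));
    try apply Cpunct_filter.
  - generalize Cpunct_neq0. apply filter_imp. intros h Hh. field. auto.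
  - apply Clim_plus; try apply Cpunct_filter.
    + apply Clim_mult; auto. apply Cpunct_filter. eapply Cder_cont; eauto.
    + apply Clim_scal; auto. apply Cpunct_filter.
Qed.

Lemma Cder_inv (f : C -> C) (x d : C) :
  f x <> 0 -> Cder f x d -> exists e, Cder (fun y => / f y) x e.
Proof.
  intros Hx Hf. exists (RtoC (-1) * d * (/ f x * / f x)).
  assert (Hc := Cder_cont _ _ _ Hf).
  assert (Hn : Cpunct (fun h => f (x + h) <> 0)).
  { assert (Hp : 0 < Cmod (f x)) by now apply Cmod_gt_0.
    generalize (Hc _ Hp). apply filter_imp. intros h Hh E. rewrite E in Hh.
    replace (0 - f x) with (- f x) in Hh by ring. rewrite Cmod_opp in Hh. lra. }
  apply Clim_ext_loc with
    (fun h => RtoC (-1) * ((f (x + h) - f x) / h) * (/ f (x + h) * / f x));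
    try apply Cpunct_filter.
  - generalize (filter_and _ _ Hn Cpunct_neq0). apply filter_imp.
    intros h [H1 H2]. field. auto.
  - apply Clim_mult; try apply Cpunct_filter.
    + apply Clim_scal; auto. apply Cpunct_filter.
    + apply Clim_mult; try apply Cpunct_filter.
      * apply Clim_inv; auto. apply Cpunct_filter.
      * apply Clim_const, Cpunct_filter.
Qed.

Lemma Cder_shift (f : C -> C) (x c d : C) :
  Cder f (x + c) d -> Cder (fun y => f (y + c)) x d.
Proof.
  apply Clim_ext; [apply Cpunct_filter|]. intros h.
  now replace (x + c + h) with (x + h + c) by ring.
Qed.

Lemma Clim_Cmod_le {T : Type} (F : (T -> Prop) -> Prop) {FF : ProperFilter F}
  (f : T -> C) (l : C) (B : R) :
  F (fun t => (Cmod (f t) <= B)) -> Clim F f l -> (Cmod l <= B).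
Proof.
  intros HB H. apply le_epsilon. intros eps Heps.
  destruct (filter_ex _ (filter_and _ _ HB (H eps Heps))) as [t [H1 H2]].
  replace l with (f t + - (f t - l)) by ring.
  tri. rewrite Cmod_opp. lra.
Qed.

Lemma Cder_series_aux (t : nat -> C -> C) (x : C) (d : nat -> C) (M : nat -> R)
  (delta : R) : (0 < delta) -> ex_series M ->
  (forall n, Cder (t n) x (d n)) ->
  (forall n h, Cmod h < delta -> (Cmod (t n (x + h)%C) <= M n)) ->
  (forall n h, Cmod h < delta ->
     (Cmod (t n (x + h)%C - t n x) <= M n * Cmod h)) ->
  Cder (fun y => CSeries (fun n => t n y)) x (CSeries d).
Proof.
  intros Hdelta HM Hd Hb HL.
  set (q := fun h n => (t n (x + h) - t n x) / h).
  assert (Hq : Cpunct (fun h => forall n, (Cmod (q h n) <= M n))).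
  { exists delta. split; auto. intros h [Hh0 Hh] n. unfold q.
    assert (h <> 0) by now apply Cmod_gt_0.
    rewrite Cmod_div by auto. apply Rle_div_l; auto. }
  apply Clim_ext_loc with (fun h => CSeries (q h)); try apply Cpunct_filter.
  - exists delta. split; auto. intros h [Hh0 Hh].
    assert (h <> 0) by now apply Cmod_gt_0.
    assert (S1 : Csummable (fun n => t n (x + h))) by (apply Csummable_le with M; auto).
    assert (S0 : Csummable (fun n => t n x)).
    { apply Csummable_le with M; auto. intros n.
      replace x with (x + 0) by ring. apply Hb. rewrite Cmod_0. lra. }
    rewrite <- CSeries_minus by auto. unfold q, Cdiv. rewrite Cmult_comm.
    rewrite <- CSeries_scal.
    + apply CSeries_ext. intros n. ring.
    + apply Csummable_le with (fun n => M n * Cmod h)%R; auto.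
      exact (ex_series_scal_r (Cmod h) M HM).
  - apply (Tannery Cpunct) with M; auto; try apply Cpunct_filter.
    intros n. apply Clim_Cmod_le with Cpunct (fun h => q h n);
      try apply Cpunct_filter; [|apply Hd].
    generalize Hq. apply filter_imp. auto.
Qed.

(** Termwise differentiation; the majorant is only required for the tail, since
    finitely many terms can be split off. *)
Lemma Cder_series (N : nat) (t : nat -> C -> C) (x : C) (M : nat -> R) (delta : R) :
  (0 < delta) -> ex_series M ->
  (forall n, exists d, Cder (t n) x d) ->
  (forall n h, Cmod h < delta -> (Cmod (t (N + n)%nat (x + h)%C) <= M n)) ->
  (forall n h, Cmod h < delta ->
     (Cmod (t (N + n)%nat (x + h)%C - t (N + n)%nat x) <= M n * Cmod h)) ->
  exists d, Cder (fun y => CSeries (fun n => t n y)) x d.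
Proof.
  intros Hdelta HM. revert t. induction N as [|N IH]; intros t Hd Hb HL.
  - destruct (Stdlib.Logic.ClassicalEpsilon.constructive_indefinite_description
      (fun d : nat -> C => forall n, Cder (t n) x (d n))) as [d Hd'].
    { exists (fun n => proj1_sig
        (Stdlib.Logic.ClassicalEpsilon.constructive_indefinite_description _ (Hd n))).
      intros n. exact (proj2_sig
        (Stdlib.Logic.ClassicalEpsilon.constructive_indefinite_description _ (Hd n))). }
    exists (CSeries d). eapply Cder_series_aux; eauto.
  - destruct (IH (fun n => t (S n)) (fun n => Hd (S n)) Hb HL) as [d1 Hd1].
    destruct (Hd O) as [d0 Hd0].
    exists (d0 + d1).
    assert (E : forall h, Cmod h < delta ->
      t O (x + h) + CSeries (fun n => t (S n) (x + h)) = CSeries (fun n => t n (x + h))).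
    { intros h Hh. symmetry. apply (CSeries_shift (fun n => t n (x + h))).
      apply (ex_series_incr_n (fun n => Cmod (t n (x + h)%C)) (S N)).
      apply ex_series_Rle with M; auto. intros n.
      rewrite Rabs_pos_eq; [now apply Hb|apply Cmod_ge_0]. }
    eapply Cder_ext_loc; [| |apply (Cder_plus _ _ _ _ _ Hd0 Hd1)].
    + replace x with (x + 0) by ring. apply E. rewrite Cmod_0. auto.
    + exists delta. split; auto. intros h [_ Hh]. now apply E.
Qed.

(** If a factor is bounded by [a n] with Lipschitz constant [b n], multiplying by it
    multiplies a common bound for the value and the Lipschitz constant by at most
    [a n + b n].  Gauss' product and the terms of the hypergeometric series are both
    estimated in this way. *)
Lemma product_Lipschitz (u r : nat -> C -> C) (a b P : nat -> R) (M delta : R) :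
  (0 < delta) -> (0 <= M) -> (forall n, 0 <= a n)%R -> (forall n, 0 <= b n)%R ->
  (1 <= P O) ->
  (forall n, (P n * (a n + b n) <= P (S n))) ->
  (forall n h, Cmod h < delta -> u (S n) h = u n h * r n h) ->
  (forall n h, Cmod h < delta -> (Cmod (r n h) <= a n)) ->
  (forall n h, Cmod h < delta -> (Cmod (r n h - r n 0) <= b n * Cmod h)) ->
  (forall h, Cmod h < delta -> (Cmod (u O h) <= M)) ->
  (forall h, Cmod h < delta -> (Cmod (u O h - u O 0) <= M * Cmod h)) ->
  forall n h, Cmod h < delta ->
    (0 <= P n) /\
    (Cmod (u n h) <= M * P n) /\ (Cmod (u n h - u n 0) <= M * P n * Cmod h).
Proof.
  intros Hdelta HM Ha Hb HP0 HP Hu Hra Hrb H0 H0'.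
  assert (D0 : Cmod 0 < delta) by (rewrite Cmod_0; auto).
  induction n as [|n IH]; intros h Hh.
  - assert (P1 := Cmod_ge_0 h). repeat split; [lra| |].
    + specialize (H0 h Hh). nra.
    + specialize (H0' h Hh). apply Rle_trans with (M * Cmod h)%R; auto.
      apply Rmult_le_compat_r; auto. nra.
  - destruct (IH h Hh) as (I0 & I1 & I2). destruct (IH 0 D0) as (_ & I3 & _).
    assert (P1 := Cmod_ge_0 h).
    assert (A := Ha n). assert (B := Hb n). assert (Q := HP n).
    assert (R1 := Hra n h Hh). assert (R2 := Hrb n h Hh).
    assert (MP : 0 <= M * P n) by now apply Rmult_le_pos.
    assert (MPS : M * P n * (a n + b n) <= M * P (S n)).
    { rewrite Rmult_assoc. now apply Rmult_le_compat_l. }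
    repeat split.
    + eapply Rle_trans; [|apply Q]. apply Rmult_le_pos; lra.
    + rewrite Hu, Cmod_mult by auto.
      apply Rle_trans with (M * P n * a n)%R.
      * apply Rmult_le_compat; auto using Cmod_ge_0.
      * assert (0 <= M * P n * b n) by now apply Rmult_le_pos. lra.
    + rewrite !Hu by auto.
      replace (u n h * r n h - u n 0 * r n 0)
        with ((u n h - u n 0) * r n h + u n 0 * (r n h - r n 0)) by ring.
      tri. rewrite !Cmod_mult.
      assert (Cmod (u n h - u n 0) * Cmod (r n h) <= M * P n * Cmod h * a n)
        by (apply Rmult_le_compat; auto using Cmod_ge_0).
      assert (Cmod (u n 0) * Cmod (r n h - r n 0) <= M * P n * (b n * Cmod h))
        by (apply Rmult_le_compat; auto using Cmod_ge_0).
      apply Rle_trans with (M * P n * (a n + b n) * Cmod h)%R; [lra|].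
      now apply Rmult_le_compat_r.
Qed.

(** * The complex exponential *)

Lemma Cexp_plus (a b : C) : Cexp (a + b) = Cexp a * Cexp b.
Proof.
  unfold Cexp. destruct a as [a1 a2], b as [b1 b2]. simpl.
  rewrite exp_plus, cos_plus, sin_plus. apply injective_projections; simpl; ring.
Qed.

Lemma Cexp_0 : Cexp 0 = 1.
Proof.
  unfold Cexp. simpl. rewrite exp_0, cos_0, sin_0.
  apply injective_projections; simpl; ring.
Qed.

Lemma Cexp_neq0 (a : C) : Cexp a <> 0.
Proof.
  intros E. assert (H := Cexp_plus a (- a)).
  replace (a + - a) with (RtoC 0) in H by ring. rewrite Cexp_0, E in H.
  apply C1_nz. rewrite H. ring.
Qed.

Lemma Cexp_real (r : R) : Cexp r = RtoC (exp r).
Proof.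
  unfold Cexp. simpl. rewrite cos_0, sin_0. apply injective_projections; simpl; ring.
Qed.

Lemma Cmod_Cexp (a : C) : Cmod (Cexp a) = exp (Re a).
Proof.
  unfold Cexp. rewrite Cmod_mult, Cmod_pos by (left; apply exp_pos).
  replace (Cmod (cos (Im a), sin (Im a))) with 1%R; [ring|].
  assert (H := sin2_cos2 (Im a)). unfold Rsqr in H.
  unfold Cmod. cbn [fst snd].
  replace (cos (Im a) ^ 2 + sin (Im a) ^ 2)%R with 1%R by lra.
  symmetry. apply sqrt_1.
Qed.

Lemma Rabs_exp_minus_1 (x : R) : (Rabs (exp x - 1) <= Rabs x * exp (Rabs x)).
Proof.
  assert (H1 := exp_ineq1_le x). assert (H2 := exp_ineq1_le (- x)).
  assert (E : (exp x * exp (- x) = 1)%R).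
  { rewrite <- exp_plus. replace (x + - x)%R with 0%R by ring. apply exp_0. }
  assert (P := exp_pos x).
  destruct (Rle_dec 0 x) as [Hx|Hx].
  - rewrite !Rabs_pos_eq by lra. nra.
  - rewrite (Rabs_left1 x) by lra.
    assert (exp x < 1) by (rewrite <- exp_0; apply exp_increasing; lra).
    rewrite Rabs_left1 by lra.
    assert (1 <= exp (- x)) by (rewrite <- exp_0; left; apply exp_increasing; lra).
    nra.
Qed.

Lemma Rabs_exp_minus_1_minus_id (x : R) :
  (Rabs (exp x - 1 - x) <= x * x * exp (Rabs x)).
Proof.
  assert (H1 := exp_ineq1_le x). assert (H2 := exp_ineq1_le (- x)).
  assert (E : (exp x * exp (- x) = 1)%R).
  { rewrite <- exp_plus. replace (x + - x)%R with 0%R by ring. apply exp_0. }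
  assert (P := exp_pos x).
  rewrite Rabs_pos_eq by lra.
  assert (exp x - 1 <= x * exp x) by nra.
  apply Rle_trans with (x * (exp x - 1))%R; [lra|].
  eapply Rle_trans; [apply Rle_abs|]. rewrite Rabs_mult.
  replace (x * x)%R with (Rabs x * Rabs x)%R
    by (rewrite <- Rabs_mult; apply Rabs_pos_eq; nra).
  rewrite Rmult_assoc. apply Rmult_le_compat_l; [apply Rabs_pos|].
  apply Rabs_exp_minus_1.
Qed.

Lemma Rabs_sin_le (y : R) : (Rabs (sin y) <= Rabs y).
Proof.
  assert (H : forall y, (0 < y) -> (Rabs (sin y) <= y)).
  { intros t Ht. destruct (Rle_dec t 1) as [H1|H1].
    - assert (A := sin_lt_x t Ht).
      assert (0 <= sin t) by (apply sin_ge_0; [lra|assert (X := PI2_1); lra]).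
      rewrite Rabs_pos_eq; lra.
    - assert (X := SIN_bound t). apply Rabs_le. lra. }
  destruct (total_order_T y 0) as [[Hy|Hy]|Hy].
  - assert (A := H (- y)%R ltac:(lra)). rewrite sin_neg, Rabs_Ropp in A.
    rewrite (Rabs_left y); lra.
  - subst. rewrite sin_0. lra.
  - rewrite (Rabs_pos_eq y) by lra. apply H. lra.
Qed.

Lemma Rabs_cos_minus_1 (y : R) :
  (Rabs (cos y - 1) <= Rabs y) /\ (Rabs (cos y - 1) <= y * y / 2).
Proof.
  assert (E : (cos y - 1 = - (2 * (sin (y / 2) * sin (y / 2))))%R).
  { replace y with (2 * (y / 2))%R at 1 by field. rewrite cos_2a_sin. ring. }
  rewrite E, Rabs_Ropp, Rabs_pos_eq by nra.
  assert (B := Rabs_sin_le (y / 2)).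
  assert (Ey : (Rabs (y / 2) = Rabs y / 2)%R).
  { unfold Rdiv. rewrite Rabs_mult, (Rabs_pos_eq (/ 2)); lra. }
  rewrite Ey in B.
  assert (S1 := SIN_bound (y / 2)).
  assert (P := Rabs_pos (sin (y / 2))).
  assert (Q : Rabs (sin (y / 2)) <= 1) by (apply Rabs_le; lra).
  assert (Es : (sin (y / 2) * sin (y / 2) = Rabs (sin (y / 2)) * Rabs (sin (y / 2)))%R).
  { rewrite <- Rabs_mult. symmetry. apply Rabs_pos_eq. nra. }
  assert (Eyy : (y * y = Rabs y * Rabs y)%R).
  { rewrite <- Rabs_mult. symmetry. apply Rabs_pos_eq. nra. }
  rewrite Es, Eyy. split; nra.
Qed.

Lemma Rabs_sin_minus_id (y : R) : (Rabs (sin y - y) <= y * y).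
Proof.
  destruct (MVT_gen (fun t => sin t - t)%R 0 y (fun t => cos t - 1)%R) as [c [Hc E]].
  - intros t _. auto_derive; auto; ring.
  - intros t _. apply continuity_pt_minus.
    + apply continuity_sin.
    + apply derivable_continuous_pt, derivable_pt_id.
  - rewrite sin_0 in E. replace (sin y - y)%R with ((cos c - 1) * y)%R by lra.
    rewrite Rabs_mult.
    assert (Rabs c <= Rabs y).
    { unfold Rmin, Rmax in Hc. destruct (Rle_dec 0 y).
      - rewrite !Rabs_pos_eq; lra.
      - rewrite !Rabs_left1; lra. }
    assert (B := proj1 (Rabs_cos_minus_1 c)).
    replace (y * y)%R with (Rabs y * Rabs y)%R
      by (rewrite <- Rabs_mult; apply Rabs_pos_eq; nra).
    apply Rmult_le_compat_r; [apply Rabs_pos|lra].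
Qed.

Lemma Rabs_re_im_Cmod (d : C) : (Cmod d <= Rabs (Re d) + Rabs (Im d)).
Proof.
  assert (Ed : d = RtoC (Re d) + Ci * RtoC (Im d))
    by (destruct d; apply injective_projections; simpl; ring).
  rewrite Ed at 1. tri.
  rewrite Cmod_mult, Cmod_Ci, !Cmod_R. lra.
Qed.

Lemma Cexp_second_order (w : C) :
  (Cmod (Cexp w - 1 - w) <= 3 * (Cmod w * Cmod w) * exp (Cmod w)).
Proof.
  set (m := Cmod w). assert (Hm := Cmod_ge_0 w). fold m in Hm.
  assert (Hx : Rabs (Re w) <= m) by apply re_le_Cmod.
  assert (Hy : Rabs (Im w) <= m) by apply im_le_Cmod.
  assert (Hm2 : (m * m = Re w * Re w + Im w * Im w)%R).
  { assert (H := Cmod2_alt w). fold m in H. simpl in H. lra. }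
  destruct w as [x y]. simpl in Hx, Hy, Hm2.
  assert (Eexp : exp (Rabs x) <= exp m).
  { destruct Hx as [Hx|Hx]; [left; now apply exp_increasing|rewrite Hx; lra]. }
  assert (E1 : 1 + m <= exp m) by apply exp_ineq1_le.
  assert (X1 := Rabs_exp_minus_1 x). assert (X2 := Rabs_exp_minus_1_minus_id x).
  assert (C2 := proj2 (Rabs_cos_minus_1 y)).
  assert (S1 := Rabs_sin_le y). assert (S2 := Rabs_sin_minus_id y).
  assert (Cb : Rabs (cos y) <= 1) by (apply Rabs_le; assert (T := COS_bound y); lra).
  assert (Px := Rabs_pos x). assert (Py := Rabs_pos y).
  assert (Exx : (x * x = Rabs x * Rabs x)%R)
    by (rewrite <- Rabs_mult; symmetry; apply Rabs_pos_eq; nra).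
  assert (Eyy : (y * y = Rabs y * Rabs y)%R)
    by (rewrite <- Rabs_mult; symmetry; apply Rabs_pos_eq; nra).
  rewrite Exx in X2, Hm2. rewrite Eyy in C2, S2, Hm2.
  set (X := Rabs x) in *. set (Y := Rabs y) in *.
  eapply Rle_trans; [apply Rabs_re_im_Cmod|].
  assert (ER : Re (Cexp (x, y) - 1 - (x, y))
    = ((exp x - 1 - x) * cos y + (1 + x) * (cos y - 1))%R) by (simpl; ring).
  assert (EI : Im (Cexp (x, y) - 1 - (x, y))
    = ((exp x - 1) * sin y + (sin y - y))%R) by (simpl; ring).
  rewrite ER, EI.
  assert (B1 : Rabs ((exp x - 1 - x) * cos y) <= X * X * exp m).
  { rewrite Rabs_mult. apply Rle_trans with (X * X * exp X * 1)%R.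
    - apply Rmult_le_compat; auto using Rabs_pos.
    - rewrite Rmult_1_r. apply Rmult_le_compat_l; auto. nra. }
  assert (B2 : Rabs ((1 + x) * (cos y - 1)) <= exp m * (Y * Y / 2)).
  { rewrite Rabs_mult. apply Rmult_le_compat; auto using Rabs_pos.
    eapply Rle_trans; [apply Rabs_triang|]. rewrite Rabs_R1. fold X. lra. }
  assert (B3 : Rabs ((exp x - 1) * sin y) <= X * exp m * Y).
  { rewrite Rabs_mult. apply Rmult_le_compat; auto using Rabs_pos.
    eapply Rle_trans; [apply X1|]. apply Rmult_le_compat_l; auto. }
  assert (B4 : Rabs (sin y - y) <= exp m * (Y * Y)).
  { eapply Rle_trans; [apply S2|]. assert (0 <= Y * Y) by nra. nra. }
  assert (T1 := Rabs_triang ((exp x - 1 - x) * cos y) ((1 + x) * (cos y - 1))).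
  assert (T2 := Rabs_triang ((exp x - 1) * sin y) (sin y - y)).
  assert (0 < exp m) by apply exp_pos.
  assert (X * X + Y * Y / 2 + X * Y + Y * Y <= 3 * (m * m)) by (rewrite Hm2; nra).
  apply Rle_trans with ((X * X + Y * Y / 2 + X * Y + Y * Y) * exp m)%R; [lra|].
  apply Rmult_le_compat_r; lra.
Qed.

Lemma Cder_Cexp_linear (c s : C) : exists d, Cder (fun y => Cexp (y * c)) s d.
Proof.
  exists (Cexp (s * c) * c).
  apply Clim_ext_loc with (fun h => Cexp (s * c) * (c + (Cexp (h * c) - 1 - h * c) / h));
    try apply Cpunct_filter.
  { generalize Cpunct_neq0. apply filter_imp. intros h Hh.
    replace ((s + h) * c) with (s * c + h * c) by ring. rewrite Cexp_plus. field. auto. }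
  apply Clim_scal; [apply Cpunct_filter|].
  cut (Clim Cpunct (fun h => c + (Cexp (h * c) - 1 - h * c) / h) (c + 0));
    [now rewrite Cplus_0_r|].
  apply Clim_plus; try apply Cpunct_filter; [apply Clim_const, Cpunct_filter|].
  intros eps Heps.
  set (K := (3 * (Cmod c * Cmod c) * exp (Cmod c))%R).
  assert (Hc := Cmod_ge_0 c). assert (He := exp_pos (Cmod c)).
  assert (HK : 0 <= K) by (unfold K; apply Rmult_le_pos; [nra|lra]).
  assert (Hd : 0 < eps / (K + 1)) by (apply Rdiv_lt_0_compat; lra).
  exists (Rmin 1 (eps / (K + 1))). split; [apply Rmin_pos; lra|].
  intros h [Hh0 Hh]. assert (h <> 0) by now apply Cmod_gt_0.
  assert (M1 := Rmin_l 1 (eps / (K + 1))). assert (M2 := Rmin_r 1 (eps / (K + 1))).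
  replace ((Cexp (h * c) - 1 - h * c) / h - 0)
    with ((Cexp (h * c) - 1 - h * c) / h) by (field; auto).
  rewrite Cmod_div by auto.
  assert (B := Cexp_second_order (h * c)). rewrite Cmod_mult in B.
  assert (exp (Cmod h * Cmod c) <= exp (Cmod c)).
  { destruct (Req_dec (Cmod h * Cmod c) (Cmod c)) as [E|E]; [rewrite E; lra|].
    left. apply exp_increasing. assert (Cmod h * Cmod c <= 1 * Cmod c); [|lra].
    apply Rmult_le_compat_r; lra. }
  apply Rle_lt_trans with (K * Cmod h)%R.
  - apply Rle_div_l; auto. eapply Rle_trans; [apply B|].
    apply Rle_trans with (3 * (Cmod h * Cmod c * (Cmod h * Cmod c)) * exp (Cmod c))%R.
    + apply Rmult_le_compat_l; auto. nra.
    + unfold K. right. ring.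
  - apply Rle_lt_trans with (K * (eps / (K + 1)))%R; [apply Rmult_le_compat_l; lra|].
    replace eps with ((K + 1) * (eps / (K + 1)))%R at 2 by (field; lra). nra.
Qed.

(** * The reciprocal Gamma function *)

Lemma RtoC_neq0 (r : R) : r <> 0%R -> RtoC r <> 0.
Proof. intros H E. apply H. now apply RtoC_inj. Qed.

Lemma INR_fact_neq0 (n : nat) : RtoC (INR (fact n)) <> 0.
Proof. apply RtoC_neq0. apply INR_fact_neq_0. Qed.

Lemma RtoC_INR_S (n : nat) : RtoC (INR (S n)) = RtoC (INR n) + 1.
Proof. rewrite S_INR. now rewrite RtoC_plus. Qed.

Lemma Cpoch_S_l (s : C) (n : nat) : Cpoch s (S n) = s * Cpoch (s + 1) n.
Proof.
  induction n as [|n IH].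
  - cbn [Cpoch]. simpl INR. ring.
  - change (Cpoch s (S (S n))) with (Cpoch s (S n) * (s + INR (S n))).
    rewrite IH, RtoC_INR_S. cbn [Cpoch]. ring.
Qed.

Lemma Cpoch_add (s : C) (k m : nat) :
  Cpoch s (k + m) = Cpoch s k * Cpoch (s + INR k) m.
Proof.
  induction m as [|m IH]; [rewrite Nat.add_0_r; cbn [Cpoch]; ring|].
  rewrite Nat.add_succ_r. cbn [Cpoch]. rewrite IH, plus_INR, RtoC_plus. ring.
Qed.

Lemma Rcpow_plus (t : R) (s s' : C) : Rcpow t (s + s') = Rcpow t s * Rcpow t s'.
Proof. unfold Rcpow. rewrite <- Cexp_plus. f_equal. ring. Qed.

Lemma Rcpow_neq0 (t : R) (s : C) : Rcpow t s <> 0.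
Proof. apply Cexp_neq0. Qed.

Lemma Rcpow_1 (t : R) : (0 < t) -> Rcpow t 1 = RtoC t.
Proof.
  intros Ht. unfold Rcpow. replace (1 * RtoC (ln t)) with (RtoC (ln t)) by ring.
  now rewrite Cexp_real, exp_ln.
Qed.

Definition gauss_recip (n : nat) (s : C) : C :=
  Cpoch s (S n) / (RtoC (INR (fact n)) * Rcpow (INR n) s).

Definition gauss_ratio (m : nat) (s : C) : C :=
  (1 + s * RtoC (/ INR (S (S m))))
  * Cexp (s * RtoC (ln (INR (S m)) - ln (INR (S (S m))))).

(** The limit of the reciprocals in Gauss' product formula, written as a telescoping series so that it can be
    differentiated termwise. *)
Definition recip_Gamma (s : C) : C :=
  gauss_recip 1 s + CSeries (fun m => gauss_recip (S m) s * (gauss_ratio m s - 1)).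

Lemma gauss_recip_S (m : nat) (s : C) :
  gauss_recip (S (S m)) s = gauss_recip (S m) s * gauss_ratio m s.
Proof.
  unfold gauss_recip, gauss_ratio.
  set (k := S m).
  change (Cpoch s (S (S k))) with (Cpoch s (S k) * (s + INR (S k))).
  change (fact (S k)) with (S k * fact k)%nat.
  rewrite mult_INR, RtoC_mult.
  assert (E : Rcpow (INR (S k)) s * Cexp (s * RtoC (ln (INR k) - ln (INR (S k))))
    = Rcpow (INR k) s).
  { unfold Rcpow. rewrite <- Cexp_plus. f_equal. rewrite RtoC_minus. ring. }
  rewrite <- E.
  assert (H1 := INR_fact_neq0 k).
  assert (H2 : RtoC (INR (S k)) <> 0) by (apply RtoC_neq0, not_0_INR; lia).
  assert (H3 := Rcpow_neq0 (INR (S k)) s).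
  assert (H4 := Cexp_neq0 (s * RtoC (ln (INR k) - ln (INR (S k))))).
  rewrite RtoC_inv by (apply not_0_INR; lia).
  field. auto.
Qed.

Lemma log_step_bounds (m : nat) :
  let L := (ln (INR (S m)) - ln (INR (S (S m))))%R in
  let t := (/ INR (S (S m)))%R in
  let tau := (/ INR (S m))%R in
  (0 < t <= tau) /\ (tau <= 1) /\ (Rabs L <= tau) /\ (Rabs (L + t) <= tau * tau).
Proof.
  intros L t tau.
  set (x := INR (S m)) in *.
  assert (Hx : 1 <= x) by (unfold x; rewrite S_INR; assert (P := pos_INR m); lra).
  assert (Ex : INR (S (S m)) = (x + 1)%R) by (unfold x; now rewrite (S_INR (S m))).
  unfold L, t in *. rewrite Ex in *. clear L t Ex.
  assert (Ht : 0 < / (x + 1)) by (apply Rinv_0_lt_compat; lra).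
  assert (Htt : / (x + 1) <= / x) by (apply Rinv_le_contravar; lra).
  assert (Hd : / x - / (x + 1) <= / x * / x).
  { replace (/ x - / (x + 1))%R with (/ x * / (x + 1))%R by (field; lra).
    apply Rmult_le_compat_l; lra. }
  assert (H1 : / x <= 1) by (rewrite <- Rinv_1; apply Rinv_le_contravar; lra).
  assert (A : ln x - ln (x + 1) <= - / (x + 1)).
  { rewrite <- ln_div by lra.
    assert (B := exp_ineq1_le (ln (x / (x + 1)))).
    rewrite exp_ln in B by (apply Rdiv_lt_0_compat; lra).
    replace (x / (x + 1))%R with (1 - / (x + 1))%R in B at 2 by (field; lra). lra. }
  assert (A' : - / x <= ln x - ln (x + 1)).
  { assert (B := exp_ineq1_le (ln ((x + 1) / x))).
    rewrite exp_ln in B by (apply Rdiv_lt_0_compat; lra).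
    rewrite ln_div in B by lra.
    replace ((x + 1) / x)%R with (1 + / x)%R in B by (field; lra). lra. }
  unfold tau. repeat split; try lra; apply Rabs_le; lra.
Qed.

(** Both the deviation of [gauss_ratio m] from 1 and its Lipschitz constant are
    [O(1/m^2)]: the first order terms [s/(m+2)] and [s ln((m+1)/(m+2))] cancel up
    to that order. *)
Lemma gauss_ratio_Lipschitz (B : R) : (0 <= B) -> exists K, (0 <= K) /\
  forall m s h, (Cmod s <= B) -> (Cmod h <= B) ->
    (Cmod (gauss_ratio m (s + h)%C - gauss_ratio m s)
       <= K * (/ INR (S m) * / INR (S m)) * Cmod h).
Proof.
  intros HB.
  set (K1 := (1 + B + B + (1 + B + B) * (3 * B * exp B))%R).
  assert (EB := exp_pos B).
  exists (exp B * K1)%R. split.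
  { unfold K1. apply Rmult_le_pos; [lra|].
    assert (0 <= 3 * B * exp B) by (apply Rmult_le_pos; lra). nra. }
  intros m s h Hs Hh.
  destruct (log_step_bounds m) as (Ht & Htau & HL & HLt).
  set (L := (ln (INR (S m)) - ln (INR (S (S m))))%R) in *.
  set (t := (/ INR (S (S m)))%R) in *. set (tau := (/ INR (S m))%R) in *.
  set (Rm := Cexp (h * RtoC L) - 1 - h * RtoC L).
  assert (E : gauss_ratio m (s + h) - gauss_ratio m s = Cexp (s * RtoC L) *
    (h * RtoC (L + t) + s * h * RtoC (t * L) + h * h * RtoC (t * L)
     + (1 + s * RtoC t + h * RtoC t) * Rm)).
  { unfold gauss_ratio, Rm. fold L t.
    replace ((s + h) * RtoC L) with (s * RtoC L + h * RtoC L) by ring.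
    rewrite Cexp_plus, RtoC_plus, RtoC_mult. ring. }
  rewrite E, Cmod_mult. clear E.
  assert (Hh0 := Cmod_ge_0 h). assert (Hs0 := Cmod_ge_0 s).
  assert (Ltau : Rabs L <= 1) by lra.
  assert (PL := Rabs_pos L).
  assert (Hmono : forall y, (y <= B) -> (exp y <= exp B)).
  { intros y [Hy|Hy]; [left; now apply exp_increasing|rewrite Hy; lra]. }
  assert (He : Cmod (Cexp (s * RtoC L)) <= exp B).
  { rewrite Cmod_Cexp. apply Hmono.
    eapply Rle_trans; [apply Rle_abs|]. eapply Rle_trans; [apply re_le_Cmod|].
    rewrite Cmod_mult, Cmod_R. nra. }
  assert (HhL : Cmod (h * RtoC L) <= Cmod h * tau).
  { rewrite Cmod_mult, Cmod_R. now apply Rmult_le_compat_l. }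
  assert (HR : Cmod Rm <= (3 * B * exp B) * (tau * tau) * Cmod h).
  { unfold Rm. eapply Rle_trans; [apply Cexp_second_order|].
    assert (P := Cmod_ge_0 (h * RtoC L)).
    assert (exp (Cmod (h * RtoC L)) <= exp B) by (apply Hmono; nra).
    assert (Cmod (h * RtoC L) * Cmod (h * RtoC L) <= Cmod h * tau * (Cmod h * tau))
      by (apply Rmult_le_compat; auto).
    apply Rle_trans with (3 * (Cmod h * tau * (Cmod h * tau)) * exp B)%R.
    - apply Rmult_le_compat; [nra|left; apply exp_pos|lra|auto].
    - assert (Cmod h * (tau * tau * Cmod h * exp B) <= B * (tau * tau * Cmod h * exp B)).
      { apply Rmult_le_compat_r; auto. apply Rmult_le_pos; [|lra]. nra. }
      lra. }
  assert (HtL : Rabs (t * L) <= tau * tau).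
  { rewrite Rabs_mult, (Rabs_pos_eq t) by lra. apply Rmult_le_compat; lra. }
  assert (T2 : 0 <= tau * tau) by nra.
  set (q := (tau * tau * Cmod h)%R).
  assert (Hq : 0 <= q) by (unfold q; nra).
  assert (G1 : Cmod (h * RtoC (L + t)) <= q).
  { rewrite Cmod_mult, Cmod_R. unfold q. rewrite Rmult_comm.
    now apply Rmult_le_compat_r. }
  assert (G2 : Cmod (s * h * RtoC (t * L)) <= B * q).
  { rewrite !Cmod_mult, Cmod_R. unfold q.
    apply Rle_trans with (B * Cmod h * (tau * tau))%R; [|lra].
    apply Rmult_le_compat; auto using Rabs_pos; [nra|].
    now apply Rmult_le_compat_r. }
  assert (G3 : Cmod (h * h * RtoC (t * L)) <= B * q).
  { rewrite !Cmod_mult, Cmod_R. unfold q.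
    apply Rle_trans with (B * Cmod h * (tau * tau))%R; [|lra].
    apply Rmult_le_compat; auto using Rabs_pos; [nra|].
    now apply Rmult_le_compat_r. }
  assert (G4 : Cmod ((1 + s * RtoC t + h * RtoC t) * Rm)
    <= (1 + B + B) * (3 * B * exp B) * q).
  { rewrite Cmod_mult. apply Rle_trans with ((1 + B + B) * (3 * B * exp B * (tau * tau) * Cmod h))%R.
    - apply Rmult_le_compat; auto using Cmod_ge_0.
      tri.
      tri_l.
      rewrite Cmod_1, !Cmod_mult, Cmod_pos by lra. nra.
    - unfold q. right. ring. }
  apply Rle_trans with (exp B * (K1 * q))%R; [|unfold q; right; ring].
  apply Rmult_le_compat; auto using Cmod_ge_0.
  tri.
  tri_l.
  eapply Rle_trans; [apply Rplus_le_compat_r, Rplus_le_compat_r, Cmod_triangle|].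
  unfold K1. lra.
Qed.

Lemma gauss_ratio_0 (m : nat) : gauss_ratio m 0 = 1.
Proof.
  unfold gauss_ratio. replace (0 * RtoC (ln (INR (S m)) - ln (INR (S (S m)))))
    with (RtoC 0) by ring. rewrite Cexp_0. ring.
Qed.

Lemma ex_series_inv_square : ex_series (fun m => / INR (S m) * / INR (S m))%R.
Proof.
  (* majorised by the telescoping series of 2/(m+1) - 2/(m+2) *)
  apply ex_series_bounded with 2%R.
  - intros n. assert (0 < / INR (S n)) by (apply Rinv_0_lt_compat, lt_0_INR; lia). nra.
  - intros n. apply Rle_trans with (2 - 2 * / INR (S (S n)))%R.
    + induction n as [|n IH].
      * rewrite sum_O. simpl. lra.
      * rewrite sum_Sn. unfold plus; simpl AbelianMonoid.sort in *; cbv beta.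
        eapply Rle_trans; [apply Rplus_le_compat_r, IH|].
        rewrite (S_INR (S (S n))). set (x := INR (S (S n))).
        assert (Hx : 1 <= x).
        { unfold x. rewrite S_INR. assert (P := pos_INR (S n)). lra. }
        assert (/ x * / x <= 2 * (/ x - / (x + 1))); [|lra].
        replace (2 * (/ x - / (x + 1)))%R with (/ x * (2 * / (x + 1)))%R by (field; lra).
        assert (0 < / x) by (apply Rinv_0_lt_compat; lra).
        apply Rmult_le_compat_l; [lra|].
        replace (2 * / (x + 1))%R with (/ ((x + 1) / 2))%R by (field; lra).
        apply Rinv_le_contravar; lra.
    + assert (0 < / INR (S (S n))) by (apply Rinv_0_lt_compat, lt_0_INR; lia). lra.
Qed.

Lemma gauss_recip_1 (s : C) : gauss_recip 1 s = s * (s + 1).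
Proof.
  unfold gauss_recip, Rcpow. change (fact 1) with 1%nat. cbn [Cpoch].
  change (INR 1) with 1%R. change (INR 0) with 0%R. rewrite ln_1.
  replace (s * RtoC 0) with (RtoC 0) by ring. rewrite Cexp_0. field.
Qed.

Lemma Cder_gauss_ratio (m : nat) (s : C) : exists d, Cder (gauss_ratio m) s d.
Proof.
  destruct (Cder_Cexp_linear (RtoC (ln (INR (S m)) - ln (INR (S (S m))))) s) as [d Hd].
  eexists. unfold gauss_ratio. apply Cder_mult; [|apply Hd].
  apply Cder_plus; [apply Cder_const|].
  apply Cder_mult; [apply Cder_id|apply Cder_const].
Qed.

Lemma Cder_gauss_recip (m : nat) (s : C) : exists d, Cder (gauss_recip (S m)) s d.
Proof.
  induction m as [|m [d IH]].
  - eexists. eapply Cder_ext; [intros y; symmetry; apply gauss_recip_1|].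
    apply Cder_mult; [apply Cder_id|].
    apply Cder_plus; [apply Cder_id|apply Cder_const].
  - destruct (Cder_gauss_ratio m s) as [e He]. eexists.
    eapply Cder_ext; [intros y; symmetry; apply gauss_recip_S|].
    apply Cder_mult; eauto.
Qed.

(** Gauss' reciprocals are products of factors [1 + O(1/m^2)] whose Lipschitz constants
    are [O(1/m^2)], so both estimates are uniform in the index. *)
Lemma gauss_recip_bounds (s : C) : exists M K, (0 <= M) /\ (0 <= K) /\
  forall n h, Cmod h < 1 ->
    let q := (/ INR (S n) * / INR (S n))%R in
    (Cmod (gauss_recip (S n) (s + h)%C) <= M) /\
    (Cmod (gauss_recip (S n) (s + h)%C - gauss_recip (S n) s) <= M * Cmod h) /\
    (Cmod (gauss_ratio n (s + h)%C - 1) <= K * q) /\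
    (Cmod (gauss_ratio n (s + h)%C - gauss_ratio n s) <= K * q * Cmod h).
Proof.
  set (B := (Cmod s + 1)%R). assert (HB : 1 <= B)
    by (unfold B; assert (P := Cmod_ge_0 s); lra).
  destruct (gauss_ratio_Lipschitz B ltac:(lra)) as [K0 [HK0 HL]].
  set (K := (K0 * B)%R).
  assert (HK : 0 <= K) by (unfold K; apply Rmult_le_pos; lra).
  assert (HKK : K0 <= K) by (unfold K; nra).
  assert (Hq : forall n, (0 < / INR (S n) * / INR (S n))).
  { intros n. assert (0 < / INR (S n)) by (apply Rinv_0_lt_compat, lt_0_INR; lia).
    nra. }
  assert (R1 : forall n h, Cmod h < 1 ->
    (Cmod (gauss_ratio n (s + h)%C - 1) <= K * (/ INR (S n) * / INR (S n)))).
  { intros n h Hh.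
    assert (Hsh : Cmod (s + h) <= B)
      by (eapply Rle_trans; [apply Cmod_triangle|unfold B; lra]).
    assert (A := HL n 0 (s + h) ltac:(rewrite Cmod_0; lra) Hsh).
    rewrite Cplus_0_l, gauss_ratio_0 in A.
    eapply Rle_trans; [apply A|]. unfold K. specialize (Hq n).
    set (q := (/ INR (S n) * / INR (S n))%R) in *.
    apply Rle_trans with (K0 * q * B)%R; [|lra].
    apply Rmult_le_compat_l; auto. apply Rmult_le_pos; lra. }
  assert (R2 : forall n h, Cmod h < 1 ->
    (Cmod (gauss_ratio n (s + h)%C - gauss_ratio n s)
       <= K * (/ INR (S n) * / INR (S n)) * Cmod h)).
  { intros n h Hh.
    eapply Rle_trans; [apply HL; [unfold B; lra|lra]|].
    apply Rmult_le_compat_r; [apply Cmod_ge_0|].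
    apply Rmult_le_compat_r; auto. left. apply Hq. }
  set (a := fun n => (1 + K * (/ INR (S n) * / INR (S n)))%R).
  set (b := fun n => (K * (/ INR (S n) * / INR (S n)))%R).
  set (P := fun n => exp (4 * K * (1 - / INR (S n)))).
  set (M0 := ((B + 1) * (B + 1) * 2)%R).
  exists (M0 * exp (4 * K))%R, K.
  assert (HM0 : 0 <= M0) by (unfold M0; nra).
  assert (Hb : forall n, (0 <= b n)).
  { intros n. unfold b. apply Rmult_le_pos; auto. left. apply Hq. }
  assert (Ha : forall n, (0 <= a n)).
  { intros n. specialize (Hb n). unfold a, b in *. lra. }
  assert (HPS : forall n, (P n * (a n + b n) <= P (S n))).
  { intros n. unfold P, a, b.
    replace (4 * K * (1 - / INR (S (S n))))%R with
      (4 * K * (1 - / INR (S n)) + 4 * K * (/ INR (S n) - / INR (S (S n))))%R by ring.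
    rewrite exp_plus. apply Rmult_le_compat_l; [left; apply exp_pos|].
    eapply Rle_trans; [|apply exp_ineq1_le].
    rewrite (S_INR (S n)). set (x := INR (S n)).
    assert (Hx : 1 <= x) by (unfold x; rewrite S_INR; assert (Q := pos_INR n); lra).
    assert (0 < / x) by (apply Rinv_0_lt_compat; lra).
    assert (/ x * / x <= 2 * (/ x - / (x + 1))); [|nra].
    replace (2 * (/ x - / (x + 1)))%R with (/ x * (2 * / (x + 1)))%R by (field; lra).
    apply Rmult_le_compat_l; [lra|].
    replace (2 * / (x + 1))%R with (/ ((x + 1) / 2))%R by (field; lra).
    apply Rinv_le_contravar; lra. }
  assert (HP : forall n, (P n <= exp (4 * K))).
  { intros n. unfold P.
    assert (0 < / INR (S n)) by (apply Rinv_0_lt_compat, lt_0_INR; lia).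
    destruct (Rle_lt_or_eq_dec (4 * K * (1 - / INR (S n))) (4 * K)) as [E|E].
    - assert (0 <= K * / INR (S n)) by (apply Rmult_le_pos; lra). lra.
    - left. now apply exp_increasing.
    - rewrite E. lra. }
  assert (Main := product_Lipschitz
    (fun n h => gauss_recip (S n) (s + h)) (fun n h => gauss_ratio n (s + h))
    a b P M0 1 ltac:(lra) HM0
    Ha Hb).
  split; [apply Rmult_le_pos; auto; left; apply exp_pos|]. split; auto.
  intros n h Hh q.
  destruct (fun A1 A2 A3 A4 A5 A6 => Main A1 HPS A2 A3 A4 A5 A6 n h Hh) as (_ & U1 & U2).
  - unfold P. simpl INR. rewrite Rinv_1, Rminus_diag, Rmult_0_r, exp_0. lra.
  - intros k y _. apply gauss_recip_S.
  - intros k y Hy. unfold a.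
    replace (gauss_ratio k (s + y)) with (1 + (gauss_ratio k (s + y) - 1)) by ring.
    tri. rewrite Cmod_1.
    specialize (R1 k y Hy). lra.
  - intros k y Hy. rewrite Cplus_0_r. now apply R2.
  - intros y Hy. rewrite gauss_recip_1, Cmod_mult.
    assert (Cmod (s + y) <= B)
      by (eapply Rle_trans; [apply Cmod_triangle|unfold B; lra]).
    assert (Cmod (s + y + 1) <= B + 1)
      by (eapply Rle_trans; [apply Cmod_triangle|rewrite Cmod_1; lra]).
    assert (Q1 := Cmod_ge_0 (s + y)). assert (Q2 := Cmod_ge_0 (s + y + 1)).
    apply Rle_trans with (B * (B + 1))%R; [now apply Rmult_le_compat|].
    unfold M0. nra.
  - intros y Hy. rewrite Cplus_0_r, !gauss_recip_1.
    replace ((s + y) * (s + y + 1) - s * (s + 1)) with ((s + s + y + 1) * y) by ring.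
    rewrite Cmod_mult. apply Rmult_le_compat_r; [apply Cmod_ge_0|].
    tri. rewrite Cmod_1.
    tri_l.
    eapply Rle_trans; [apply Rplus_le_compat_r, Rplus_le_compat_r, Cmod_triangle|].
    unfold M0, B. assert (Q1 := Cmod_ge_0 s). nra.
  - rewrite Cplus_0_r in U2. specialize (HP n). repeat split; auto.
    + eapply Rle_trans; [apply U1|]. now apply Rmult_le_compat_l.
    + eapply Rle_trans; [apply U2|]. apply Rmult_le_compat_r; [apply Cmod_ge_0|].
      now apply Rmult_le_compat_l.
Qed.

Lemma recip_Gamma_summable (s : C) :
  Csummable (fun m => gauss_recip (S m) s * (gauss_ratio m s - 1)).
Proof.
  destruct (gauss_recip_bounds s) as (M & K & HM & HK & H).
  apply Csummable_le with (fun m => (M * K) * (/ INR (S m) * / INR (S m)))%R.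
  - intros n. destruct (H n 0 ltac:(rewrite Cmod_0; lra)) as (A & _ & B & _).
    rewrite Cplus_0_r in A, B. rewrite Cmod_mult, Rmult_assoc.
    apply Rmult_le_compat; auto using Cmod_ge_0.
  - exact (ex_series_scal_l (M * K)%R _ ex_series_inv_square).
Qed.

Lemma Clim_gauss_recip (s : C) :
  Clim eventually (fun n => gauss_recip n s) (recip_Gamma s).
Proof.
  assert (H := CSeries_correct _ (recip_Gamma_summable s)).
  apply Cis_series_Clim in H.
  assert (E : forall n, gauss_recip (S n) s = gauss_recip 1 s +
    Csum (fun m => gauss_recip (S m) s * (gauss_ratio m s - 1)) n).
  { induction n as [|n IH]; [cbn [Csum]; ring|].
    rewrite gauss_recip_S. cbn [Csum].
    replace (gauss_recip (S n) s * gauss_ratio n s)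
      with (gauss_recip (S n) s + gauss_recip (S n) s * (gauss_ratio n s - 1)) by ring.
    rewrite IH at 1. ring. }
  assert (H' : Clim eventually (fun n => gauss_recip (S n) s) (recip_Gamma s)).
  { eapply Clim_ext; [apply eventually_filter|intros n; symmetry; apply E|].
    apply Clim_plus; auto; try apply eventually_filter.
    apply Clim_const, eventually_filter. }
  intros eps Heps. destruct (H' eps Heps) as [N HN].
  exists (S N). intros [|n] Hn; [lia|]. apply HN. lia.
Qed.

Lemma Cder_recip_Gamma (s : C) : exists d, Cder recip_Gamma s d.
Proof.
  destruct (gauss_recip_bounds s) as (M & K & HM & HK & H).
  destruct (Cder_gauss_recip 0 s) as [d0 Hd0].
  destruct (Cder_series 0
    (fun m y => gauss_recip (S m) y * (gauss_ratio m y - 1)) s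
    (fun m => (M * (K + K)) * (/ INR (S m) * / INR (S m)))%R 1) as [d1 Hd1].
  - lra.
  - exact (ex_series_scal_l (M * (K + K))%R _ ex_series_inv_square).
  - intros n. destruct (Cder_gauss_recip n s) as [d Hd].
    destruct (Cder_gauss_ratio n s) as [e He]. eexists.
    apply Cder_mult; [apply Hd|]. apply Cder_plus; [apply He|apply Cder_const].
  - intros n h Hh. destruct (H n h Hh) as (A & _ & B & _).
    simpl Nat.add. rewrite Cmod_mult.
    apply Rle_trans with (M * (K * (/ INR (S n) * / INR (S n))))%R.
    + apply Rmult_le_compat; auto using Cmod_ge_0.
    + assert (0 < / INR (S n)) by (apply Rinv_0_lt_compat, lt_0_INR; lia).
      set (q := (/ INR (S n) * / INR (S n))%R).
      assert (0 <= q) by (unfold q; nra).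
      assert (0 <= M * K * q) by (apply Rmult_le_pos; auto; now apply Rmult_le_pos).
      lra.
  - intros n h Hh. destruct (H n h Hh) as (A1 & A2 & _ & B2).
    destruct (H n 0 ltac:(rewrite Cmod_0; lra)) as (A3 & _ & B3 & _).
    rewrite Cplus_0_r in A3, B3.
    destruct (H n h Hh) as (_ & _ & B1 & _).
    simpl Nat.add.
    set (f1 := gauss_recip (S n) (s + h)) in *. set (f0 := gauss_recip (S n) s) in *.
    set (r1 := gauss_ratio n (s + h)) in *. set (r0 := gauss_ratio n s) in *.
    set (q := (/ INR (S n) * / INR (S n))%R) in *.
    replace (f1 * (r1 - 1) - f0 * (r0 - 1))
      with ((f1 - f0) * (r1 - 1) + f0 * (r1 - r0)) by ring.
    tri. rewrite !Cmod_mult.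
    assert (Cmod (f1 - f0) * Cmod (r1 - 1) <= M * Cmod h * (K * q))
      by (apply Rmult_le_compat; auto using Cmod_ge_0).
    assert (Cmod f0 * Cmod (r1 - r0) <= M * (K * q * Cmod h))
      by (apply Rmult_le_compat; auto using Cmod_ge_0).
    lra.
  - exists (d0 + d1). apply Cder_plus; auto.
Qed.

Lemma recip_Gamma_S (s : C) : s * recip_Gamma (s + 1) = recip_Gamma s.
Proof.
  assert (H1 := Clim_scal eventually s _ _ (Clim_gauss_recip (s + 1))).
  assert (H2 : Clim eventually
    (fun n => gauss_recip n s * (1 + (s + 1) * RtoC (/ INR n))) (recip_Gamma s * (1 + (s + 1) * 0))).
  { apply Clim_mult; try apply eventually_filter; [apply Clim_gauss_recip|].
    apply Clim_plus; try apply eventually_filter; [apply Clim_const, eventually_filter|].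
    apply Clim_scal; [apply eventually_filter|].
    intros eps Heps.
    destruct (archimed_cor1 eps Heps) as [N [HN HN0]].
    exists N. intros n Hn.
    replace (RtoC (/ INR n) - 0) with (RtoC (/ INR n)) by ring.
    assert (0 < INR N) by (apply lt_0_INR; lia).
    assert (INR N <= INR n) by (apply le_INR; lia).
    rewrite Cmod_pos; [|left; apply Rinv_0_lt_compat; lra].
    eapply Rle_lt_trans; [|apply HN]. apply Rinv_le_contravar; lra. }
  replace (recip_Gamma s * (1 + (s + 1) * 0)) with (recip_Gamma s) in H2 by ring.
  apply Clim_unique with eventually (fun n => s * gauss_recip n (s + 1));
    [apply eventually_filter|auto|].
  apply Clim_ext_loc with (3 := H2); [apply eventually_filter|].
  exists 1%nat. intros n Hn. unfold gauss_recip.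
  assert (Hn0 : INR n <> 0%R) by (apply not_0_INR; lia).
  assert (Hnp : 0 < INR n) by (apply lt_0_INR; lia).
  rewrite Rcpow_plus, Rcpow_1 by auto. 
  change (Cpoch (s + 1) (S n)) with (Cpoch (s + 1) n * (s + 1 + INR n)).
  rewrite Cpoch_S_l, RtoC_inv by auto.
  assert (A1 := INR_fact_neq0 n). assert (A2 := Rcpow_neq0 (INR n) s).
  assert (A3 := RtoC_neq0 _ Hn0). field. auto.
Qed.

Lemma recip_Gamma_poch (s : C) (n : nat) :
  recip_Gamma s = Cpoch s n * recip_Gamma (s + INR n).
Proof.
  induction n as [|n IH].
  - cbn [Cpoch]. simpl INR. rewrite Cplus_0_r. ring.
  - rewrite IH. cbn [Cpoch]. rewrite RtoC_INR_S.
    rewrite <- (recip_Gamma_S (s + INR n)).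
    rewrite <- Cplus_assoc. ring.
Qed.

Definition not_pole (s : C) : Prop := forall n : nat, s + INR n <> 0.

Lemma Cpoch_neq0 (s : C) (n : nat) : not_pole s -> Cpoch s n <> 0.
Proof.
  intros H. induction n as [|n IH]; cbn [Cpoch]; [apply C1_nz|].
  now apply Cmult_neq_0.
Qed.

(** The factors are non-zero and [1 + O(1/m^2)], so the partial products from some
    index on stay above half of the first one. *)
Lemma recip_Gamma_neq0 (s : C) : not_pole s -> recip_Gamma s <> 0.
Proof.
  intros Hs E.
  destruct (gauss_recip_bounds s) as (M & K & HM & HK & H).
  assert (HR : forall n, (Cmod (gauss_ratio n s - 1) <= K * (/ INR (S n) * / INR (S n)))).
  { intros n. destruct (H n 0 ltac:(rewrite Cmod_0; lra)) as (_ & _ & B & _).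
    now rewrite Cplus_0_r in B. }
  destruct (INR_unbounded (2 * K + 1)) as [N0 HN0].
  set (N := S N0).
  assert (HN : 2 * K < INR N) by (unfold N; rewrite S_INR; lra).
  assert (HNp : 0 < INR N) by lra.
  assert (Low : forall k, (Cmod (gauss_recip (S N) s) *
    (1 - K * (/ INR N - / INR (N + k))) <= Cmod (gauss_recip (S (N + k)) s))).
  { induction k as [|k IH].
    - rewrite Nat.add_0_r. rewrite Rminus_diag. lra.
    - rewrite Nat.add_succ_r, gauss_recip_S, Cmod_mult.
      set (x := INR (N + k)) in *.
      assert (Hx : INR N <= x) by (apply le_INR; lia).
      assert (Ex : INR (S (N + k)) = (x + 1)%R) by apply S_INR.
      specialize (HR (N + k)%nat). rewrite Ex in *.
      assert (Hr : 1 - K * (/ x - / (x + 1)) <= Cmod (gauss_ratio (N + k) s)).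
      { assert (1 <= Cmod (gauss_ratio (N + k) s) + Cmod (gauss_ratio (N + k) s - 1)).
        { rewrite <- Cmod_1 at 1.
          replace (RtoC 1) with (gauss_ratio (N + k) s + - (gauss_ratio (N + k) s - 1)) at 1
            by ring.
          tri. rewrite Cmod_opp. lra. }
        assert (/ (x + 1) * / (x + 1) <= / x - / (x + 1)); [|nra].
        replace (/ x - / (x + 1))%R with (/ x * / (x + 1))%R by (field; lra).
        apply Rmult_le_compat_r; [left; apply Rinv_0_lt_compat; lra|].
        apply Rinv_le_contravar; lra. }
      assert (Kx : 0 <= K * (/ INR N - / x) <= 1 / 2).
      { assert (/ x <= / INR N) by (apply Rinv_le_contravar; lra).
        assert (0 < / x) by (apply Rinv_0_lt_compat; lra). split; [nra|].
        apply Rle_trans with (K * / INR N)%R; [nra|].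
        apply Rle_div_l; lra. }
      assert (Kx' : 0 <= K * (/ x - / (x + 1)) <= 1 / 2).
      { assert (/ (x + 1) <= / x) by (apply Rinv_le_contravar; lra).
        assert (0 < / (x + 1)) by (apply Rinv_0_lt_compat; lra). split; [nra|].
        apply Rle_trans with (K * / x)%R; [nra|].
        apply Rle_div_l; lra. }
      set (u := (K * (/ INR N - / x))%R) in *.
      set (v := (K * (/ x - / (x + 1)))%R) in *.
      assert (Euv : (K * (/ INR N - / (x + 1)) = u + v)%R) by (unfold u, v; ring).
      rewrite Euv.
      set (g := Cmod (gauss_recip (S N) s)) in *.
      assert (Hg : 0 <= g) by apply Cmod_ge_0.
      apply Rle_trans with (g * (1 - u) * (1 - v))%R.
      + assert (0 <= g * (u * v)) by (apply Rmult_le_pos; nra). nra.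
      + apply Rmult_le_compat; auto; [|lra]. apply Rmult_le_pos; lra. }
  assert (Hg : 0 < Cmod (gauss_recip (S N) s)).
  { apply Cmod_gt_0. unfold gauss_recip, Cdiv. apply Cmult_neq_0.
    - now apply Cpoch_neq0.
    - intros E0. assert (A1 := INR_fact_neq0 (S N)). assert (A2 := Rcpow_neq0 (INR (S N)) s).
      assert (A3 := Cinv_r _ (Cmult_neq_0 _ _ A1 A2)). rewrite E0, Cmult_0_r in A3.
      now apply C1_nz. }
  assert (L := Clim_gauss_recip s). rewrite E in L.
  destruct (L (Cmod (gauss_recip (S N) s) / 2)%R ltac:(lra)) as [m Hm].
  specialize (Hm (S (N + m)) ltac:(lia)). specialize (Low m).
  replace (gauss_recip (S (N + m)) s - 0) with (gauss_recip (S (N + m)) s) in Hm by ring.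
  assert (K * (/ INR N - / INR (N + m)) <= 1 / 2).
  { assert (0 < INR (N + m)) by (apply lt_0_INR; lia).
    assert (0 < / INR (N + m)) by now apply Rinv_0_lt_compat.
    apply Rle_trans with (K * / INR N)%R; [nra|]. apply Rle_div_l; lra. }
  nra.
Qed.

Lemma CGamma_recip (s : C) : not_pole s -> CGamma s = / recip_Gamma s.
Proof.
  intros Hs. apply Climit_eq; [apply eventually_filter|].
  apply Clim_ext_loc with (fun n => / gauss_recip n s).
  - apply eventually_filter.
  - exists O. intros n _. unfold gauss_recip.
    assert (A1 := INR_fact_neq0 n). assert (A2 := Rcpow_neq0 (INR n) s).
    assert (A3 := Cpoch_neq0 s (S n) Hs). field. auto.
  - apply Clim_inv; [apply eventually_filter|now apply recip_Gamma_neq0|].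
    apply Clim_gauss_recip.
Qed.

(** * Power series and analytic functions *)

Definition pser (a : nat -> C) (h : C) : C := CSeries (fun k => a k * h ^ k).

Definition psum (a : nat -> C) (r : R) : Prop := ex_series (fun k => Cmod (a k) * r ^ k)%R.

Definition pnorm (a : nat -> C) (r : R) : R := Series (fun k => Cmod (a k) * r ^ k)%R.

Lemma pterm_le (a : nat -> C) (r : R) (h : C) (k : nat) :
  (Cmod h <= r) -> (Cmod (a k * h ^ k) <= Cmod (a k) * r ^ k).
Proof.
  intros Hh. rewrite Cmod_mult, Cmod_pow. apply Rmult_le_compat_l; [apply Cmod_ge_0|].
  apply pow_incr. split; [apply Cmod_ge_0|auto].
Qed.

Lemma psum_summable (a : nat -> C) (r : R) (h : C) :
  psum a r -> (Cmod h <= r) -> Csummable (fun k => a k * h ^ k).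
Proof. intros Ha Hh. apply Csummable_le with (2 := Ha). intros k. now apply pterm_le. Qed.

Lemma Series_nonneg (u : nat -> R) :
  (forall n, (0 <= u n)) -> ex_series u -> (0 <= Series u).
Proof.
  intros Hu Hs. eapply Rle_trans; [apply (Hu O)|]. now apply Rle_Series_term.
Qed.

Lemma pterm_nonneg (a : nat -> C) (r : R) (k : nat) :
  (0 <= r) -> (0 <= Cmod (a k) * r ^ k).
Proof. intros Hr. apply Rmult_le_pos; [apply Cmod_ge_0|now apply pow_le]. Qed.

Lemma pnorm_nonneg (a : nat -> C) (r : R) : (0 <= r) -> psum a r -> (0 <= pnorm a r).
Proof. intros Hr Ha. apply Series_nonneg; auto. intros n. now apply pterm_nonneg. Qed.

Lemma Cmod_pser_le (a : nat -> C) (r : R) (h : C) :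
  psum a r -> (Cmod h <= r) -> (Cmod (pser a h) <= pnorm a r).
Proof.
  intros Ha Hh. eapply Rle_trans; [apply Cmod_CSeries_le; eapply psum_summable; eauto|].
  apply Series_le; auto. intros k. split; [apply Cmod_ge_0|now apply pterm_le].
Qed.

Lemma psum_le (a : nat -> C) (r r' : R) : (0 <= r' <= r) -> psum a r -> psum a r'.
Proof.
  intros Hr Ha. apply ex_series_Rle with (2 := Ha). intros k.
  rewrite Rabs_pos_eq by (apply pterm_nonneg; lra).
  apply Rmult_le_compat_l; [apply Cmod_ge_0|]. apply pow_incr; auto.
Qed.

Lemma psum_shift (a : nat -> C) (r : R) :
  (0 < r) -> psum a r -> psum (fun k => a (S k)) r.
Proof.
  intros Hr Ha. apply (ex_series_incr_1 (fun k => Cmod (a k) * r ^ k)%R) in Ha.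
  apply ex_series_ext with (fun k => / r * (Cmod (a (S k)) * r ^ S k))%R.
  - intros k. simpl. field. lra.
  - exact (ex_series_scal_l (/ r)%R _ Ha).
Qed.

Lemma pser_shift (a : nat -> C) (r : R) (h : C) : (0 < r) -> psum a r ->
  (Cmod h <= r) -> pser a h = a O + h * pser (fun k => a (S k)) h.
Proof.
  intros Hr Ha Hh. unfold pser. rewrite CSeries_shift by (eapply psum_summable; eauto).
  rewrite <- CSeries_scal.
  - cbn [Cpow]. rewrite Cmult_1_r. f_equal. apply CSeries_ext. intros k. ring.
  - apply psum_summable with r; auto. now apply psum_shift.
Qed.

Lemma pser_minus (a b : nat -> C) (r : R) (h : C) : (0 <= r) ->
  psum a r -> psum b r -> (Cmod h <= r) ->
  psum (fun k => a k - b k) r /\ pser (fun k => a k - b k) h = pser a h - pser b h.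
Proof.
  intros Hr Ha Hb Hh. split.
  - apply ex_series_Rle with (fun k => Cmod (a k) * r ^ k + Cmod (b k) * r ^ k)%R.
    + intros k. rewrite Rabs_pos_eq
        by now apply (pterm_nonneg (fun k => a k - b k)).
      rewrite <- Rmult_plus_distr_r. apply Rmult_le_compat_r; [now apply pow_le|].
      unfold Cminus. tri. rewrite Cmod_opp. lra.
    + exact (ex_series_plus _ _ Ha Hb).
  - unfold pser. rewrite <- CSeries_minus by (eapply psum_summable; eauto).
    apply CSeries_ext. intros k. ring.
Qed.

Definition conv (a b : nat -> C) (n : nat) : C :=
  Csum (fun i => a i * b (n - i)%nat) (S n).

(** Cauchy products: power series absolutely convergent at radius [r] form a normed
    algebra for [pnorm _ r]. *)
Lemma conv_spec (a b : nat -> C) (r : R) : (0 < r) -> psum a r -> psum b r ->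
  psum (conv a b) r /\ (pnorm (conv a b) r <= pnorm a r * pnorm b r) /\
  forall h, (Cmod h <= r) -> pser (conv a b) h = pser a h * pser b h.
Proof.
  intros Hr Ha Hb.
  set (g := fun (h : C) i k => a i * h ^ i * (b k * h ^ k)).
  assert (Hrs : forall h i, (Cmod h <= r) -> Csummable (g h i)).
  { intros h i Hh. apply Csummable_scal. eapply psum_summable; eauto. }
  assert (Hrn : forall h i, (Cmod h <= r) ->
    (Series (fun n => Cmod (g h i n)) <= Cmod (a i) * r ^ i * pnorm b r)).
  { intros h i Hh. unfold pnorm. rewrite <- Series_scal_l. apply Series_le.
    - intros k. split; [apply Cmod_ge_0|]. unfold g. rewrite Cmod_mult.
      apply Rmult_le_compat; auto using Cmod_ge_0, pterm_le.
    - exact (ex_series_scal_l _ _ Hb). }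
  assert (Hbs : ex_series (fun i => Cmod (a i) * r ^ i * pnorm b r)%R)
    by exact (ex_series_scal_r (pnorm b r) _ Ha).
  assert (Hcol : forall h n, Csum (fun i => g h i (n - i)%nat) (S n) = conv a b n * h ^ n).
  { intros h n. unfold conv. rewrite <- Csum_scal_r. apply Csum_ext.
    intros k Hk. unfold g. replace n with (k + (n - k))%nat at 4 by lia.
    rewrite Cpow_add_r. ring. }
  assert (HrC : Cmod r <= r) by (rewrite Cmod_pos; lra).
  destruct (CSeries_triangle (g (RtoC r)) _ (fun i => Hrs _ i HrC)
    (fun i => Hrn _ i HrC) Hbs) as (F1 & F2 & _).
  assert (En : forall n, (Cmod (Csum (fun i => g (RtoC r) i (n - i)%nat) (S n))
    = Cmod (conv a b n) * r ^ n)%R).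
  { intros n. rewrite Hcol, Cmod_mult, Cmod_pow, Cmod_pos; lra. }
  split; [|split].
  - apply ex_series_ext with (2 := F1). exact En.
  - unfold pnorm at 1. rewrite <- (Series_ext _ _ En).
    eapply Rle_trans; [apply F2|]. rewrite Series_scal_r. apply Rle_refl.
  - intros h Hh.
    destruct (CSeries_triangle (g h) _ (fun i => Hrs _ i Hh)
      (fun i => Hrn _ i Hh) Hbs) as (_ & _ & F4).
    unfold pser at 1. rewrite <- (CSeries_ext _ _ (Hcol h)), F4.
    rewrite Cmult_comm. unfold pser at 2.
    rewrite <- CSeries_scal by (eapply psum_summable; eauto).
    apply CSeries_ext. intros i. unfold g.
    rewrite CSeries_scal by (eapply psum_summable; eauto). unfold pser. ring.
Qed.

Fixpoint conv_pow (b : nat -> C) (n : nat) : nat -> C :=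
  match n with
  | O => fun k => match k with O => 1 | S _ => 0 end
  | S m => conv b (conv_pow b m)
  end.

Lemma psum_finite (a : nat -> C) (r : R) (n : nat) :
  (0 <= r) -> (forall k, (n <= k)%nat -> a k = 0) -> psum a r.
Proof.
  intros Hr H. destruct (Csum_CSeries (fun k => a k * RtoC r ^ k) n) as [Hs _].
  - intros k Hk. rewrite H by auto. ring.
  - apply ex_series_ext with (2 := Hs). intros k.
    rewrite Cmod_mult, Cmod_pow, Cmod_pos; auto.
Qed.

Lemma pser_finite (a : nat -> C) (h : C) (n : nat) :
  (forall k, (n <= k)%nat -> a k = 0) -> pser a h = Csum (fun k => a k * h ^ k) n.
Proof.
  intros H. apply Csum_CSeries. intros k Hk. rewrite H by auto. ring.
Qed.

Lemma conv_pow_spec (b : nat -> C) (r : R) (n : nat) : (0 < r) -> psum b r ->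
  psum (conv_pow b n) r /\ (pnorm (conv_pow b n) r <= pnorm b r ^ n) /\
  forall h, (Cmod h <= r) -> pser (conv_pow b n) h = pser b h ^ n.
Proof.
  intros Hr Hb. induction n as [|n (I1 & I2 & I3)].
  - assert (Hz : forall k, (1 <= k)%nat -> conv_pow b 0 k = 0)
      by (intros [|k] Hk; [lia|auto]).
    assert (Hs : psum (conv_pow b 0) r) by (apply psum_finite with 1%nat; auto; lra).
    split; [auto|split].
    + unfold pnorm. rewrite Series_incr_1 by exact Hs. simpl.
      rewrite (Series_ext _ (fun _ => 0 * 0)%R) by (intros k; rewrite Cmod_0; ring).
      rewrite Series_scal_l, Cmod_1. lra.
    + intros h _. rewrite (pser_finite _ _ 1) by auto. cbn. ring.
  - destruct (conv_spec b (conv_pow b n) r Hr Hb I1) as (C1 & C2 & C3).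
    split; [auto|split].
    + eapply Rle_trans; [apply C2|]. simpl.
      apply Rmult_le_compat_l; auto. apply pnorm_nonneg; auto. lra.
    + intros h Hh. cbn [conv_pow]. rewrite C3, I3; auto.
Qed.

(** The powers of the inner series satisfy pnorm (b^n) <= (pnorm b)^n, which makes the double
    series absolutely convergent. *)
Lemma pser_comp (a b : nat -> C) (R0 r : R) : (0 < r) ->
  psum a R0 -> psum b r -> (pnorm b r <= R0) ->
  exists d, psum d r /\ forall h, (Cmod h <= r) -> pser d h = pser a (pser b h).
Proof.
  intros Hr Ha Hb Hn.
  assert (Hn0 : 0 <= pnorm b r) by (apply pnorm_nonneg; auto; lra).
  set (c := fun (h : C) n k => a n * (conv_pow b n k * h ^ k)).
  assert (Hrs : forall h n, (Cmod h <= r) -> Csummable (c h n)).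
  { intros h n Hh. apply Csummable_scal. apply psum_summable with r; auto.
    now apply conv_pow_spec. }
  assert (Hrn : forall h n, (Cmod h <= r) ->
    (Series (fun k => Cmod (c h n k)) <= Cmod (a n) * R0 ^ n)).
  { intros h n Hh. destruct (conv_pow_spec b r n Hr Hb) as (P1 & P2 & _).
    apply Rle_trans with (Cmod (a n) * pnorm (conv_pow b n) r)%R.
    - unfold pnorm. rewrite <- Series_scal_l. apply Series_le.
      + intros k. split; [apply Cmod_ge_0|]. unfold c. rewrite Cmod_mult.
        apply Rmult_le_compat_l; auto using Cmod_ge_0, pterm_le.
      + exact (ex_series_scal_l _ _ P1).
    - apply Rmult_le_compat_l; [apply Cmod_ge_0|].
      eapply Rle_trans; [apply P2|]. apply pow_incr. auto. }
  assert (HrC : Cmod r <= r) by (rewrite Cmod_pos; lra).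
  destruct (CSeries_Fubini (c (RtoC r)) _ (fun i => Hrs _ i HrC)
    (fun i => Hrn _ i HrC) Ha) as (F1 & F2 & _).
  assert (Hd : forall k, Csummable (fun n => a n * conv_pow b n k)).
  { intros k. apply (Csummable_ext (fun n => / RtoC r ^ k * c (RtoC r) n k)).
    - intros n. unfold c. field. apply Cpow_nz. apply RtoC_neq0. lra.
    - now apply Csummable_scal. }
  assert (Ed : forall h k, CSeries (fun n => c h n k)
    = CSeries (fun n => a n * conv_pow b n k) * h ^ k).
  { intros h k. rewrite Cmult_comm, <- CSeries_scal by auto.
    apply CSeries_ext. intros n. unfold c. ring. }
  exists (fun k => CSeries (fun n => a n * conv_pow b n k)). split.
  - apply ex_series_ext with (2 := F2). intros k.
    rewrite Ed, Cmod_mult, Cmod_pow, Cmod_pos; lra.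
  - intros h Hh.
    destruct (CSeries_Fubini (c h) _ (fun i => Hrs _ i Hh)
      (fun i => Hrn _ i Hh) Ha) as (_ & _ & _ & _ & F4).
    unfold pser at 1. rewrite <- (CSeries_ext _ _ (Ed h)), F4.
    apply CSeries_ext. intros n.
    destruct (conv_pow_spec b r n Hr Hb) as (P1 & _ & P3).
    unfold c. rewrite CSeries_scal by (eapply psum_summable; eauto).
    now rewrite <- P3.
Qed.

(** [analytic_at], with the expansion required to converge absolutely up to the
    boundary of a disc. *)
Definition has_expansion (f : C -> C) (x : C) : Prop :=
  exists a r, (0 < r) /\ psum a r /\
    forall h, (Cmod h <= r) -> f (x + h) = pser a h.

Lemma has_expansion_affine (c d x : C) : has_expansion (fun u => c * u + d) x.
Proof.
  set (a := fun k => match k with O => c * x + d | S O => c | _ => 0 end).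
  assert (Hz : forall k, (2 <= k)%nat -> a k = 0) by (intros [|[|k]] Hk; auto; lia).
  exists a, 1%R. split; [lra|]. split.
  - apply psum_finite with 2%nat; auto; lra.
  - intros h _. rewrite (pser_finite _ _ 2) by auto. cbn. ring.
Qed.

Lemma has_expansion_ext (f g : C -> C) (x : C) :
  (forall y, f y = g y) -> has_expansion f x -> has_expansion g x.
Proof.
  intros E (a & r & Hr & Ha & H). exists a, r. repeat split; auto.
  intros h Hh. rewrite <- E. auto.
Qed.

Lemma has_expansion_mult (f g : C -> C) (x : C) :
  has_expansion f x -> has_expansion g x -> has_expansion (fun u => f u * g u) x.
Proof.
  intros (a & r & Hr & Ha & Hf) (b & s & Hs & Hb & Hg).
  assert (Hm : 0 < Rmin r s) by now apply Rmin_pos.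
  assert (M1 := Rmin_l r s). assert (M2 := Rmin_r r s).
  destruct (conv_spec a b (Rmin r s) Hm) as (C1 & _ & C3).
  - apply psum_le with r; auto. lra.
  - apply psum_le with s; auto. lra.
  - exists (conv a b), (Rmin r s). repeat split; auto.
    intros h Hh. rewrite C3, Hf, Hg; auto; lra.
Qed.

Lemma pser_at_0 (a : nat -> C) (r : R) : (0 < r) -> psum a r -> pser a 0 = a O.
Proof.
  intros Hr Ha. rewrite (pser_shift a r); auto; [ring|]. rewrite Cmod_0. lra.
Qed.

Lemma has_expansion_comp (f g : C -> C) (x : C) :
  has_expansion f (g x) -> has_expansion g x -> has_expansion (fun u => f (g u)) x.
Proof.
  intros (a & R0 & HR & Ha & Hf) (b & r & Hr & Hb & Hg).
  assert (Hb0 : g x = b O).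
  { rewrite <- (Cplus_0_r x), Hg by (rewrite Cmod_0; lra). eapply pser_at_0; eauto. }
  set (b' := fun k => match k with O => RtoC 0 | S _ => b k end).
  assert (Hb'S : forall s, (0 < s <= r) -> psum b' s).
  { intros s Hs. apply ex_series_Rle with (fun k => Cmod (b k) * s ^ k)%R.
    - intros k. rewrite Rabs_pos_eq by (apply pterm_nonneg; lra).
      apply Rmult_le_compat_r; [apply pow_le; lra|].
      destruct k; simpl; [rewrite Cmod_0; apply Cmod_ge_0|lra].
    - apply psum_le with r; auto. lra. }
  (* without constant term, the norm is O(s) *)
  assert (Hn : forall s, (0 < s <= r) -> (pnorm b' s <= s * (pnorm b' r / r))).
  { intros s Hs. unfold pnorm, Rdiv. rewrite <- Series_scal_r, <- Series_scal_l.
    apply Series_le.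
    - intros k. split; [apply pterm_nonneg; lra|].
      destruct k as [|k]; [simpl; rewrite Cmod_0; lra|].
      replace (s * (Cmod (b' (S k)) * r ^ S k * / r))%R
        with (Cmod (b' (S k)) * (s * r ^ k))%R by (simpl; field; lra).
      apply Rmult_le_compat_l; [apply Cmod_ge_0|].
      simpl. apply Rmult_le_compat_l; [lra|]. apply pow_incr. lra.
    - apply (ex_series_scal_l s (fun k => Cmod (b' k) * r ^ k * / r)%R).
      apply (ex_series_scal_r (/ r)%R (fun k => Cmod (b' k) * r ^ k)%R).
      apply Hb'S. lra. }
  set (K := (pnorm b' r / r)%R).
  assert (HK : 0 <= K).
  { unfold K. apply Rmult_le_pos; [apply pnorm_nonneg; [lra|apply Hb'S; lra]|].
    left. now apply Rinv_0_lt_compat. }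
  set (s := Rmin r (R0 / (K + 1))).
  assert (Hs0 : 0 < R0 / (K + 1)) by (apply Rdiv_lt_0_compat; lra).
  assert (M1 := Rmin_l r (R0 / (K + 1))). assert (M2 := Rmin_r r (R0 / (K + 1))).
  fold s in M1, M2.
  assert (Hs : 0 < s) by (unfold s; now apply Rmin_pos).
  assert (Hns : pnorm b' s <= R0).
  { eapply Rle_trans; [apply Hn; lra|]. fold K.
    apply Rle_trans with (R0 / (K + 1) * K)%R; [apply Rmult_le_compat_r; auto|].
    apply Rle_trans with (R0 / (K + 1) * (K + 1))%R.
    - apply Rmult_le_compat_l; lra.
    - right. field. lra. }
  destruct (pser_comp a b' R0 s Hs Ha (Hb'S s ltac:(lra)) Hns) as [d [Hd Hd']].
  exists d, s. repeat split; auto.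
  intros h Hh. rewrite Hd' by auto.
  assert (E : g (x + h) = g x + pser b' h).
  { rewrite Hg by lra.
    rewrite (pser_shift b r), (pser_shift b' r); auto; try lra; [|apply Hb'S; lra].
    rewrite Hb0. unfold b'. ring. }
  rewrite E. apply Hf.
  eapply Rle_trans; [apply Cmod_pser_le with (r := s); auto; apply Hb'S; lra|auto].
Qed.

Lemma has_expansion_pser (a : nat -> C) (R0 : R) (x : C) :
  psum a R0 -> (Cmod x < R0) -> has_expansion (pser a) x.
Proof.
  intros Ha Hx.
  set (b := fun k => match k with O => x | S O => RtoC 1 | _ => 0 end).
  assert (Hz : forall k, (2 <= k)%nat -> b k = 0) by (intros [|[|k]] Hk; auto; lia).
  set (r := (R0 - Cmod x)%R). assert (Hr : 0 < r) by (unfold r; lra).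
  assert (Hb : psum b r) by (apply psum_finite with 2%nat; auto; lra).
  destruct (pser_comp a b R0 r Hr Ha Hb) as [d [Hd Hd']].
  - unfold pnorm. rewrite Series_incr_1 by exact Hb.
    rewrite Series_incr_1 by (apply (ex_series_incr_1 (fun k => Cmod (b k) * r ^ k)%R); exact Hb).
    rewrite (Series_ext _ (fun _ => 0 * 0)%R)
      by (intros k; rewrite Hz by lia; rewrite Cmod_0; ring).
    rewrite Series_scal_l. simpl. rewrite Cmod_1. unfold r. lra.
  - exists d, r. repeat split; auto.
    intros h Hh. rewrite Hd' by auto. f_equal.
    rewrite (pser_finite _ _ 2) by auto. cbn. ring.
Qed.

Lemma psum_geom (q r : R) : (0 <= q) -> (0 <= r) -> (q * r < 1) ->
  forall a M, (forall k, (Cmod (a k) <= M * q ^ k)) -> psum a r.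
Proof.
  intros Hq Hr Hqr a M Ha.
  apply ex_series_Rle with (fun k => M * (q * r) ^ k)%R.
  - intros k. rewrite Rabs_pos_eq by now apply pterm_nonneg.
    rewrite Rpow_mult_distr, <- Rmult_assoc. apply Rmult_le_compat_r; auto.
    now apply pow_le.
  - apply (ex_series_scal_l M (fun k => (q * r) ^ k)%R). apply ex_series_geom.
    rewrite Rabs_pos_eq; auto. now apply Rmult_le_pos.
Qed.

Lemma has_expansion_Cinv (x : C) : x <> 0 -> has_expansion Cinv x.
Proof.
  intros Hx. assert (Hp : 0 < Cmod x) by now apply Cmod_gt_0.
  set (a := fun k => / x * (- / x) ^ k). set (r := (Cmod x / 2)%R).
  assert (Hps : psum a r).
  { apply (psum_geom (/ Cmod x) r) with (/ Cmod x)%R.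
    - left. now apply Rinv_0_lt_compat.
    - unfold r. lra.
    - unfold r. replace (/ Cmod x * (Cmod x / 2))%R with (1 / 2)%R by (field; lra). lra.
    - intros k. unfold a.
      rewrite Cmod_mult, Cmod_pow, Cmod_opp, !Cmod_inv by auto. lra. }
  assert (Hr : 0 < r) by (unfold r; lra).
  exists a, r. repeat split; auto.
  intros h Hh.
  (* the sum S of the geometric series satisfies S = 1/x - (h/x) S *)
  assert (E : pser a h = / x + h * (- / x * pser a h)).
  { rewrite (pser_shift a r) at 1; auto. unfold a at 1. cbn [Cpow]. rewrite Cmult_1_r.
    f_equal. f_equal. unfold pser. rewrite <- CSeries_scal by (eapply psum_summable; eauto).
    apply CSeries_ext. intros k. unfold a. cbn [Cpow]. ring. }
  assert (Hxh : x + h <> 0).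
  { intros E0. assert (Cmod x <= Cmod (x + h) + Cmod h).
    { replace x with (x + h + - h) at 1 by ring.
      tri. rewrite Cmod_opp. lra. }
    rewrite E0, Cmod_0 in H. unfold r in Hh. lra. }
  assert (E1 : pser a h * (x + h) = 1).
  { assert (E2 : pser a h * x = 1 - h * pser a h) by (rewrite E at 1; field; auto).
    replace (pser a h * (x + h)) with (pser a h * x + h * pser a h) by ring.
    rewrite E2. ring. }
  rewrite <- (Cmult_1_l (/ (x + h))), <- E1. field. auto.
Qed.

Lemma locally_Cmod (x : C) (P : C -> Prop) :
  @locally C_UniformSpace x P <->
  exists d : R, (0 < d) /\ forall y, (Cmod (y - x) < d) -> P y.
Proof.
  split.
  - intros H.
    destruct (@locally_norm_le_locally C_AbsRing C_NormedModule x P H) as [d Hd].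
    exists d. split; [apply cond_pos|]. intros y Hy. apply Hd. exact Hy.
  - intros (d & Hd & H).
    apply (@locally_le_locally_norm C_AbsRing C_NormedModule x P).
    exists (mkposreal d Hd). intros y Hy. apply H. exact Hy.
Qed.

Lemma has_expansion_analytic (f : C -> C) (x : C) :
  has_expansion f x -> analytic_at f x.
Proof.
  intros (a & r & Hr & Ha & H). exists a. apply locally_Cmod.
  exists r. split; auto. intros y Hy.
  replace (f y) with (pser a (y - x)) by (rewrite <- H by lra; f_equal; ring).
  apply CSeries_correct. apply psum_summable with r; auto. lra.
Qed.

Lemma eventually_bounded (u : nat -> R) (B : R) (N : nat) :
  (forall n, (N <= n)%nat -> (u n <= B)) -> exists M, forall n, (u n <= M).
Proof.
  revert u. induction N as [|N IH]; intros u H.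
  - exists B. intros n. apply H. lia.
  - destruct (IH (fun n => u (S n))) as [M HM]; [intros n Hn; apply H; lia|].
    exists (Rmax (u O) M). intros [|n]; [apply Rmax_l|].
    eapply Rle_trans; [apply HM|apply Rmax_r].
Qed.

Lemma Cis_series_bounded (u : nat -> C) (v : C) :
  Cis_series u v -> exists M, forall n, (Cmod (u n) <= M).
Proof.
  intros H. apply Cis_series_Clim in H. destruct (H 1%R ltac:(lra)) as [N HN].
  apply eventually_bounded with 2%R N. intros n Hn.
  assert (A := HN n Hn). assert (B := HN (S n) ltac:(lia)).
  replace (u n) with ((Csum u (S n) - v) + - (Csum u n - v)) by (cbn [Csum]; ring).
  tri. rewrite Cmod_opp. lra.
Qed.

Lemma analytic_has_expansion (f : C -> C) (x : C) :
  analytic_at f x -> has_expansion f x.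
Proof.
  intros [a H]. apply locally_Cmod in H. destruct H as (d & Hd & H).
  assert (H1 := H (x + RtoC (d / 2))).
  replace (x + RtoC (d / 2) - x) with (RtoC (d / 2)) in H1 by ring.
  rewrite Cmod_pos in H1 by lra.
  destruct (Cis_series_bounded _ _ (H1 ltac:(lra))) as [M HM].
  assert (Ha : psum a (d / 4)).
  { apply (psum_geom (2 / d) (d / 4)) with M.
    - left. apply Rdiv_lt_0_compat; lra.
    - lra.
    - replace (2 / d * (d / 4))%R with (1 / 2)%R by (field; lra). lra.
    - intros k. specialize (HM k).
      rewrite Cmod_mult, Cmod_pow, Cmod_R, Rabs_pos_eq in HM by lra.
      replace (2 / d)%R with (/ (d / 2))%R by (field; lra). rewrite pow_inv.
      apply (Rle_div_r (Cmod (a k)) M); [apply pow_lt; lra|auto]. }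
  exists a, (d / 4)%R. split; [lra|]. split; auto.
  intros h Hh. specialize (H (x + h)). replace (x + h - x) with h in H by ring.
  symmetry. apply CSeries_unique; [eapply psum_summable; eauto|]. apply H. lra.
Qed.

Lemma pser_zero_coef0 (a : nat -> C) (r : R) (v : C) : (0 < r) -> psum a r ->
  (exists d, (0 < d) /\ forall s : R, (0 < s < d) -> pser a (- (RtoC s * v)) = 0) ->
  a O = 0.
Proof.
  intros Hr Ha (d & Hd & H). apply Cmod_eq_0.
  set (K := pnorm (fun k => a (S k)) r).
  assert (Ha' : psum (fun k => a (S k)) r) by now apply psum_shift.
  assert (HK : 0 <= K) by (apply pnorm_nonneg; auto; lra).
  assert (Hv := Cmod_ge_0 v).
  apply Rle_antisym; [|apply Cmod_ge_0]. apply le_epsilon. intros eps Heps.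
  rewrite Rplus_0_l.
  set (s := Rmin (d / 2) (Rmin (r / (Cmod v + 1)) (eps / ((Cmod v + 1) * (K + 1))))).
  assert (Hs1 : 0 < r / (Cmod v + 1)) by (apply Rdiv_lt_0_compat; lra).
  assert (Hs2 : 0 < eps / ((Cmod v + 1) * (K + 1))) by (apply Rdiv_lt_0_compat; nra).
  assert (Hs : 0 < s) by (unfold s; repeat apply Rmin_pos; lra).
  assert (L1 : s <= d / 2) by apply Rmin_l.
  assert (L2 : s <= r / (Cmod v + 1))
    by (eapply Rle_trans; [apply Rmin_r|apply Rmin_l]).
  assert (L3 : s <= eps / ((Cmod v + 1) * (K + 1)))
    by (eapply Rle_trans; [apply Rmin_r|apply Rmin_r]).
  apply Rle_div_r in L2; [|lra].
  apply Rle_div_r in L3; [|nra].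
  assert (Hsv : Cmod (- (RtoC s * v)) <= r).
  { rewrite Cmod_opp, Cmod_mult, Cmod_pos; nra. }
  assert (E := H s ltac:(lra)). rewrite (pser_shift a r) in E by auto.
  replace (a O) with (RtoC s * v * pser (fun k => a (S k)) (- (RtoC s * v))).
  - rewrite !Cmod_mult, Cmod_pos by lra.
    assert (B := Cmod_pser_le _ _ _ Ha' Hsv). fold K in B.
    assert (P : 0 <= s * Cmod v) by nra.
    apply Rle_trans with (s * Cmod v * K)%R; [now apply Rmult_le_compat_l|]. nra.
  - replace (a O) with (0 - - (RtoC s * v) * pser (fun k => a (S k)) (- (RtoC s * v)));
      [ring|]. rewrite <- E. ring.
Qed.

Lemma pser_zero_coefs (a : nat -> C) (r : R) (v : C) : (0 < r) -> psum a r -> v <> 0 ->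
  (exists d, (0 < d) /\ forall s : R, (0 < s < d) -> pser a (- (RtoC s * v)) = 0) ->
  forall k, a k = 0.
Proof.
  intros Hr Ha Hv H k. revert a Ha H.
  induction k as [|k IH]; intros a Ha H.
  - now apply (pser_zero_coef0 a r v).
  - apply (IH (fun k => a (S k))); [now apply psum_shift|].
    assert (E0 := pser_zero_coef0 a r v Hr Ha H). destruct H as (d & Hd & H).
    assert (Hpv : 0 < Cmod v) by now apply Cmod_gt_0.
    assert (Hrv : 0 < r / Cmod v) by (apply Rdiv_lt_0_compat; lra).
    exists (Rmin d (r / Cmod v)). split; [now apply Rmin_pos|].
    intros s Hs. assert (M1 := Rmin_l d (r / Cmod v)). assert (M2 := Rmin_r d (r / Cmod v)).
    assert (Hsr : s < r / Cmod v) by lra.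
    apply Rlt_div_r in Hsr; auto.
    assert (E := H s ltac:(lra)). rewrite (pser_shift a r) in E; auto.
    + assert (Hs0 : RtoC s <> 0) by (apply RtoC_neq0; lra).
      rewrite E0, Cplus_0_l in E.
      set (w := pser (fun j => a (S j)) (- (RtoC s * v))) in *.
      replace w with (/ (RtoC s * v) * - (- (RtoC s * v) * w)) by (field; auto).
      rewrite E. ring.
    + rewrite Cmod_opp, Cmod_mult, Cmod_pos; lra.
Qed.

(** The identity theorem along a segment.  At the supremum of the parameters up to
    which [f] and [g] agree, the two expansions agree along the part already covered,
    hence have equal coefficients, and the agreement extends further. *)
Lemma identity_on_segment (f g : C -> C) (p q : C) :
  (forall t : R, (0 <= t <= 1) -> has_expansion f (p + RtoC t * (q - p))) ->
  (forall t : R, (0 <= t <= 1) -> has_expansion g (p + RtoC t * (q - p))) ->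
  (exists e, (0 < e) /\ forall t : R, (0 <= t < e) ->
     f (p + RtoC t * (q - p)) = g (p + RtoC t * (q - p))) ->
  f q = g q.
Proof.
  intros Hf Hg (e & He & H0).
  set (y := fun t : R => p + RtoC t * (q - p)).
  destruct (Ceq_dec (q - p) 0) as [Eqp|Nqp].
  { replace q with (y 0%R); [apply H0; lra|]. unfold y. rewrite Eqp, Cmult_0_r.
    replace q with ((q - p) + p) by ring. rewrite Eqp. ring. }
  set (E := fun t : R => (0 <= t <= 1) /\
    forall s : R, (0 <= s <= t) -> f (y s) = g (y s)).
  assert (E0 : E 0%R).
  { split; [lra|]. intros s Hs. apply H0. lra. }
  destruct (completeness E) as [T [HT1 HT2]].
  { exists 1%R. intros t [Ht _]. lra. }
  { now exists 0%R. }
  assert (TE : 0 <= T <= 1).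
  { split; [now apply HT1|]. apply HT2. intros t [Ht _]. lra. }
  assert (Tpos : 0 < T).
  { set (t0 := Rmin 1 (e / 2)). assert (0 < t0) by (apply Rmin_pos; lra).
    assert (t0 <= 1) by apply Rmin_l. assert (t0 <= e / 2) by apply Rmin_r.
    apply Rlt_le_trans with t0; auto. apply HT1. split; [lra|].
    intros s Hs. apply H0. lra. }
  assert (Hlt : forall s : R, (0 <= s < T) -> f (y s) = g (y s)).
  { intros s Hs. apply Classical_Prop.NNPP. intros N.
    assert (T <= s); [|lra]. apply HT2. intros t [Ht1 Ht2].
    apply Rnot_lt_le. intros Hst. apply N, Ht2. lra. }
  destruct (Hf T TE) as (a & r & Hr & Ha & Hfa).
  destruct (Hg T TE) as (b & r' & Hr' & Hb & Hgb).
  fold (y T) in Hfa, Hgb.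
  set (m := Rmin r r'). assert (Hm : 0 < m) by now apply Rmin_pos.
  assert (Mr : m <= r) by apply Rmin_l. assert (Mr' : m <= r') by apply Rmin_r.
  assert (Ha' : psum a m) by (apply psum_le with r; auto; lra).
  assert (Hb' : psum b m) by (apply psum_le with r'; auto; lra).
  assert (Yd : forall s, y s = y T + RtoC (s - T) * (q - p)).
  { intros s. unfold y. rewrite RtoC_minus. ring. }
  assert (Hpv : 0 < Cmod (q - p)) by now apply Cmod_gt_0.
  set (d := (m / Cmod (q - p))%R).
  assert (Hd : 0 < d) by (apply Rdiv_lt_0_compat; lra).
  assert (Hdm : forall s : R, (Rabs s < d) -> (Cmod (RtoC s * (q - p)) < m)).
  { intros s Hs. rewrite Cmod_mult, Cmod_R. now apply Rlt_div_r. }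
  assert (Coef : forall k, a k - b k = 0).
  { apply (pser_zero_coefs (fun k => a k - b k) m (q - p)); auto.
    - apply (pser_minus a b m 0); auto; [lra|rewrite Cmod_0; lra].
    - exists (Rmin d T). split; [now apply Rmin_pos|]. intros s Hs.
      assert (M1 := Rmin_l d T). assert (M2 := Rmin_r d T).
      replace (- (RtoC s * (q - p))) with (RtoC (- s) * (q - p))
        by (rewrite RtoC_opp; ring).
      assert (Hsm : Cmod (RtoC (- s) * (q - p)) < m)
        by (apply Hdm; rewrite Rabs_Ropp, Rabs_pos_eq; lra).
      destruct (pser_minus a b m (RtoC (- s) * (q - p)) ltac:(lra) Ha' Hb' ltac:(lra))
        as [_ ->].
      rewrite <- Hfa, <- Hgb by lra.
      assert (A := Hlt (T - s)%R ltac:(lra)). rewrite Yd in A.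
      replace (T - s - T)%R with (- s)%R in A by ring. rewrite A. ring. }
  assert (Hnear : forall s : R, (Rabs (s - T) < d) -> f (y s) = g (y s)).
  { intros s Hs. apply Hdm in Hs. rewrite Yd, Hfa, Hgb by lra.
    unfold pser. apply CSeries_ext. intros k.
    replace (a k) with ((a k - b k) + b k) by ring. rewrite Coef. ring. }
  assert (HT : T = 1%R).
  { apply Rle_antisym; [lra|]. apply Rnot_lt_le. intros HT.
    set (t1 := Rmin 1 (T + d / 2)). assert (t1 <= 1) by apply Rmin_l.
    assert (t1 <= T + d / 2) by apply Rmin_r.
    assert (T < t1) by (unfold t1; apply Rmin_glb_lt; lra).
    assert (t1 <= T); [|lra]. apply HT1. split; [lra|].
    intros s Hs. destruct (Rlt_dec s T) as [L|L]; [apply Hlt; lra|].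
    apply Hnear. rewrite Rabs_pos_eq; lra. }
  replace q with (y 1%R) by (unfold y; ring). apply Hnear.
  rewrite HT, Rminus_diag, Rabs_R0. auto.
Qed.

(** * The binomial series *)

Lemma ratio_bound_le (u : nat -> R) (rho : R) (N : nat) : (0 < rho) ->
  (forall n, (0 <= u n)) ->
  (forall n, (N <= n)%nat -> (u (S n) <= rho * u n)) ->
  exists M, (0 <= M) /\ forall n, (u n <= M * rho ^ n).
Proof.
  intros Hrho Hu H.
  destruct (eventually_bounded (fun n => u n / rho ^ n)%R (u N / rho ^ N)%R N) as [M HM].
  - intros n Hn. induction Hn as [|n Hn IH]; [lra|].
    eapply Rle_trans; [|apply IH]. simpl.
    assert (P : 0 < rho ^ n) by now apply pow_lt.
    apply Rle_div_l; [nra|].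
    replace (u n / rho ^ n * (rho * rho ^ n))%R with (rho * u n)%R by (field; lra).
    now apply H.
  - exists M. split.
    + eapply Rle_trans; [|apply (HM O)]. simpl. specialize (Hu O). lra.
    + intros n. specialize (HM n). apply Rle_div_l in HM; auto. now apply pow_lt.
Qed.

Lemma linear_ratio_bound (K rho : R) : (0 <= K) -> (1 < rho) ->
  exists N, (1 <= N)%nat /\ (2 * K + 1 <= INR N) /\
  forall n, (N <= n)%nat -> forall a b,
    (Cmod a <= K) -> (Cmod b <= K) ->
    b + INR n <> 0 /\
    (Cmod ((a + INR n) / (b + INR n)) <= rho).
Proof.
  intros HK Hrho.
  destruct (INR_unbounded (2 * K + 1 + K * (1 + rho) / (rho - 1))) as [N HN].
  assert (HQ : 0 <= K * (1 + rho) / (rho - 1)).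
  { apply Rmult_le_pos; [nra|]. left. apply Rinv_0_lt_compat. lra. }
  exists N. split; [destruct N; [simpl in HN; lra|lia]|].
  split; [lra|]. intros n Hn a b Ha Hb.
  apply le_INR in Hn. set (x := INR n) in *.
  assert (Hx : K * (1 + rho) <= x * (rho - 1)) by (apply Rle_div_l; lra).
  assert (Lb : x - K <= Cmod (b + RtoC x)).
  { assert (x <= Cmod (b + RtoC x) + Cmod b); [|lra].
    replace x with (Cmod x) at 1 by (rewrite Cmod_pos; lra).
    replace (RtoC x) with (b + RtoC x + - b) at 1 by ring.
    tri. rewrite Cmod_opp. lra. }
  assert (Nz : b + RtoC x <> 0) by (apply Cmod_gt_0; lra).
  split; auto. rewrite Cmod_div by auto. apply Rle_div_l; [lra|].
  tri. rewrite Cmod_pos by lra. nra.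
Qed.

Lemma psum_ratio (a q : nat -> C) (r : R) : (0 <= r < 1) ->
  (forall n, a (S n) = a n * q n) ->
  (forall rho, (1 < rho) -> exists N, forall n, (N <= n)%nat -> (Cmod (q n) <= rho)) ->
  psum a r.
Proof.
  intros Hr Ha Hq. set (rho := (2 / (1 + r))%R).
  assert (Hrho : 1 < rho) by (apply Rlt_div_r; lra).
  destruct (Hq rho Hrho) as [N HN].
  destruct (ratio_bound_le (fun n => Cmod (a n)) rho N) as [M [HM HM']].
  - lra.
  - intros n. apply Cmod_ge_0.
  - intros n Hn. rewrite Ha, Cmod_mult, Rmult_comm.
    apply Rmult_le_compat_r; [apply Cmod_ge_0|auto].
  - apply (psum_geom rho r) with M; auto; try lra.
    unfold rho. replace (2 / (1 + r) * r)%R with (2 * r / (1 + r))%R by (field; lra).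
    apply Rlt_div_l; lra.
Qed.

Lemma hyp_coef_S (A B c : C) (n : nat) : not_pole c ->
  hyp_coef A B c (S n) = hyp_coef A B c n *
    ((A + INR n) / (c + INR n) * ((B + INR n) / (1 + INR n))).
Proof.
  intros Hc. unfold hyp_coef. cbn [Cpoch].
  change (fact (S n)) with (S n * fact n)%nat. rewrite mult_INR, RtoC_mult, RtoC_INR_S.
  assert (H1 := INR_fact_neq0 n). assert (H2 := Cpoch_neq0 c n Hc). assert (H3 := Hc n).
  assert (H4 : 1 + INR n <> 0).
  { rewrite <- RtoC_plus. apply RtoC_neq0. assert (P := pos_INR n). lra. }
  assert (H5 : RtoC (INR n) + 1 <> 0) by now rewrite Cplus_comm.
  field. auto.
Qed.

Lemma not_pole_1 : not_pole 1.
Proof.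
  intros n. rewrite <- RtoC_plus. apply RtoC_neq0. assert (P := pos_INR n). lra.
Qed.

Lemma psum_hyp_coef (A B c : C) (r : R) : not_pole c -> (0 <= r < 1) ->
  psum (hyp_coef A B c) r.
Proof.
  intros Hc Hr. eapply psum_ratio; auto; [intros n; now apply hyp_coef_S|].
  intros rho Hrho.
  set (s := sqrt rho).
  assert (Hs : 1 < s) by (unfold s; rewrite <- sqrt_1; apply sqrt_lt_1; lra).
  assert (Hss : (s * s = rho)%R) by (apply sqrt_sqrt; lra).
  assert (P1 := Cmod_ge_0 A). assert (P2 := Cmod_ge_0 B). assert (P3 := Cmod_ge_0 c).
  destruct (linear_ratio_bound (Cmod A + Cmod B + Cmod c + 1) s) as (N & _ & _ & HN);
    [lra|auto|].
  exists N. intros n Hn.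
  destruct (HN n Hn A c ltac:(lra) ltac:(lra)) as [_ B1].
  destruct (HN n Hn B 1 ltac:(lra) ltac:(rewrite Cmod_1; lra)) as [_ B2].
  rewrite Cmod_mult, <- Hss. apply Rmult_le_compat; auto using Cmod_ge_0.
Qed.

(** [pser (bin A) s] is the binomial series of (1 - s)^(-A). *)
Definition bin (A : C) (k : nat) : C := Cpoch A k / INR (fact k).

Lemma Cpoch_1 (n : nat) : Cpoch 1 n = RtoC (INR (fact n)).
Proof.
  induction n as [|n IH]; [reflexivity|].
  cbn [Cpoch]. rewrite IH. change (fact (S n)) with (S n * fact n)%nat.
  rewrite mult_INR, RtoC_mult, RtoC_INR_S. ring.
Qed.

Lemma bin_hyp_coef (A : C) (k : nat) : hyp_coef A 1 1 k = bin A k.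
Proof.
  unfold hyp_coef, bin. rewrite Cpoch_1. assert (H := INR_fact_neq0 k). field. auto.
Qed.

Lemma psum_bin (A : C) (r : R) : (0 <= r < 1) -> psum (bin A) r.
Proof.
  intros Hr. apply ex_series_ext with (fun k => Cmod (hyp_coef A 1 1 k) * r ^ k)%R.
  - intros k. now rewrite bin_hyp_coef.
  - apply psum_hyp_coef; auto using not_pole_1.
Qed.

Lemma bin_0 (A : C) : bin A 0 = 1.
Proof. unfold bin. simpl. field. Qed.

Lemma bin_pascal (A : C) (k : nat) : bin (A + 1) (S k) - bin (A + 1) k = bin A (S k).
Proof.
  unfold bin. rewrite (Cpoch_S_l A). cbn [Cpoch].
  change (fact (S k)) with (S k * fact k)%nat. rewrite mult_INR, RtoC_mult, RtoC_INR_S.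
  assert (H := INR_fact_neq0 k).
  assert (H2 : RtoC (INR k) + 1 <> 0)
    by (rewrite <- RtoC_INR_S; apply RtoC_neq0, not_0_INR; lia).
  field. auto.
Qed.

Lemma pser_bin_S (A s : C) : (Cmod s < 1) ->
  (1 - s) * pser (bin (A + 1)) s = pser (bin A) s.
Proof.
  intros Hs. set (r := ((1 + Cmod s) / 2)%R). assert (H0 := Cmod_ge_0 s).
  assert (Hr : 0 <= r < 1) by (unfold r; lra).
  assert (Hsr : Cmod s <= r) by (unfold r; lra).
  assert (P1 := psum_bin (A + 1) r Hr). assert (P0 := psum_bin A r Hr).
  assert (P1' : psum (fun k => bin (A + 1) (S k)) r) by (apply psum_shift; auto; unfold r; lra).
  replace ((1 - s) * pser (bin (A + 1)) s)
    with (pser (bin (A + 1)) s - s * pser (bin (A + 1)) s) by ring.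
  rewrite (pser_shift (bin (A + 1)) r) at 1; auto; [|unfold r; lra].
  rewrite (pser_shift (bin A) r); auto; [|unfold r; lra].
  rewrite !bin_0.
  destruct (pser_minus _ _ r s (proj1 Hr) P1' P1 Hsr) as [_ E].
  replace (pser (fun k => bin A (S k)) s)
    with (pser (fun k => bin (A + 1) (S k) - bin (A + 1) k) s).
  - rewrite E. ring.
  - apply CSeries_ext. intros k. now rewrite bin_pascal.
Qed.

Lemma pser_bin_add (A s : C) (k : nat) : (Cmod s < 1) ->
  (1 - s) ^ k * pser (bin (A + INR k)) s = pser (bin A) s.
Proof.
  intros Hs. induction k as [|k IH].
  - simpl INR. rewrite Cplus_0_r. cbn [Cpow]. ring.
  - rewrite RtoC_INR_S, Cplus_assoc, <- IH, <- (pser_bin_S (A + INR k)) by auto.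
    cbn [Cpow]. ring.
Qed.

Lemma Cpoch_nonneg (t : R) (n : nat) : (0 <= t) ->
  exists x, (0 <= x) /\ Cpoch (RtoC t) n = RtoC x.
Proof.
  intros Ht. induction n as [|n (x & Hx & E)].
  - exists 1%R. split; [lra|reflexivity].
  - exists (x * (t + INR n))%R. split.
    + apply Rmult_le_pos; auto. assert (P := pos_INR n). lra.
    + cbn [Cpoch]. now rewrite E, RtoC_mult, RtoC_plus.
Qed.

Lemma Cmod_Cpoch_le (A : C) (t : R) (n : nat) : (Cmod A <= t) ->
  (Cmod (Cpoch A n) <= Cmod (Cpoch (RtoC t) n)).
Proof.
  intros Ht. assert (P := Cmod_ge_0 A).
  induction n as [|n IH]; cbn [Cpoch]; [lra|]. rewrite !Cmod_mult.
  apply Rmult_le_compat; auto using Cmod_ge_0.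
  assert (Q := pos_INR n).
  rewrite <- RtoC_plus, (Cmod_R (t + _)), (Rabs_pos_eq (t + _)) by lra.
  tri. rewrite Cmod_pos; lra.
Qed.

Lemma pnorm_bin_add (A : C) (r : R) (k : nat) : (0 <= r < 1) ->
  (pnorm (bin (A + INR k)) r
     <= (/ (1 - r)) ^ k * pnorm (bin (RtoC (Cmod A))) r).
Proof.
  intros Hr. set (t := Cmod A). assert (Ht : 0 <= t) by apply Cmod_ge_0.
  assert (Hreal : forall x, (0 <= x) -> pser (bin (RtoC x)) r = RtoC (pnorm (bin (RtoC x)) r)).
  { intros x Hx. unfold pser, CSeries, pnorm, RtoC.
    assert (E : forall j, bin (RtoC x) j * RtoC r ^ j = RtoC (Cmod (bin (RtoC x) j) * r ^ j)).
    { intros j. destruct (Cpoch_nonneg x j Hx) as (y & Hy & E).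
      unfold bin. rewrite E. unfold Cdiv.
      assert (F : 0 < INR (fact j)) by apply INR_fact_lt_0.
      rewrite <- RtoC_inv by lra. rewrite <- RtoC_mult, Cmod_R, Rabs_pos_eq.
      - now rewrite <- RtoC_pow, <- RtoC_mult.
      - apply Rmult_le_pos; auto. left. now apply Rinv_0_lt_compat. }
    f_equal.
    - apply Series_ext. intros j. fold (RtoC x) (RtoC r). now rewrite E.
    - rewrite (Series_ext _ (fun _ => 0 * 0)%R).
      + rewrite Series_scal_l. ring.
      + intros j. fold (RtoC x) (RtoC r). rewrite E. simpl. ring. }
  assert (B := pser_bin_add (RtoC t) (RtoC r) k ltac:(rewrite Cmod_pos; lra)).
  rewrite <- RtoC_plus, !Hreal in B by (try assert (P := pos_INR k); lra).
  rewrite <- RtoC_minus, <- RtoC_pow, <- RtoC_mult in B. apply RtoC_inj in B.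
  rewrite <- B, <- Rmult_assoc, <- Rpow_mult_distr, Rinv_l, pow1, Rmult_1_l by lra.
  apply Series_le; [|apply psum_bin; auto].
  intros j. split; [apply pterm_nonneg; lra|].
  apply Rmult_le_compat_r; [apply pow_le; lra|].
  unfold bin. assert (F := INR_fact_neq0 j). rewrite !Cmod_div by auto.
  apply Rmult_le_compat_r.
  - left. apply Rinv_0_lt_compat. now apply Cmod_gt_0.
  - apply Cmod_Cpoch_le. tri.
    assert (P := pos_INR k). rewrite Cmod_pos by auto. unfold t. lra.
Qed.

Lemma Csum_plus (u v : nat -> C) (n : nat) :
  Csum (fun k => u k + v k) n = Csum u n + Csum v n.
Proof. induction n as [|n IH]; cbn [Csum]; [ring|]. rewrite IH. ring. Qed.

Lemma Csum_S_l (u : nat -> C) (n : nat) :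
  Csum u (S n) = u O + Csum (fun k => u (S k)) n.
Proof.
  induction n as [|n IH]; [cbn [Csum]; ring|].
  change (Csum u (S (S n))) with (Csum u (S n) + u (S n)).
  rewrite IH. cbn [Csum]. ring.
Qed.

(** Leibniz' rule for the derivative of a product of power series.  It turns the
    binomial theorem and the Chu-Vandermonde identity into recursions. *)
Lemma conv_derivation (a b a' b' : nat -> C) (n : nat) :
  (forall k, (RtoC (INR k) + 1) * a (S k) = a' k) ->
  (forall k, (RtoC (INR k) + 1) * b (S k) = b' k) ->
  (RtoC (INR n) + 1) * conv a b (S n) = conv a' b n + conv a b' n.
Proof.
  intros Ha Hb. unfold conv at 1.
  rewrite Cmult_comm, <- Csum_scal_r.
  rewrite (Csum_ext _ (fun i => RtoC (INR i) * a i * b (S n - i)%nat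
    + a i * (RtoC (INR (S n - i)) * b (S n - i)%nat))).
  - rewrite Csum_plus. f_equal.
    + rewrite Csum_S_l. simpl INR at 1. rewrite !Cmult_0_l, Cplus_0_l.
      apply Csum_ext. intros k Hk. rewrite RtoC_INR_S, Ha. reflexivity.
    + change (Csum ?u (S (S n))) with (Csum u (S n) + u (S n)). cbv beta.
      replace (S n - S n)%nat with O by lia. simpl INR at 2.
      rewrite Cmult_0_l, Cmult_0_r, Cplus_0_r.
      apply Csum_ext. intros k Hk. replace (S n - k)%nat with (S (n - k)) by lia.
      rewrite RtoC_INR_S, Hb. reflexivity.
  - intros k Hk.
    replace (RtoC (INR n) + 1) with (RtoC (INR k) + INR (S n - k)); [ring|].
    rewrite <- RtoC_plus, <- plus_INR, <- RtoC_INR_S. f_equal. f_equal. lia.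
Qed.

Lemma conv_scal_l (c : C) (a b : nat -> C) (n : nat) :
  conv (fun k => c * a k) b n = c * conv a b n.
Proof.
  unfold conv. rewrite (Cmult_comm c), <- Csum_scal_r. apply Csum_ext. intros. ring.
Qed.

Lemma conv_scal_r (c : C) (a b : nat -> C) (n : nat) :
  conv a (fun k => c * b k) n = c * conv a b n.
Proof.
  unfold conv. rewrite (Cmult_comm c), <- Csum_scal_r. apply Csum_ext. intros. ring.
Qed.

Lemma INR_S_neq0 (k : nat) : RtoC (INR k) + 1 <> 0.
Proof. rewrite <- RtoC_INR_S. apply RtoC_neq0, not_0_INR. lia. Qed.

Lemma RtoC_fact_S (k : nat) :
  RtoC (INR (fact (S k))) = (RtoC (INR k) + 1) * INR (fact k).
Proof. change (fact (S k)) with (S k * fact k)%nat. now rewrite mult_INR, RtoC_mult, RtoC_INR_S. Qed.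

Lemma binomial_conv (x y : C) (n : nat) :
  conv (fun k => x ^ k / INR (fact k)) (fun k => y ^ k / INR (fact k)) n
  = (x + y) ^ n / INR (fact n).
Proof.
  induction n as [|n IH].
  - unfold conv. simpl. field.
  - assert (D : forall z k, (RtoC (INR k) + 1) * (z ^ S k / RtoC (INR (fact (S k))))
      = z * (z ^ k / INR (fact k))).
    { intros z k. rewrite RtoC_fact_S. cbn [Cpow].
      assert (H1 := INR_S_neq0 k). assert (H2 := INR_fact_neq0 k). field. auto. }
    assert (E := conv_derivation (fun k => x ^ k / INR (fact k))
      (fun k => y ^ k / INR (fact k)) _ _ n (D x) (D y)).
    rewrite conv_scal_l, conv_scal_r, IH in E.
    assert (H1 := INR_S_neq0 n). assert (H2 := INR_fact_neq0 n).
    rewrite RtoC_fact_S. cbn [Cpow].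
    set (v := conv _ _ (S n)) in *.
    replace v with (/ (RtoC (INR n) + 1) * ((RtoC (INR n) + 1) * v)) by (field; auto).
    rewrite E. field. auto.
Qed.

(** The sum of (-1)^k binomial(n, k) (D)_k / (c)_k, divided by n!, is the Cauchy product
    of this sequence with 1/m!. *)
Definition chu (D c : C) (k : nat) : C :=
  (RtoC (-1)) ^ k * Cpoch D k / (Cpoch c k * INR (fact k)).

Lemma not_pole_S (c : C) : not_pole c -> not_pole (c + 1).
Proof.
  intros H n. specialize (H (S n)). rewrite RtoC_INR_S in H.
  now replace (c + 1 + INR n) with (c + (RtoC (INR n) + 1)) by ring.
Qed.

Lemma Chu_Vandermonde (D c : C) (n : nat) : not_pole c ->
  conv (chu D c) (fun m => / INR (fact m)) n
  = Cpoch (c - D) n / (Cpoch c n * INR (fact n)).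
Proof.
  revert D c. induction n as [|n IH]; intros D c Hc.
  - unfold conv, chu. simpl. field.
  - assert (Hc0 : c <> 0) by (specialize (Hc O); simpl INR in Hc; now rewrite Cplus_0_r in Hc).
    assert (D1 : forall k, (RtoC (INR k) + 1) * chu D c (S k)
      = - (D / c) * chu (D + 1) (c + 1) k).
    { intros k. unfold chu. rewrite RtoC_fact_S, !Cpoch_S_l. cbn [Cpow].
      assert (H1 := INR_S_neq0 k). assert (H2 := INR_fact_neq0 k).
      assert (H3 := Cpoch_neq0 (c + 1) k (not_pole_S c Hc)).
      field. auto. }
    assert (D2 : forall k, (RtoC (INR k) + 1) * / RtoC (INR (fact (S k)))
      = / INR (fact k)).
    { intros k. rewrite RtoC_fact_S.
      assert (H1 := INR_S_neq0 k). assert (H2 := INR_fact_neq0 k). field. auto. }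
    assert (E := conv_derivation (chu D c)
      (fun m => / INR (fact m)) _ _ n D1 D2).
    rewrite conv_scal_l, !IH in E by auto using not_pole_S.
    replace (c + 1 - (D + 1)) with (c - D) in E by ring.
    assert (H1 := INR_S_neq0 n). assert (H2 := INR_fact_neq0 n).
    assert (H3 := Cpoch_neq0 (c + 1) n (not_pole_S c Hc)).
    assert (H4 := Cpoch_neq0 c n Hc). assert (H5 := Hc n).
    assert (E2 : Cpoch c n * (c + INR n) = c * Cpoch (c + 1) n)
      by (rewrite <- Cpoch_S_l; reflexivity).
    assert (E3 : Cpoch (c + 1) n = Cpoch c n * (c + INR n) / c)
      by (rewrite E2; field; auto).
    set (v := conv _ _ (S n)) in *.
    replace v with (/ (RtoC (INR n) + 1) * ((RtoC (INR n) + 1) * v)) by (field; auto).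
    rewrite E, E3, RtoC_fact_S. cbn [Cpoch]. field. auto.
Qed.

(** Substituting [x + (1 - x) u] in the binomial series multiplies it by its value at
    [x]; the restriction to [0 <= x < 1] makes the rearrangement converge for every
    [u] in the unit disc. *)
Lemma pser_bin_homothety (A : C) (x : R) (u : C) : (0 <= x < 1) -> (Cmod u < 1) ->
  pser (bin A) (RtoC x + RtoC (1 - x) * u) = pser (bin A) x * pser (bin A) u.
Proof.
  intros Hx Hu. set (y := (1 - x)%R). assert (Hy : 0 < y) by (unfold y; lra).
  set (g := fun k m => bin A k * (RtoC y * u) ^ k
    * (bin (A + INR k) m * RtoC x ^ m)).
  assert (HxC : Cmod x <= x) by (rewrite Cmod_pos; lra).
  assert (Hg : forall k, Csummable (g k)).
  { intros k. apply Csummable_scal. apply psum_summable with x; auto. now apply psum_bin. }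
  set (K := pnorm (bin (RtoC (Cmod A))) x).
  assert (Hgb : forall k, (Series (fun m => Cmod (g k m))
    <= Cmod (bin A k) * Cmod u ^ k * K)).
  { intros k. apply Rle_trans with
      (Cmod (bin A k * (RtoC y * u) ^ k) * pnorm (bin (A + INR k)) x)%R.
    - unfold pnorm. rewrite <- Series_scal_l. apply Series_le.
      + intros m. split; [apply Cmod_ge_0|]. unfold g. rewrite (Cmod_mult (bin A k * _)).
        apply Rmult_le_compat_l; auto using Cmod_ge_0, pterm_le.
      + exact (ex_series_scal_l _ _ (psum_bin (A + INR k) x Hx)).
    - rewrite Cmod_mult, Cmod_pow, Cmod_mult, Cmod_R, (Rabs_pos_eq y) by lra.
      rewrite Rpow_mult_distr.
      apply Rle_trans with (Cmod (bin A k) * (y ^ k * Cmod u ^ k)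
        * ((/ y) ^ k * K))%R.
      + apply Rmult_le_compat_l; [|apply (pnorm_bin_add A x k Hx)].
        apply Rmult_le_pos; [apply Cmod_ge_0|].
        apply Rmult_le_pos; apply pow_le; [lra|apply Cmod_ge_0].
      + right. rewrite pow_inv. field. apply pow_nonzero. lra. }
  assert (Hb : ex_series (fun k => Cmod (bin A k) * Cmod u ^ k * K)%R).
  { apply (ex_series_scal_r K (fun k => Cmod (bin A k) * Cmod u ^ k)%R).
    apply psum_bin. split; [apply Cmod_ge_0|auto]. }
  destruct (CSeries_triangle g _ Hg Hgb Hb) as (_ & _ & E).
  unfold pser at 1.
  rewrite (CSeries_ext _ (fun n => Csum (fun k => g k (n - k)%nat) (S n))), E.
  - unfold pser at 2. rewrite <- CSeries_scal.
    + apply CSeries_ext. intros k. unfold g.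
      rewrite CSeries_scal by (apply psum_summable with x; auto; now apply psum_bin).
      change (CSeries (fun m => bin (A + INR k) m * RtoC x ^ m))
        with (pser (bin (A + INR k)) x).
      rewrite <- (pser_bin_add A (RtoC x) k) by lra.
      replace (1 - RtoC x) with (RtoC y) by (unfold y; now rewrite RtoC_minus).
      rewrite Cpow_mult_l. ring.
    + apply psum_summable with (Cmod u); [|lra]. apply psum_bin.
      split; [apply Cmod_ge_0|auto].
  - intros n. assert (B := binomial_conv (RtoC y * u) (RtoC x) n).
    replace (bin A n * (RtoC x + RtoC y * u) ^ n) with
      (Cpoch A n * ((RtoC y * u + RtoC x) ^ n / INR (fact n))).
    + rewrite <- B. unfold conv. rewrite Cmult_comm, <- Csum_scal_r. apply Csum_ext.
      intros k Hk. unfold g, bin.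
      replace (Cpoch A n) with (Cpoch A k * Cpoch (A + INR k) (n - k)).
      * assert (H1 := INR_fact_neq0 k). assert (H2 := INR_fact_neq0 (n - k)).
        field. auto.
      * rewrite <- Cpoch_add. f_equal. lia.
    + unfold bin. assert (H1 := INR_fact_neq0 n).
      rewrite (Cplus_comm (RtoC y * u)). field. auto.
Qed.

(** If the binomial series vanished at [x] it would vanish around [x], hence along
    the segment down to 0, where its value is 1. *)
Lemma pser_bin_neq0 (A : C) (x : R) : (0 < x < 1) -> pser (bin A) x <> 0.
Proof.
  intros Hx E.
  assert (Ex : forall y, has_expansion (fun _ => 0) y).
  { intros y. apply has_expansion_ext with (2 := has_expansion_affine 0 0 y).
    intros. ring. }
  assert (P : pser (bin A) 0 = 0).
  { apply (identity_on_segment (pser (bin A)) (fun _ => 0) (RtoC x) 0).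
    - intros t Ht. apply has_expansion_pser with ((1 + x) / 2)%R.
      + apply psum_bin. lra.
      + replace (RtoC x + RtoC t * (0 - RtoC x)) with (RtoC (x * (1 - t)))
          by (rewrite RtoC_mult, RtoC_minus; ring).
        rewrite Cmod_pos by nra. nra.
    - intros t _. apply Ex.
    - exists ((1 - x) / x)%R. split; [apply Rdiv_lt_0_compat; lra|].
      intros t Ht.
      assert (Htx : t * x < 1 - x) by (apply Rlt_div_r; lra).
      replace (RtoC x + RtoC t * (0 - RtoC x))
        with (RtoC x + RtoC (1 - x) * RtoC (- (t * x / (1 - x)))).
      + rewrite pser_bin_homothety; [|lra|].
        * rewrite E. ring.
        * rewrite Cmod_R, Rabs_Ropp, Rabs_pos_eq.
          -- apply Rlt_div_l; lra.
          -- apply Rmult_le_pos; [nra|left; apply Rinv_0_lt_compat; lra].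
      + rewrite <- RtoC_mult. replace ((1 - x) * - (t * x / (1 - x)))%R with (- (t * x))%R
          by (field; lra). rewrite RtoC_opp, RtoC_mult. ring. }
  rewrite (pser_at_0 _ (1 / 2)), bin_0 in P; [now apply C1_nz|lra|].
  apply psum_bin. lra.
Qed.

(** * The hypergeometric function off the unit disc *)

(** Pfaff's transformation near the origin: the series in powers of u/(u-1) is multiplied
    out with (1-u)^(-A), and the coefficient of u^n is a Chu-Vandermonde sum. *)
Lemma Pfaff_near_0 (A B c u : C) : not_pole c -> (Cmod u <= 1 / 4) ->
  pser (bin A) u * pser (hyp_coef A (c - B) c) (u / (u - 1)) = pser (hyp_coef A B c) u.
Proof.
  intros Hc Hu. set (D := c - B). set (phi := hyp_coef A D c).
  set (r := (1 / 4)%R). assert (Hr : 0 <= r < 1) by (unfold r; lra).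
  set (g := fun k m => phi k * (- u) ^ k * (bin (A + INR k) m * u ^ m)).
  assert (Hg : forall k, Csummable (g k)).
  { intros k. apply Csummable_scal. apply psum_summable with r; auto. now apply psum_bin. }
  set (K := pnorm (bin (RtoC (Cmod A))) r).
  assert (Hgb : forall k, (Series (fun m => Cmod (g k m))
    <= Cmod (phi k) * (1 / 3) ^ k * K)).
  { intros k. apply Rle_trans with
      (Cmod (phi k * (- u) ^ k) * pnorm (bin (A + INR k)) r)%R.
    - unfold pnorm. rewrite <- Series_scal_l. apply Series_le.
      + intros m. split; [apply Cmod_ge_0|]. unfold g. rewrite (Cmod_mult (phi k * _)).
        apply Rmult_le_compat_l; auto using Cmod_ge_0, pterm_le.
      + exact (ex_series_scal_l _ _ (psum_bin (A + INR k) r Hr)).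
    - rewrite Cmod_mult, Cmod_pow, Cmod_opp.
      apply Rle_trans with (Cmod (phi k) * r ^ k * ((/ (1 - r)) ^ k * K))%R.
      + apply Rmult_le_compat; [| |  |apply (pnorm_bin_add A r k Hr)].
        * apply Rmult_le_pos; [apply Cmod_ge_0|apply pow_le, Cmod_ge_0].
        * apply pnorm_nonneg; [lra|now apply psum_bin].
        * apply Rmult_le_compat_l; [apply Cmod_ge_0|]. apply pow_incr.
          split; [apply Cmod_ge_0|auto].
      + right. replace (1 / 3)%R with (r * / (1 - r))%R by (unfold r; field).
        rewrite Rpow_mult_distr. ring. }
  assert (Hb : ex_series (fun k => Cmod (phi k) * (1 / 3) ^ k * K)%R).
  { apply (ex_series_scal_r K (fun k => Cmod (phi k) * (1 / 3) ^ k)%R).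
    apply psum_hyp_coef; auto. lra. }
  destruct (CSeries_triangle g _ Hg Hgb Hb) as (_ & _ & E).
  assert (H1u : 1 - u <> 0).
  { intros E0. assert (Eu : u = 1) by (replace u with (1 - (1 - u)) by ring; rewrite E0; ring).
    rewrite Eu, Cmod_1 in Hu. lra. }
  assert (Hu1 : u - 1 <> 0).
  { intros E0. apply H1u. replace (1 - u) with (- (u - 1)) by ring. rewrite E0. ring. }
  assert (Hv : Cmod (u / (u - 1)) <= 1 / 3).
  { rewrite Cmod_div by auto.
    assert (1 <= Cmod (u - 1) + Cmod u).
    { rewrite <- Cmod_1 at 1. replace (RtoC 1) with (- (u - 1) + u) at 1 by ring.
      tri. rewrite Cmod_opp. lra. }
    apply Rle_div_l; lra. }
  unfold pser at 3.
  rewrite (CSeries_ext _ (fun n => Csum (fun k => g k (n - k)%nat) (S n))), E.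
  - unfold pser at 2. rewrite <- CSeries_scal.
    + apply CSeries_ext. intros k. unfold g.
      rewrite CSeries_scal by (apply psum_summable with r; auto; now apply psum_bin).
      change (CSeries (fun m => bin (A + INR k) m * u ^ m))
        with (pser (bin (A + INR k)) u).
      rewrite <- (pser_bin_add A u k) by lra. fold phi.
      replace (- u) with ((1 - u) * (u / (u - 1))) by (field; auto).
      rewrite Cpow_mult_l. ring.
    + apply psum_summable with (1 / 3)%R; auto. apply psum_hyp_coef; auto. lra.
  - intros n. assert (V := Chu_Vandermonde D c n Hc).
    replace (c - D) with B in V by (unfold D; ring).
    assert (H1 := INR_fact_neq0 n). assert (H2 := Cpoch_neq0 c n Hc).
    replace (hyp_coef A B c n * u ^ n) with
      (Cpoch A n * u ^ n * (Cpoch B n / (Cpoch c n * INR (fact n))))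
      by (unfold hyp_coef; field; auto).
    rewrite <- V. unfold conv. rewrite Cmult_comm, <- Csum_scal_r. apply Csum_ext.
    intros k Hk. unfold g, bin, phi, hyp_coef, chu.
    replace (Cpoch A n) with (Cpoch A k * Cpoch (A + INR k) (n - k)).
    + replace (u ^ n) with (u ^ k * u ^ (n - k)) by (rewrite <- Cpow_add_r; f_equal; lia).
      replace (- u) with (RtoC (-1) * u) by ring.
      rewrite Cpow_mult_l.
      assert (H3 := INR_fact_neq0 k). assert (H4 := INR_fact_neq0 (n - k)).
      assert (H5 := Cpoch_neq0 c k Hc). field. auto.
    + rewrite <- Cpoch_add. f_equal. lia.
Qed.

(** Star-shapedness puts the segment [0, w] inside both domains, and along it the two
    continuations cannot separate. *)
Lemma is_hyp2F1_unique (A B c w v v' : C) :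
  is_hyp2F1 A B c w v -> is_hyp2F1 A B c w v' -> v = v'.
Proof.
  intros (U & f & _ & [_ HU] & _ & Hf & Hs & Hw & <-)
    (U' & f' & _ & [_ HU'] & _ & Hf' & Hs' & Hw' & <-).
  assert (E : forall t, 0 + RtoC t * (w - 0) = RtoC t * w) by (intros t; ring).
  apply (identity_on_segment f f' 0 w).
  - intros t Ht. rewrite E. apply analytic_has_expansion, Hf. now apply HU.
  - intros t Ht. rewrite E. apply analytic_has_expansion, Hf'. now apply HU'.
  - assert (P := Cmod_ge_0 w).
    assert (Hd : 0 < / (Cmod w + 1)) by (apply Rinv_0_lt_compat; lra).
    assert (Hd1 : / (Cmod w + 1) <= 1)
      by (rewrite <- Rinv_1; apply Rinv_le_contravar; lra).
    exists (/ (Cmod w + 1))%R. split; auto. intros t Ht. rewrite E.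
    assert (Hm : Cmod (RtoC t * w) < 1).
    { rewrite Cmod_mult, Cmod_pos by lra.
      apply Rle_lt_trans with (t * (Cmod w + 1))%R; [nra|].
      replace 1%R with (/ (Cmod w + 1) * (Cmod w + 1))%R at 2 by (field; lra).
      apply Rmult_lt_compat_r; lra. }
    eapply Cis_series_unique; [apply Hs|apply Hs']; auto; [apply HU|apply HU']; auto; lra.
Qed.

(** Pfaff's transformation provides a continuation to a disc which contains 0 and
    the argument xi/(xi-1) and lies in the half-plane Re u < 1/2: there u/(u-1) lies in the unit disc and
    equals xi at that point.  The factor (1-u)^(-A) is written as a quotient of values
    of the binomial series re-centred at xi/(xi-1), so that no logarithm is needed. *)
Lemma hyp2F1_value (A B c : C) (xi : R) : (0 < xi < 1) -> not_pole c ->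
  hyp2F1 A B c (RtoC (xi / (xi - 1)))
  = pser (hyp_coef A (c - B) c) (RtoC xi) / pser (bin A) xi.
Proof.
  intros Hxi Hc. set (w := (xi / (xi - 1))%R).
  assert (Hw : w < 0).
  { unfold w. replace (xi / (xi - 1))%R with (- (xi / (1 - xi)))%R by (field; lra).
    assert (0 < xi / (1 - xi)) by (apply Rdiv_lt_0_compat; lra). lra. }
  assert (HwE : ((1 - xi) * w = - xi)%R) by (unfold w; field; lra).
  set (beta := pser (bin A) xi).
  assert (Hbeta : beta <> 0) by (now apply pser_bin_neq0).
  set (sig := fun u => RtoC (1 - xi) * u + RtoC xi).
  set (mob := fun u => u * / (1 * u + RtoC (-1))).
  set (Phi := pser (hyp_coef A (c - B) c)).
  set (f := fun u => (0 * u + / beta) * (pser (bin A) (sig u) * Phi (mob u))).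
  set (U := fun u : C => (Cmod (u - RtoC w) < 1 / 2 - w)).
  assert (Hre : forall u, U u -> (Re u < 1 / 2)).
  { intros u Hu. unfold U in Hu. assert (B1 := re_le_Cmod (u - RtoC w)).
    assert (B2 := Rle_abs (Re (u - RtoC w))).
    replace (Re (u - RtoC w)) with (Re u - w)%R in * by (destruct u; simpl; ring). lra. }
  assert (Hsig : forall u, U u -> (Cmod (sig u) < (1 + xi) / 2)).
  { intros u Hu. unfold sig.
    replace (RtoC (1 - xi) * u + RtoC xi) with (RtoC (1 - xi) * (u - RtoC w)).
    - rewrite Cmod_mult, Cmod_pos by lra. unfold U in Hu.
      replace ((1 + xi) / 2)%R with ((1 - xi) * (1 / 2 - w))%R by lra.
      apply Rmult_lt_compat_l; lra.
    - replace (RtoC xi) with (RtoC (- ((1 - xi) * w))) by (f_equal; lra).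
      rewrite RtoC_opp, RtoC_mult. ring. }
  assert (Hden : forall u, (Re u < 1 / 2) -> 1 * u + RtoC (-1) <> 0).
  { intros u Hu E. apply (f_equal Re) in E. destruct u as [u1 u2]. simpl in E, Hu. lra. }
  assert (Hmob : forall u, (Re u < 1 / 2) -> (Cmod (mob u) < 1)).
  { intros u Hu. unfold mob. fold (u / (1 * u + RtoC (-1))).
    rewrite Cmod_div by auto. assert (P : 0 < Cmod (1 * u + RtoC (-1)))
      by (apply Cmod_gt_0; auto).
    apply Rlt_div_l; auto. rewrite Rmult_1_l. unfold Cmod. apply sqrt_lt_1_alt.
    destruct u as [u1 u2]. simpl in *. nra. }
  assert (Hseg : forall u (t : R), U u -> (0 <= t <= 1) -> U (RtoC t * u)).
  { intros u t Hu Ht. unfold U in *.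
    replace (RtoC t * u - RtoC w) with (RtoC t * (u - RtoC w) + RtoC ((1 - t) * - w))
      by (rewrite RtoC_mult, RtoC_minus, RtoC_opp; ring).
    eapply Rle_lt_trans; [apply Cmod_triangle|].
    rewrite Cmod_mult, !Cmod_R, (Rabs_pos_eq t), (Rabs_pos_eq ((1 - t) * - w)) by nra.
    destruct (Req_dec t 0) as [->|Ht0]; [lra|].
    assert (t * Cmod (u - RtoC w) < t * (1 / 2 - w)) by (apply Rmult_lt_compat_l; lra).
    nra. }
  assert (Hf : forall u, U u -> has_expansion f u).
  { intros u Hu. unfold f. apply has_expansion_mult; [apply has_expansion_affine|].
    apply has_expansion_mult.
    - apply (has_expansion_comp (pser (bin A)) sig); [|apply has_expansion_affine].
      apply has_expansion_pser with ((1 + xi) / 2)%R; auto. apply psum_bin. lra.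
    - apply (has_expansion_comp Phi mob).
      + assert (M := Hmob u (Hre u Hu)). assert (M0 := Cmod_ge_0 (mob u)).
        apply has_expansion_pser with ((1 + Cmod (mob u)) / 2)%R; [|lra].
        apply psum_hyp_coef; auto. lra.
      + unfold mob. apply has_expansion_mult.
        * apply has_expansion_ext with (2 := has_expansion_affine 1 0 u). intros; ring.
        * apply (has_expansion_comp Cinv (fun v => 1 * v + RtoC (-1)));
            [|apply has_expansion_affine].
          apply has_expansion_Cinv, Hden, Hre, Hu. }
  assert (Hnear : forall u, (Cmod u <= 1 / 4) -> f u = pser (hyp_coef A B c) u).
  { intros u Hu. unfold f, sig, mob. rewrite Cplus_comm at 1.
    rewrite (Cplus_comm (RtoC (1 - xi) * u)), pser_bin_homothety by lra.
    rewrite <- Pfaff_near_0 by auto. fold beta. unfold Phi, Cdiv.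
    replace (1 * u + RtoC (-1)) with (u - 1) by ring.
    field. auto. }
  assert (Hw0 : U (RtoC w)).
  { unfold U. replace (RtoC w - RtoC w) with (RtoC 0) by ring. rewrite Cmod_0. lra. }
  assert (Main : is_hyp2F1 A B c (RtoC w) (Phi (RtoC xi) / beta)).
  { exists U, f. repeat split.
    - intros u Hu. apply locally_Cmod. unfold U in *.
      exists (1 / 2 - w - Cmod (u - RtoC w))%R. split; [lra|]. intros y Hy.
      replace (y - RtoC w) with ((y - u) + (u - RtoC w)) by ring.
      eapply Rle_lt_trans; [apply Cmod_triangle|]. lra.
    - unfold U. replace (0 - RtoC w) with (RtoC (- w)) by (rewrite RtoC_opp; ring).
      rewrite Cmod_pos; lra.
    - intros u t Hu Ht. now apply Hseg.
    - intros u Hu [_ H1]. specialize (Hre u Hu). lra.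
    - intros u Hu. now apply has_expansion_analytic, Hf.
    - intros u Hu Hu1.
      set (m := ((1 + Cmod u) / 2)%R). assert (P := Cmod_ge_0 u).
      assert (Hm : psum (hyp_coef A B c) m) by (apply psum_hyp_coef; auto; unfold m; lra).
      replace (f u) with (pser (hyp_coef A B c) u);
        [apply CSeries_correct, psum_summable with m; auto; unfold m; lra|].
      assert (E : forall t, 0 + RtoC t * (u - 0) = RtoC t * u) by (intros t; ring).
      symmetry. apply (identity_on_segment f (pser (hyp_coef A B c)) 0 u).
      + intros t Ht. rewrite E. apply Hf. now apply Hseg.
      + intros t Ht. rewrite E. apply has_expansion_pser with m; auto.
        rewrite Cmod_mult, Cmod_pos by lra. unfold m. nra.
      + exists (1 / 4)%R. split; [lra|]. intros t Ht. rewrite E. apply Hnear.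
        rewrite Cmod_mult, Cmod_pos by lra. nra.
    - exact Hw0.
    - unfold f, sig, mob.
      replace (RtoC (1 - xi) * RtoC w + RtoC xi) with (RtoC 0)
        by (rewrite <- RtoC_mult, HwE, RtoC_opp; ring).
      rewrite (pser_at_0 (bin A) (1 / 2)), bin_0 by (try apply psum_bin; lra).
      replace (RtoC w * / (1 * RtoC w + RtoC (-1))) with (RtoC xi); [field; auto|].
      rewrite Cmult_1_l, <- RtoC_plus, <- RtoC_inv, <- RtoC_mult by lra.
      f_equal. unfold w. field. lra. }
  apply (@iota_unique C_AbsRing C_CompleteNormedModule); [|exact Main].
  intros v Hv. eapply is_hyp2F1_unique; eauto.
Qed.

(** * The regularised function as a series entire in the third parameter *)

(** By Pfaff's transformation F(A, B; c; xi/(xi-1)) / Gamma(c) is, up to a constant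
    factor, this series with [D = c - B]. *)
Definition reg_term (xi : R) (A D c : C) (n : nat) : C :=
  bin A n * RtoC xi ^ n * (Cpoch D n * recip_Gamma (c + INR n)).

Definition reg_series (xi : R) (A D c : C) : C := CSeries (reg_term xi A D c).

Lemma Cder_local_bounds (f : C -> C) (x d : C) : Cder f x d ->
  exists delta M, (0 < delta) /\ (0 <= M) /\ forall h, Cmod h < delta ->
    (Cmod (f (x + h)%C) <= M) /\ (Cmod (f (x + h)%C - f x) <= M * Cmod h).
Proof.
  intros H. destruct (H 1%R ltac:(lra)) as (e & He & He').
  assert (P := Cmod_ge_0 d). assert (Q := Cmod_ge_0 (f x)).
  exists (Rmin 1 e), (Cmod (f x) + (Cmod d + 1))%R.
  split; [apply Rmin_pos; lra|]. split; [lra|].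
  intros h Hh. assert (M1 := Rmin_l 1 e). assert (M2 := Rmin_r 1 e).
  assert (P0 := Cmod_ge_0 h).
  assert (B : Cmod (f (x + h)%C - f x) <= (Cmod d + 1) * Cmod h).
  { destruct (Ceq_dec h 0) as [->|Nh].
    - rewrite Cplus_0_r. replace (f x - f x) with (RtoC 0) by ring. rewrite Cmod_0. lra.
    - assert (Hp : 0 < Cmod h) by now apply Cmod_gt_0.
      specialize (He' h ltac:(lra)).
      assert (B1 : Cmod ((f (x + h)%C - f x) / h) <= Cmod d + 1).
      { replace ((f (x + h) - f x) / h) with (((f (x + h) - f x) / h - d) + d) by ring.
        tri. lra. }
      rewrite Cmod_div in B1 by auto. now apply Rle_div_l in B1. }
  split.
  - replace (f (x + h)) with ((f (x + h) - f x) + f x) by ring.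
    tri. nra.
  - eapply Rle_trans; [apply B|]. nra.
Qed.

Lemma Cder_Cpoch (s b : C) (n : nat) : exists d, Cder (fun c => Cpoch (c + b) n) s d.
Proof.
  induction n as [|n [d IH]].
  - exists 0. apply (Cder_const 1).
  - eexists. cbn [Cpoch]. apply Cder_mult; [apply IH|].
    apply Cder_plus; [|apply Cder_const]. apply Cder_plus; [apply Cder_id|apply Cder_const].
Qed.

Lemma Cder_reg_term (xi : R) (A B c : C) (n : nat) :
  exists d, Cder (fun y => reg_term xi A (y - B) y n) c d.
Proof.
  destruct (Cder_Cpoch c (- B) n) as [d Hd].
  destruct (Cder_recip_Gamma (c + INR n)) as [e He].
  eexists. unfold reg_term. apply Cder_mult; [apply Cder_const|].
  apply Cder_mult; [apply Hd|]. apply Cder_shift. apply He.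
Qed.

(** Consecutive factors have ratio [1 - B/(c+n)], which for large [n] is close to 1 and
    has a small Lipschitz constant in [c]; the geometric factor [xi^n] absorbs both. *)
Lemma reg_term_bounds (xi : R) (A B c : C) : (0 < xi < 1) ->
  exists N M delta, (0 < delta) /\ ex_series M /\ forall n h, Cmod h < delta ->
    (Cmod (reg_term xi A (c + h - B) (c + h) (N + n)) <= M n) /\
    (Cmod (reg_term xi A (c + h - B) (c + h) (N + n) - reg_term xi A (c - B) c (N + n))
       <= M n * Cmod h).
Proof.
  intros Hxi.
  set (tau := (2 / (1 + xi))%R). set (rho := ((1 + tau) / 2)%R).
  assert (Htau : 1 < tau) by (apply Rlt_div_r; lra).
  assert (Hrho : 1 < rho) by (unfold rho; lra).
  set (K := (Cmod c + Cmod B + 1)%R).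
  assert (P1 := Cmod_ge_0 c). assert (P2 := Cmod_ge_0 B).
  assert (HK : 1 <= K) by (unfold K; lra).
  destruct (linear_ratio_bound K rho ltac:(lra) Hrho) as (N1 & _ & _ & HN1).
  destruct (INR_unbounded (K + 1 + K / (rho - 1))) as [N2 HN2].
  set (N := (N1 + N2)%nat).
  set (q := fun n y => Cpoch (y - B) n * recip_Gamma (y + INR n)).
  set (r := fun n h => (c + h - B + INR (N + n)) / (c + h + INR (N + n))).
  assert (Hq : exists d, Cder (q N) c d).
  { destruct (Cder_Cpoch c (- B) N) as [d Hd].
    destruct (Cder_recip_Gamma (c + INR N)) as [e He].
    eexists. apply Cder_mult; [apply Hd|]. apply Cder_shift. apply He. }
  destruct Hq as [dq Hq]. destruct (Cder_local_bounds _ _ _ Hq) as (d0 & M0 & Hd0 & HM0 & Hq0).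
  set (delta := Rmin d0 1). assert (Hdelta : 0 < delta) by (apply Rmin_pos; lra).
  assert (Dl : delta <= d0) by apply Rmin_l. assert (Dr : delta <= 1) by apply Rmin_r.
  assert (Hr : forall n h, Cmod h < delta ->
    c + h + INR (N + n) <> 0 /\ (Cmod (r n h) <= rho)).
  { intros n h Hh. apply HN1; [lia| |].
    - replace (c + h - B) with (c + h + - B) by ring.
      tri. rewrite Cmod_opp.
      tri_l. unfold K. lra.
    - tri. unfold K. lra. }
  assert (HrL : forall n h, Cmod h < delta ->
    (Cmod (r n h - r n 0) <= (rho - 1) * Cmod h)).
  { intros n h Hh.
    assert (D0 : Cmod 0 < delta) by (rewrite Cmod_0; lra).
    destruct (Hr n h Hh) as [Z1 _]. destruct (Hr n 0 D0) as [Z0 _].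
    assert (Low : forall y, (Cmod y < delta) ->
      (1 + K / (rho - 1) <= Cmod (c + y + INR (N + n)))).
    { intros y Hy. assert (HNn : INR N2 <= INR (N + n)) by (apply le_INR; unfold N; lia).
      set (x := INR (N + n)) in *.
      assert (x <= Cmod (c + y + RtoC x) + Cmod (c + y)).
      { replace x with (Cmod x) at 1
          by (rewrite Cmod_pos; [auto|unfold x; apply pos_INR]).
        replace (RtoC x) with (c + y + RtoC x + - (c + y)) at 1 by ring.
        tri. rewrite Cmod_opp. lra. }
      assert (Cmod (c + y) <= Cmod c + Cmod y) by apply Cmod_triangle.
      unfold K in *. lra. }
    assert (L1 := Low h Hh). assert (L0 := Low 0 D0).
    assert (E : r n h - r n 0 =
      B * h / ((c + h + INR (N + n)) * (c + 0 + INR (N + n))))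
      by (rewrite Cplus_0_r in Z0; unfold r; rewrite !Cplus_0_r; field; auto).
    assert (Q : 0 < K / (rho - 1)) by (apply Rdiv_lt_0_compat; lra).
    rewrite E, Cmod_div, !Cmod_mult by now apply Cmult_neq_0.
    set (u := Cmod (c + h + INR (N + n))) in *.
    set (v := Cmod (c + 0 + INR (N + n))) in *.
    apply Rle_div_l; [nra|].
    assert (K / (rho - 1) <= u * v) by nra.
    assert (K <= (rho - 1) * (u * v)).
    { replace K with ((rho - 1) * (K / (rho - 1)))%R at 1 by (field; lra).
      apply Rmult_le_compat_l; lra. }
    assert (Ph := Cmod_ge_0 h).
    apply Rle_trans with (K * Cmod h)%R; [apply Rmult_le_compat_r; auto; unfold K; lra|].
    replace ((rho - 1) * Cmod h * (u * v))%R with ((rho - 1) * (u * v) * Cmod h)%R by ring.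
    now apply Rmult_le_compat_r. }
  assert (Main := product_Lipschitz (fun n h => q (N + n)%nat (c + h)) r
    (fun _ => rho) (fun _ => (rho - 1)%R) (fun n => (tau ^ n)%R) M0 delta
    Hdelta HM0 ltac:(intros; lra) ltac:(intros; lra) ltac:(simpl; lra)).
  assert (Main' : forall n h, Cmod h < delta ->
    (Cmod (q (N + n)%nat (c + h)%C) <= M0 * tau ^ n) /\
    (Cmod (q (N + n)%nat (c + h)%C - q (N + n)%nat c) <= M0 * tau ^ n * Cmod h)).
  { intros n h Hh. destruct (fun A1 A2 A3 A4 A5 A6 => Main A1 A2 A3 A4 A5 A6 n h Hh)
      as (_ & U1 & U2).
    - intros k. simpl. right. unfold rho. field.
    - intros k y Hy. destruct (Hr k y Hy) as [Z _]. unfold q, r.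
      rewrite Nat.add_succ_r. cbn [Cpoch]. rewrite RtoC_INR_S, Cplus_assoc.
      rewrite <- (recip_Gamma_S (c + y + INR (N + k))). field. auto.
    - intros k y Hy. apply Hr. auto.
    - exact HrL.
    - intros y Hy. rewrite Nat.add_0_r. apply Hq0. lra.
    - intros y Hy. rewrite Nat.add_0_r, Cplus_0_r. apply Hq0. lra.
    - rewrite Cplus_0_r in U2. auto. }
  assert (Hxt : 0 <= xi * tau < 1).
  { split; [nra|]. unfold tau. replace (xi * (2 / (1 + xi)))%R with (2 * xi / (1 + xi))%R
      by (field; lra). apply Rlt_div_l; lra. }
  exists N, (fun n => M0 * (Cmod (bin A (N + n)) * (xi * tau) ^ (N + n)))%R, delta.
  split; auto. split.
  { apply (ex_series_scal_l M0 (fun n => Cmod (bin A (N + n)) * (xi * tau) ^ (N + n))%R).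
    apply (ex_series_incr_n (fun n => Cmod (bin A n) * (xi * tau) ^ n)%R).
    now apply psum_bin. }
  assert (Hcoef : forall n, (Cmod (bin A (N + n) * RtoC xi ^ (N + n)) * tau ^ n
    <= Cmod (bin A (N + n)) * (xi * tau) ^ (N + n))).
  { intros n. rewrite Cmod_mult, Cmod_pow, Cmod_R, (Rabs_pos_eq xi), Rpow_mult_distr by lra.
    rewrite Rmult_assoc. apply Rmult_le_compat_l; [apply Cmod_ge_0|].
    apply Rmult_le_compat_l; [apply pow_le; lra|]. apply Rle_pow; [lra|lia]. }
  intros n h Hh. destruct (Main' n h Hh) as [U1 U2]. specialize (Hcoef n).
  set (b := bin A (N + n) * RtoC xi ^ (N + n)) in *.
  assert (Pb := Cmod_ge_0 b).
  split.
  - change (reg_term xi A (c + h - B) (c + h) (N + n)) with (b * q (N + n)%nat (c + h)).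
    rewrite Cmod_mult.
    apply Rle_trans with (Cmod b * (M0 * tau ^ n))%R; [now apply Rmult_le_compat_l|].
    replace (Cmod b * (M0 * tau ^ n))%R with (M0 * (Cmod b * tau ^ n))%R by ring.
    now apply Rmult_le_compat_l.
  - replace (reg_term xi A (c + h - B) (c + h) (N + n) - reg_term xi A (c - B) c (N + n))
      with (b * (q (N + n)%nat (c + h) - q (N + n)%nat c))
      by (unfold reg_term, q, b; ring).
    rewrite Cmod_mult.
    apply Rle_trans with (Cmod b * (M0 * tau ^ n * Cmod h))%R;
      [now apply Rmult_le_compat_l|].
    replace (Cmod b * (M0 * tau ^ n * Cmod h))%R
      with (M0 * (Cmod b * tau ^ n) * Cmod h)%R by ring.
    apply Rmult_le_compat_r; [apply Cmod_ge_0|]. now apply Rmult_le_compat_l.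
Qed.

Lemma reg_term_summable (xi : R) (A D c : C) : (0 < xi < 1) ->
  Csummable (reg_term xi A D c).
Proof.
  intros Hxi.
  destruct (reg_term_bounds xi A (c - D) c Hxi) as (N & M & d & Hd & HM & H).
  apply (ex_series_incr_n (fun n => Cmod (reg_term xi A D c n)) N).
  apply ex_series_Rle with M; auto. intros n.
  destruct (H n 0) as [B _]; [rewrite Cmod_0; auto|].
  rewrite Cplus_0_r in B. replace (c - (c - D)) with D in B by ring.
  rewrite Rabs_pos_eq by apply Cmod_ge_0. exact B.
Qed.

Lemma Cder_reg_series (xi : R) (A B c : C) : (0 < xi < 1) ->
  exists d, Cder (fun y => reg_series xi A (y - B) y) c d.
Proof.
  intros Hxi.
  destruct (reg_term_bounds xi A B c Hxi) as (N & M & d & Hd & HM & H).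
  apply (Cder_series N (fun n y => reg_term xi A (y - B) y n) c M d); auto.
  - intros n. apply Cder_reg_term.
  - intros n h Hh. now apply H.
  - intros n h Hh. now apply H.
Qed.

(** Three-term relation under a simultaneous shift of all parameters: this is the
    hypergeometric differential equation, read through F' = (AB/C) F(A+1, B+1; C+1)
    and Pfaff's transformation, and verified coefficient by coefficient. *)
Lemma reg_series_recurrence (xi : R) (A D c : C) : (0 < xi < 1) ->
  reg_series xi A D c =
  (c + (A - D + 1) * RtoC xi) * reg_series xi (A + 1) D (c + 1)
  - RtoC xi * ((A + 1) * (c - D + 1)) * reg_series xi (A + 1 + 1) D (c + 1 + 1).
Proof.
  intros Hxi. unfold reg_series.
  assert (S0 := reg_term_summable xi A D c Hxi).
  assert (S1 := reg_term_summable xi (A + 1) D (c + 1) Hxi).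
  assert (S2 := reg_term_summable xi (A + 1 + 1) D (c + 1 + 1) Hxi).
  set (a := reg_term xi A D c) in *.
  set (b := reg_term xi (A + 1) D (c + 1)) in *.
  set (g := reg_term xi (A + 1 + 1) D (c + 1 + 1)) in *.
  assert (S1' := proj1 (Csummable_shift b) S1).
  assert (E0 : a O = c * b O).
  { unfold a, b, reg_term. rewrite !bin_0. simpl INR. rewrite !Cplus_0_r.
    cbn [Cpow Cpoch]. rewrite <- (recip_Gamma_S c). ring. }
  assert (ES : forall n, a (S n) = c * b (S n)
    + (((A - D + 1) * RtoC xi) * b n + (- (RtoC xi * ((A + 1) * (c - D + 1)))) * g n)).
  { intros n. unfold a, b, g, reg_term.
    set (t := c + 1 + INR n).
    replace (c + 1 + INR (S n)) with (t + 1) by (unfold t; rewrite RtoC_INR_S; ring).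
    replace (c + INR (S n)) with t by (unfold t; rewrite RtoC_INR_S; ring).
    replace (c + 1 + 1 + INR n) with (t + 1) by (unfold t; ring).
    rewrite <- (recip_Gamma_S t).
    set (G := recip_Gamma (t + 1)).
    unfold bin. rewrite (Cpoch_S_l A n), !RtoC_fact_S.
    assert (EA : Cpoch (A + 1 + 1) n * (A + 1) = Cpoch (A + 1) n * (A + 1 + INR n)).
    { rewrite Cmult_comm, <- Cpoch_S_l. reflexivity. }
    change (Cpoch (A + 1) (S n)) with (Cpoch (A + 1) n * (A + 1 + INR n)).
    change (Cpoch D (S n)) with (Cpoch D n * (D + INR n)).
    assert (H1 := INR_S_neq0 n). assert (H2 := INR_fact_neq0 n).
    replace (- (RtoC xi * ((A + 1) * (c - D + 1))) *
      (Cpoch (A + 1 + 1) n / INR (fact n) * RtoC xi ^ n * (Cpoch D n * G)))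
    with (- (RtoC xi * (c - D + 1)) * ((Cpoch (A + 1 + 1) n * (A + 1))
      / INR (fact n) * RtoC xi ^ n * (Cpoch D n * G))) by (field; auto).
    rewrite EA. unfold t. cbn [Cpow]. field. auto. }
  rewrite (CSeries_shift a), (CSeries_ext (fun n => a (S n)) _ ES), E0 by auto.
  rewrite CSeries_plus, CSeries_plus, !CSeries_scal
    by auto using Csummable_scal, Csummable_plus.
  rewrite (CSeries_shift b) by auto. ring.
Qed.

Lemma locally'_Cpunct (c : C) (P : C -> Prop) :
  @locally' C_UniformSpace c P <-> Cpunct (fun h => P (c + h)).
Proof.
  unfold locally', within. rewrite locally_Cmod. split.
  - intros (d & Hd & H). exists d. split; auto. intros h [Hh0 Hh]. apply H.
    + now replace (c + h - c) with h by ring.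
    + intros E. assert (h = 0) by (replace h with (c + h - c) by ring; rewrite E; ring).
      subst. rewrite Cmod_0 in Hh0. lra.
  - intros (d & Hd & H). exists d. split; auto. intros y Hy Hn.
    replace y with (c + (y - c)) by ring. apply H. split; auto.
    apply Cmod_gt_0. intros E. apply Hn. replace y with ((y - c) + c) by ring.
    rewrite E. apply Cplus_0_l.
Qed.

Lemma locally'_proper (c : C) : ProperFilter (@locally' C_UniformSpace c).
Proof.
  constructor.
  - intros P H. apply locally'_Cpunct in H. destruct (filter_ex _ H) as [h Hh]. eauto.
  - apply locally'_filter.
Qed.

(** Only finitely many translates [s + n] lie within distance 1 of the origin. *)
Lemma poles_isolated (s : C) : exists d, (0 < d) /\
  forall h n, Cmod h < d -> s + h + INR n = 0 -> s + INR n = 0.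
Proof.
  assert (Hfin : forall N, exists d, (0 < d) /\ forall h n, (n < N)%nat ->
    Cmod h < d -> s + h + INR n = 0 -> s + INR n = 0).
  { induction N as [|N (d & Hd & IH)].
    - exists 1%R. split; [lra|]. intros h n Hn. lia.
    - destruct (Ceq_dec (s + INR N) 0) as [E|E].
      + exists d. split; auto. intros h n Hn Hh E'.
        destruct (Nat.eq_dec n N) as [->|]; auto. apply (IH h); auto. lia.
      + assert (Hp : 0 < Cmod (s + INR N)) by now apply Cmod_gt_0.
        exists (Rmin d (Cmod (s + INR N))). split; [now apply Rmin_pos|].
        intros h n Hn Hh E'.
        assert (M1 := Rmin_l d (Cmod (s + INR N))).
        assert (M2 := Rmin_r d (Cmod (s + INR N))).
        destruct (Nat.eq_dec n N) as [->|].
        * exfalso. replace (s + INR N) with (s + h + INR N + - h) in M2 at 2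
            by ring. rewrite E', Cplus_0_l, Cmod_opp in M2. lra.
        * apply (IH h); auto; [lia|lra]. }
  destruct (INR_unbounded (Cmod s + 1)) as [N HN].
  destruct (Hfin N) as (d & Hd & H).
  exists (Rmin d 1). split; [apply Rmin_pos; lra|]. intros h n Hh E.
  assert (M1 := Rmin_l d 1). assert (M2 := Rmin_r d 1).
  destruct (lt_dec n N) as [L|L]; [apply (H h); auto; lra|]. exfalso.
  assert (Hn : INR N <= INR n) by (apply le_INR; lia).
  assert (INR n <= Cmod s + Cmod h); [|lra].
  eapply Rle_trans; [|apply Cmod_triangle].
  rewrite <- (Cmod_opp (s + h)). replace (- (s + h)) with (RtoC (INR n)).
  - rewrite Cmod_R. apply Rle_abs.
  - replace (RtoC (INR n)) with (s + h + INR n - (s + h)) by ring. rewrite E. ring.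
Qed.

Lemma not_pole_nearby (s : C) : not_pole s -> exists d, (0 < d) /\
  forall h, Cmod h < d -> not_pole (s + h).
Proof.
  intros Hs. destruct (poles_isolated s) as (d & Hd & H). exists d. split; auto.
  intros h Hh n E. now apply (Hs n), (H h).
Qed.

Lemma not_pole_punctured (s : C) : Cpunct (fun h => not_pole (s + h)).
Proof.
  destruct (poles_isolated s) as (d & Hd & H). exists d. split; auto.
  intros h [Hh0 Hh] n E. assert (E' := H h n Hh E).
  assert (h = 0).
  { replace h with ((s + h + INR n) - (s + INR n)) by ring.
    rewrite E, E'. ring. }
  subst. rewrite Cmod_0 in Hh0. lra.
Qed.

Lemma hyp_series_regularised (xi : R) (A D c : C) : (0 < xi < 1) -> not_pole c ->
  recip_Gamma c * pser (hyp_coef A D c) xi = reg_series xi A D c.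
Proof.
  intros Hxi Hc. unfold pser. rewrite <- CSeries_scal.
  - apply CSeries_ext. intros n. unfold reg_term, hyp_coef, bin.
    rewrite (recip_Gamma_poch c n).
    assert (H1 := INR_fact_neq0 n). assert (H2 := Cpoch_neq0 c n Hc). field. auto.
  - apply psum_summable with xi.
    + apply psum_hyp_coef; auto. lra.
    + rewrite Cmod_pos; lra.
Qed.

(** The extension by continuity is differentiable, a fortiori continuous, so its value
    at the poles of Gamma is again given by the series. *)
Lemma hyp2F1_reg_value (A B c : C) (xi : R) : (0 < xi < 1) ->
  hyp2F1_reg A B c (RtoC (xi / (xi - 1)))
  = reg_series xi A (c - B) c / pser (bin A) xi.
Proof.
  intros Hxi. assert (Hb := pser_bin_neq0 A xi Hxi).
  apply Climit_eq; [apply locally'_proper|].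
  intros eps Heps. apply locally'_Cpunct.
  destruct (Cder_reg_series xi A B c Hxi) as [d Hd].
  assert (L : Clim Cpunct (fun h => reg_series xi A (c + h - B) (c + h)
    * / pser (bin A) xi) (reg_series xi A (c - B) c * / pser (bin A) xi)).
  { apply Clim_mult; try apply Cpunct_filter.
    - apply (Cder_cont _ _ _ Hd).
    - apply Clim_const, Cpunct_filter. }
  generalize (filter_and _ _ (L eps Heps) (not_pole_punctured c)). apply filter_imp.
  intros h [H1 H2]. rewrite hyp2F1_value by auto.
  rewrite CGamma_recip by auto.
  rewrite <- hyp_series_regularised in H1 by auto.
  assert (H3 := recip_Gamma_neq0 _ H2).
  replace (pser (hyp_coef A (c + h - B) (c + h)) (RtoC xi) / pser (bin A) xi
    / / recip_Gamma (c + h)) with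
    (recip_Gamma (c + h) * pser (hyp_coef A (c + h - B) (c + h)) (RtoC xi)
     * / pser (bin A) xi) by (field; auto).
  exact H1.
Qed.

(** The quotient of (A+j)_n and (c+j)_n is at most rho^n once [j] is large, since its
    factors (A+j+i)/(c+j+i) are then close to 1; what remains of the n-th term is
    bounded independently of [j]. *)
Lemma reg_series_shift_bound (xi K rho : R) : (0 < xi < 1) -> (0 <= K) ->
  (1 < rho) -> (rho * xi < 1) ->
  exists N L, (0 <= L) /\ forall j A D c, (N <= j)%nat ->
    (Cmod A <= K) -> (Cmod D <= K) -> (Cmod c <= K) ->
    (Cmod (reg_series xi (A + INR j) D (c + INR j))
      <= L * Cmod (recip_Gamma (c + INR j))).
Proof.
  intros Hxi HK Hrho Hrx.
  destruct (linear_ratio_bound K rho HK Hrho) as (N & _ & _ & HN).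
  set (s := (rho * xi)%R) in *. assert (Hs : 0 <= s < 1)
    by (split; auto; unfold s; apply Rmult_le_pos; lra).
  assert (Hp := psum_bin (RtoC K) s Hs).
  exists N, (pnorm (bin (RtoC K)) s). split; [apply pnorm_nonneg; auto; lra|].
  intros j A D c Hj HA HD Hc.
  set (a := A + INR j). set (b := c + INR j).
  assert (Hrat : forall n, (Cmod (Cpoch a n * recip_Gamma (b + INR n))
    <= rho ^ n * Cmod (recip_Gamma b))).
  { induction n as [|n IH].
    - simpl INR. rewrite Cplus_0_r. cbn [Cpoch]. rewrite Cmult_1_l. simpl. lra.
    - destruct (HN (j + n)%nat ltac:(lia) A c HA Hc) as [Z B].
      assert (Ej : forall u, u + INR (j + n) = u + INR j + INR n)
        by (intros u; rewrite plus_INR, RtoC_plus; ring).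
      rewrite (Ej c) in Z. rewrite (Ej c), (Ej A) in B. fold a b in Z, B.
      replace (Cpoch a (S n) * recip_Gamma (b + INR (S n))) with
        ((a + INR n) / (b + INR n)
         * (Cpoch a n * recip_Gamma (b + INR n))).
      + rewrite Cmod_mult. simpl. rewrite Rmult_assoc.
        apply Rmult_le_compat; auto using Cmod_ge_0.
      + rewrite <- (recip_Gamma_S (b + INR n)), RtoC_INR_S. cbn [Cpoch].
        rewrite Cplus_assoc. field. auto. }
  eapply Rle_trans; [apply Cmod_CSeries_le; now apply reg_term_summable|].
  unfold pnorm. rewrite <- Series_scal_r. apply Series_le.
  - intros n. split; [apply Cmod_ge_0|].
    replace (reg_term xi a D b n) with
      (bin D n * RtoC xi ^ n * (Cpoch a n * recip_Gamma (b + INR n)))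
      by (unfold reg_term, bin; assert (H := INR_fact_neq0 n); field; auto).
    rewrite (Cmod_mult (bin D n * _)), Cmod_mult, Cmod_pow, Cmod_pos by lra.
    assert (Bd : Cmod (bin D n) <= Cmod (bin (RtoC K) n)).
    { unfold bin. assert (F := INR_fact_neq0 n). rewrite !Cmod_div by auto.
      apply Rmult_le_compat_r; [left; apply Rinv_0_lt_compat; now apply Cmod_gt_0|].
      now apply Cmod_Cpoch_le. }
    unfold s. rewrite Rpow_mult_distr.
    assert (Px : 0 <= xi ^ n) by (apply pow_le; lra).
    apply Rle_trans with (Cmod (bin (RtoC K) n) * xi ^ n
      * (rho ^ n * Cmod (recip_Gamma b)))%R; [|right; ring].
    apply Rmult_le_compat; auto using Cmod_ge_0.
    + apply Rmult_le_pos; auto using Cmod_ge_0.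
    + now apply Rmult_le_compat_r.
  - apply (ex_series_scal_r (Cmod (recip_Gamma b)) (fun n => Cmod (bin (RtoC K) n) * s ^ n)%R).
    exact Hp.
Qed.

(** * The square root *)

Lemma Csqrt_sqr (w : C) : Csqrt w * Csqrt w = w.
Proof.
  assert (H1 : 0 <= (Cmod w + Re w) / 2)
    by (assert (A := re_le_Cmod w); assert (B := Rle_abs (- Re w));
        rewrite Rabs_Ropp in B; lra).
  assert (H2 : 0 <= (Cmod w - Re w) / 2)
    by (assert (A := re_le_Cmod w); assert (B := Rle_abs (Re w)); lra).
  assert (Hp : (sqrt ((Cmod w + Re w) / 2) * sqrt ((Cmod w - Re w) / 2)
    = Rabs (Im w) / 2)%R).
  { rewrite <- sqrt_mult by auto.
    replace ((Cmod w + Re w) / 2 * ((Cmod w - Re w) / 2))%R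
      with ((Rabs (Im w) / 2) * (Rabs (Im w) / 2))%R.
    - apply sqrt_square. assert (A := Rabs_pos (Im w)). lra.
    - assert (A := Cmod2_alt w).
      assert (B : (Rabs (Im w) * Rabs (Im w) = Im w * Im w)%R)
        by (rewrite <- Rabs_mult; apply Rabs_pos_eq; nra).
      nra. }
  unfold Csqrt. set (a := sqrt ((Cmod w + Re w) / 2)) in *.
  set (b := sqrt ((Cmod w - Re w) / 2)) in *.
  assert (Ha : (a * a = (Cmod w + Re w) / 2)%R) by now apply sqrt_sqrt.
  assert (Hb : (b * b = (Cmod w - Re w) / 2)%R) by now apply sqrt_sqrt.
  destruct (Rlt_dec (Im w) 0) as [L|L].
  - rewrite Rabs_left in Hp by auto. apply injective_projections; simpl;
      [change (fst w) with (Re w)|change (snd w) with (Im w)]; lra.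
  - rewrite Rabs_pos_eq in Hp by lra. apply injective_projections; simpl;
      [change (fst w) with (Re w)|change (snd w) with (Im w)]; lra.
Qed.

Lemma Re_Csqrt_nonneg (w : C) : (0 <= Re (Csqrt w)).
Proof. apply sqrt_pos. Qed.

Lemma Csqrt_pos (r : R) : (0 <= r) -> Csqrt (RtoC r) = RtoC (sqrt r).
Proof.
  intros Hr. unfold Csqrt. rewrite Cmod_pos by auto. simpl.
  destruct (Rlt_dec 0 0) as [L|_]; [lra|].
  replace ((r + r) / 2)%R with r by field. replace ((r - r) / 2)%R with 0%R by field.
  now rewrite sqrt_0.
Qed.

Lemma Csqrt_scal (t : R) (w : C) : (0 < t) ->
  Csqrt (RtoC t * w) = RtoC (sqrt t) * Csqrt w.
Proof.
  intros Ht. unfold Csqrt.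
  assert (Em : Cmod (RtoC t * w) = (t * Cmod w)%R)
    by (rewrite Cmod_mult, Cmod_pos; lra).
  assert (Er : Re (RtoC t * w) = (t * Re w)%R) by (destruct w; simpl; ring).
  assert (Ei : Im (RtoC t * w) = (t * Im w)%R) by (destruct w; simpl; ring).
  rewrite Em, Er, Ei.
  replace ((t * Cmod w + t * Re w) / 2)%R with (t * ((Cmod w + Re w) / 2))%R by field.
  replace ((t * Cmod w - t * Re w) / 2)%R with (t * ((Cmod w - Re w) / 2))%R by field.
  assert (H1 : 0 <= (Cmod w + Re w) / 2)
    by (assert (A := re_le_Cmod w); assert (B := Rle_abs (- Re w));
        rewrite Rabs_Ropp in B; lra).
  assert (H2 : 0 <= (Cmod w - Re w) / 2)
    by (assert (A := re_le_Cmod w); assert (B := Rle_abs (Re w)); lra).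
  rewrite !sqrt_mult by lra.
  destruct (Rlt_dec (t * Im w) 0) as [L|L]; destruct (Rlt_dec (Im w) 0) as [L'|L'].
  - apply injective_projections; simpl; ring.
  - exfalso. apply Rnot_lt_le in L'. nra.
  - exfalso. apply L. nra.
  - apply injective_projections; simpl; ring.
Qed.

(** If S is the root of [g (x + h)] and s that of [r], then (S - s)(S + s) equals
    [g (x + h) - g x], and S + s has real part at least s. *)
Lemma Cder_Csqrt_comp (g : C -> C) (x d : C) (r : R) : (0 < r) -> g x = RtoC r ->
  Cder g x d -> exists e, Cder (fun y => Csqrt (g y)) x e.
Proof.
  intros Hr Hg Hd. set (s := sqrt r). assert (Hs : 0 < s) by now apply sqrt_lt_R0.
  set (S := fun h => Csqrt (g (x + h))).
  assert (E0 : Csqrt (g x) = RtoC s) by (rewrite Hg; apply Csqrt_pos; lra).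
  assert (Low : forall h, (s <= Cmod (S h + RtoC s))).
  { intros h. eapply Rle_trans; [|apply re_le_Cmod].
    eapply Rle_trans; [|apply Rle_abs].
    assert (P := Re_Csqrt_nonneg (g (x + h))). fold (S h) in P.
    replace (Re (S h + RtoC s)) with (Re (S h) + s)%R by (destruct (S h); simpl; ring). lra. }
  assert (Nz : forall h, S h + RtoC s <> 0)
    by (intros h; apply Cmod_gt_0; specialize (Low h); lra).
  assert (Diff : forall h, S h - RtoC s = (g (x + h) - g x) / (S h + RtoC s)).
  { intros h. rewrite <- (Csqrt_sqr (g (x + h))), <- (Csqrt_sqr (g x)), E0. fold (S h).
    field. auto. }
  assert (Cont : Clim Cpunct S (RtoC s)).
  { intros eps Heps. assert (He : 0 < eps * s) by nra.
    generalize (Cder_cont _ _ _ Hd _ He). apply filter_imp. intros h Hh.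
    rewrite Diff, Cmod_div by auto. specialize (Low h).
    apply Rlt_div_l; [lra|]. apply Rlt_le_trans with (eps * s)%R; auto.
    apply Rmult_le_compat_l; lra. }
  exists (d * / (RtoC s + RtoC s)).
  apply Clim_ext_loc with (fun h => (g (x + h) - g x) / h * / (S h + RtoC s)).
  - apply Cpunct_filter.
  - generalize Cpunct_neq0. apply filter_imp. intros h Hh.
    rewrite E0. fold (S h). rewrite Diff. field. auto.
  - apply Clim_mult; auto; try apply Cpunct_filter.
    apply Clim_inv; [apply Cpunct_filter| |].
    + rewrite <- RtoC_plus. apply RtoC_neq0. lra.
    + apply Clim_plus; auto; try apply Cpunct_filter. apply Clim_const, Cpunct_filter.
Qed.

(** * Factorisation of psi *)

(** What the principal and the complementary series have in common, and all that is
    needed of them. *)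
Definition admissible (z z' : C) : Prop :=
  Im (z + z') = 0%R /\
  forall k : Z, exists p, (0 < p) /\ (z + RtoC (IZR k)) * (z' + RtoC (IZR k)) = RtoC p.

Lemma series_admissible (z z' : C) :
  principal_series z z' \/ complementary_series z z' -> admissible z z'.
Proof.
  intros [(H1 & H2 & ->)|(H1 & H2 & m & Hm & Hm')].
  - split; [destruct z; simpl; ring|]. intros k.
    destruct z as [a b]. simpl in H1.
    exists ((a + IZR k) * (a + IZR k) + b * b)%R. split.
    + assert (0 < b * b) by exact (Rsqr_pos_lt b H1).
      assert (Q := Rle_0_sqr (a + IZR k)). unfold Rsqr in Q. lra.
    + apply injective_projections; simpl; ring.
  - destruct z as [a b], z' as [a' b']. simpl in *. subst b b'.
    split; [simpl; ring|]. intros k. exists ((a + IZR k) * (a' + IZR k))%R. split.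
    + destruct (Z_le_gt_dec 0 (m + k)) as [L|L].
      * apply IZR_le in L. rewrite plus_IZR in L. apply Rmult_lt_0_compat; lra.
      * assert (L' : (m + k + 1 <= 0)%Z) by lia. apply IZR_le in L'.
        rewrite !plus_IZR in L'.
        replace ((a + IZR k) * (a' + IZR k))%R with (- (a + IZR k) * - (a' + IZR k))%R by ring.
        apply Rmult_lt_0_compat; lra.
    + apply injective_projections; simpl; ring.
Qed.

Lemma admissible_not_pole (z z' : C) (k : Z) : admissible z z' ->
  not_pole (z + RtoC (IZR k)) /\ not_pole (z' + RtoC (IZR k)).
Proof.
  intros [_ H].
  assert (G : forall n, (z + RtoC (IZR k) + INR n) * (z' + RtoC (IZR k) + INR n) <> 0).
  { intros n. destruct (H (k + Z.of_nat n)%Z) as (p & Hp & E).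
    rewrite plus_IZR, <- INR_IZR_INZ, RtoC_plus, !Cplus_assoc in E. rewrite E.
    apply RtoC_neq0. lra. }
  split; intros n E; apply (G n); rewrite E; ring.
Qed.

Lemma Clim_real_nonneg (f : nat -> C) (l : C) :
  (forall n, exists r, (0 <= r) /\ f n = RtoC r) -> Clim eventually f l ->
  exists r, (0 <= r) /\ l = RtoC r.
Proof.
  intros Hf Hl.
  assert (Hi : Im l = 0%R).
  { apply Classical_Prop.NNPP. intros N.
    assert (P := Rabs_pos_lt _ N). destruct (Hl _ P) as [n Hn].
    specialize (Hn n (Nat.le_refl n)). destruct (Hf n) as (r & _ & E).
    assert (B := im_le_Cmod (f n - l)). rewrite E in *.
    replace (Im (RtoC r - l)) with (- Im l)%R in B by (destruct l; simpl; ring).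
    rewrite Rabs_Ropp in B. lra. }
  assert (Hr : 0 <= Re l).
  { apply Rnot_lt_le. intros N.
    destruct (Hl (- Re l)%R ltac:(lra)) as [n Hn].
    specialize (Hn n (Nat.le_refl n)). destruct (Hf n) as (r & Hr & E).
    assert (B := re_le_Cmod (f n - l)). assert (B' := Rle_abs (Re (f n - l))).
    rewrite E in *.
    replace (Re (RtoC r - l)) with (r - Re l)%R in * by (destruct l; simpl; ring). lra. }
  exists (Re l). split; auto. destruct l; simpl in *. now subst.
Qed.

(** 1 / (Gamma(z - k) Gamma(z' - k)) *)
Definition wt (z z' : C) (k : Z) : R :=
  Re (recip_Gamma (z - RtoC (IZR k)) * recip_Gamma (z' - RtoC (IZR k))).

(** Gauss' formula for the product involves positive reals only, because it pairs the
    factors z + i and z' + i; the limit is not zero. *)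
Lemma wt_spec (z z' : C) (k : Z) : admissible z z' ->
  (0 < wt z z' k) /\
  recip_Gamma (z - RtoC (IZR k)) * recip_Gamma (z' - RtoC (IZR k)) = RtoC (wt z z' k).
Proof.
  intros H.
  assert (Es : forall s, s - RtoC (IZR k) = s + RtoC (IZR (- k)))
    by (intros s; rewrite opp_IZR, RtoC_opp; ring).
  unfold wt. rewrite !Es. set (s := z + RtoC (IZR (- k))). set (s' := z' + RtoC (IZR (- k))).
  destruct (admissible_not_pole z z' (- k) H) as [N N']. fold s in N. fold s' in N'.
  assert (HP : forall n, exists r, (0 <= r) /\ Cpoch s n * Cpoch s' n = RtoC r).
  { induction n as [|n (r & Hr & E)].
    - exists 1%R. split; [lra|]. cbn [Cpoch]. ring.
    - destruct (proj2 H (- k + Z.of_nat n)%Z) as (p & Hp & Ep).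
      rewrite plus_IZR, <- INR_IZR_INZ, RtoC_plus, !Cplus_assoc in Ep.
      exists (r * p)%R. split; [nra|]. cbn [Cpoch].
      rewrite RtoC_mult, <- E, <- Ep. unfold s, s'. ring. }
  assert (HS : exists t, s + s' = RtoC t).
  { exists (Re (s + s')). unfold s, s'. destruct H as [H _].
    destruct z as [a b], z' as [a' b']. simpl in H.
    apply injective_projections; simpl; [reflexivity|lra]. }
  destruct HS as [t Ht].
  assert (HG : forall n, exists r, (0 <= r) /\ gauss_recip n s * gauss_recip n s' = RtoC r).
  { intros n. destruct (HP (S n)) as (r & Hr & E).
    set (e := exp (t * ln (INR n))). assert (He : 0 < e) by apply exp_pos.
    assert (F : 0 < INR (fact n)) by apply INR_fact_lt_0.
    assert (Ee : Rcpow (INR n) s * Rcpow (INR n) s' = RtoC e).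
    { rewrite <- Rcpow_plus, Ht. unfold Rcpow. rewrite <- RtoC_mult. apply Cexp_real. }
    exists (r / (INR (fact n) * INR (fact n) * e))%R. split.
    - apply Rmult_le_pos; auto. left. apply Rinv_0_lt_compat.
      apply Rmult_lt_0_compat; [nra|auto].
    - rewrite RtoC_div, !RtoC_mult, <- E, <- Ee.
      + unfold gauss_recip. assert (F1 := INR_fact_neq0 n).
        assert (A1 := Rcpow_neq0 (INR n) s). assert (A2 := Rcpow_neq0 (INR n) s').
        field. auto.
      + apply Rgt_not_eq. apply Rmult_lt_0_compat; [nra|auto]. }
  destruct (Clim_real_nonneg _ (recip_Gamma s * recip_Gamma s') HG) as (r & Hr & E).
  { apply Clim_mult; [apply eventually_filter| |]; apply Clim_gauss_recip. }
  rewrite E. simpl Re. split; auto.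
  destruct Hr as [Hr| <-]; auto. exfalso.
  apply (Cmult_neq_0 _ _ (recip_Gamma_neq0 _ N) (recip_Gamma_neq0 _ N')). exact E.
Qed.

(** (a + 1/2 - z)(a + 1/2 - z') for a = k + 1/2; [wt_succ] shows that it is the ratio
    of consecutive weights. *)
Definition jac (z z' : C) (k : Z) : R :=
  Re ((RtoC (IZR k) + 1 - z) * (RtoC (IZR k) + 1 - z')).

Lemma jac_spec (z z' : C) (k : Z) : admissible z z' ->
  (0 < jac z z' k) /\
  (RtoC (IZR k) + 1 - z) * (RtoC (IZR k) + 1 - z') = RtoC (jac z z' k).
Proof.
  intros [_ H]. destruct (H (- (k + 1))%Z) as (p & Hp & E).
  assert (E' : (RtoC (IZR k) + 1 - z) * (RtoC (IZR k) + 1 - z') = RtoC p).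
  { rewrite <- E, opp_IZR, plus_IZR, RtoC_opp, RtoC_plus. ring. }
  unfold jac. rewrite E'. simpl Re. auto.
Qed.

Lemma wt_succ (z z' : C) (k : Z) : admissible z z' ->
  wt z z' (k + 1) = (jac z z' k * wt z z' k)%R.
Proof.
  intros H. apply RtoC_inj. rewrite RtoC_mult.
  rewrite <- (proj2 (wt_spec z z' (k + 1) H)), <- (proj2 (wt_spec z z' k H)),
    <- (proj2 (jac_spec z z' k H)).
  assert (E : forall s, recip_Gamma (s - RtoC (IZR (k + 1)))
    = (s - RtoC (IZR k) - 1) * recip_Gamma (s - RtoC (IZR k))).
  { intros s. rewrite plus_IZR, RtoC_plus, <- recip_Gamma_S.
    f_equal; [ring|f_equal; ring]. }
  rewrite !E. ring.
Qed.

(** Off-diagonal entry of the Jacobi matrix of the three-term relation in [a]. *)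
Definition alpha (xi : R) (z z' : C) (k : Z) : R := sqrt (xi * jac z z' k).

Definition amp (xi : R) (z z' : C) (k : Z) : C :=
  RtoC (sqrt (wt z z' k)) * Rcpow xi (half k / 2).

Lemma half_succ (k : Z) : half (k + 1) = half k + 1.
Proof.
  unfold half. rewrite plus_IZR, <- RtoC_plus. f_equal. ring.
Qed.

Lemma Rcpow_half (xi : R) : (0 < xi) -> Rcpow xi (/ 2) = RtoC (sqrt xi).
Proof.
  intros Hxi. unfold Rcpow.
  replace (/ 2 * RtoC (ln xi)) with (RtoC (/ 2 * ln xi)).
  - rewrite Cexp_real. f_equal. symmetry. apply sqrt_lem_1; [lra|left; apply exp_pos|].
    rewrite <- exp_plus. replace (/ 2 * ln xi + / 2 * ln xi)%R with (ln xi) by field.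
    now apply exp_ln.
  - rewrite RtoC_mult, RtoC_inv by lra. reflexivity.
Qed.

Lemma amp_succ (xi : R) (z z' : C) (k : Z) : (0 < xi) -> admissible z z' ->
  amp xi z z' (k + 1) = amp xi z z' k * RtoC (alpha xi z z' k).
Proof.
  intros Hxi H. destruct (wt_spec z z' k H) as [W _]. destruct (jac_spec z z' k H) as [J _].
  unfold amp, alpha. rewrite wt_succ, !sqrt_mult by (auto; lra).
  rewrite half_succ. replace ((half k + 1) / 2) with (half k / 2 + / 2) by field.
  rewrite Rcpow_plus, Rcpow_half, !RtoC_mult by auto. ring.
Qed.

Definition reg (xi : R) (z z' : C) (k : Z) (x : C) : C :=
  reg_series xi (- z + half k + / 2) (x + z' + / 2) (x + half k + 1).

(** [psi_a] without the factor common to all [a]. *)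
Definition psi_core (xi : R) (z z' : C) (k : Z) (x : C) : C :=
  amp xi z z' k * reg xi z z' k x.

(** The first quotient is taken at a = 1/2, but does not depend on [a]: see
    [Pfaff_factor_constant]. *)
Definition psi_factor (xi : R) (z z' : C) (x : C) : C :=
  Rcpow (1 - xi) ((z + z') / 2 - half 0) / pser (bin (- z + half 0 + / 2)) xi
  * Csqrt (CGamma (x + z + / 2) * CGamma (x + z' + / 2)) * Rcpow xi (x / 2).

(** Raising [a] by one divides both the power of [1 - xi] and the binomial series
    by [1 - xi]. *)
Lemma Pfaff_factor_constant (xi : R) (z z' : C) (k : Z) : (0 < xi < 1) ->
  Rcpow (1 - xi) ((z + z') / 2 - half k) / pser (bin (- z + half k + / 2)) xi
  = Rcpow (1 - xi) ((z + z') / 2 - half 0) / pser (bin (- z + half 0 + / 2)) xi.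
Proof.
  intros Hxi.
  set (F := fun k => Rcpow (1 - xi) ((z + z') / 2 - half k)
    / pser (bin (- z + half k + / 2)) xi).
  assert (E : forall k, F (k + 1)%Z = F k).
  { intros j. unfold F. rewrite half_succ.
    replace (- z + (half j + 1) + / 2) with (- z + half j + / 2 + 1) by ring.
    rewrite <- (pser_bin_S (- z + half j + / 2)) by (rewrite Cmod_pos; lra).
    replace ((z + z') / 2 - half j) with ((z + z') / 2 - (half j + 1) + 1) by ring.
    rewrite Rcpow_plus, Rcpow_1, RtoC_minus by lra.
    assert (H1 := pser_bin_neq0 (- z + half j + / 2 + 1) xi Hxi).
    assert (H2 : 1 - RtoC xi <> 0) by (rewrite <- RtoC_minus; apply RtoC_neq0; lra).
    field. auto. }
  change (F k = F 0%Z).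
  induction k as [|k IH|k IH] using Z.peano_ind; auto.
  - unfold Z.succ. now rewrite E.
  - rewrite <- IH. rewrite <- (E (Z.pred k)). f_equal. lia.
Qed.

Lemma psi_factorisation (xi : R) (z z' : C) (k : Z) (x : C) : (0 < xi < 1) ->
  admissible z z' ->
  psi z z' xi (half k) x = psi_factor xi z z' x * psi_core xi z z' k x.
Proof.
  intros Hxi H. unfold psi, psi_factor, psi_core, amp, reg.
  rewrite <- (Pfaff_factor_constant xi z z' k Hxi).
  rewrite hyp2F1_reg_value by auto.
  destruct (wt_spec z z' k H) as [W Ew].
  assert (Eg : CGamma (z - half k + / 2) * CGamma (z' - half k + / 2) = / RtoC (wt z z' k)).
  { assert (Eh : forall s, s - half k + / 2 = s + RtoC (IZR (- k))).
    { intros s. unfold half. rewrite opp_IZR, RtoC_opp, RtoC_plus, RtoC_inv by lra. ring. }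
    destruct (admissible_not_pole z z' (- k) H) as [N N'].
    rewrite !Eh, !CGamma_recip, <- Ew by auto.
    assert (Em : forall s, s - RtoC (IZR k) = s + RtoC (IZR (- k)))
      by (intros s; rewrite opp_IZR, RtoC_opp; ring).
    rewrite !Em. assert (R1 := recip_Gamma_neq0 _ N). assert (R2 := recip_Gamma_neq0 _ N').
    field. auto. }
  rewrite Eg.
  set (G := CGamma (x + z + / 2) * CGamma (x + z' + / 2)).
  replace (G / / RtoC (wt z z' k)) with (RtoC (wt z z' k) * G)
    by (field; apply RtoC_neq0; lra).
  rewrite Csqrt_scal by auto.
  replace ((x + half k) / 2) with (x / 2 + half k / 2) by field.
  rewrite Rcpow_plus.
  replace (x + half k + 1 - (- z' + half k + / 2)) with (x + z' + / 2) by field.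
  assert (H1 := pser_bin_neq0 (- z + half k + / 2) xi Hxi).
  field. auto.
Qed.

Lemma Cder_psi_core (xi : R) (z z' : C) (k : Z) (x : C) : (0 < xi < 1) ->
  exists d, Cder (psi_core xi z z' k) x d.
Proof.
  intros Hxi. 
  destruct (Cder_reg_series xi (- z + half k + / 2) (half k + 1 - (z' + / 2))
    (x + (half k + 1)) Hxi) as [d Hd].
  eexists. unfold psi_core. apply Cder_mult; [apply Cder_const|].
  eapply Cder_ext; [|apply Cder_shift; apply Hd].
  intros y. unfold reg. simpl. f_equal; ring.
Qed.

Lemma Cder_CGamma_shift (x b : C) : not_pole (x + b) ->
  exists d, Cder (fun y => CGamma (y + b)) x d.
Proof.
  intros H. destruct (Cder_recip_Gamma (x + b)) as [d Hd].
  destruct (Cder_inv recip_Gamma (x + b) d (recip_Gamma_neq0 _ H) Hd) as [e He].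
  exists e. destruct (not_pole_nearby _ H) as (r & Hr & Hn).
  eapply Cder_ext_loc; [| |apply Cder_shift; apply He]; cbv beta.
  - now rewrite CGamma_recip.
  - exists r. split; auto. intros h [_ Hh].
    replace (x + h + b) with (x + b + h) by ring. rewrite CGamma_recip; auto.
Qed.

Lemma Cder_psi_factor (xi : R) (z z' : C) (m : Z) : (0 < xi < 1) -> admissible z z' ->
  exists d, Cder (psi_factor xi z z') (half m) d.
Proof.
  intros Hxi H.
  assert (Eh : forall s, half m + (s + / 2) = s + RtoC (IZR (m + 1))).
  { intros s. unfold half. rewrite plus_IZR, !RtoC_plus, RtoC_inv by lra. field. }
  destruct (admissible_not_pole z z' (m + 1) H) as [N N'].
  destruct (Cder_CGamma_shift (half m) (z + / 2)) as [d Hd]; [now rewrite Eh|].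
  destruct (Cder_CGamma_shift (half m) (z' + / 2)) as [d' Hd']; [now rewrite Eh|].
  destruct (wt_spec z z' (- (m + 1)) H) as [W Ew].
  destruct (Cder_Csqrt_comp
    (fun y => CGamma (y + (z + / 2)) * CGamma (y + (z' + / 2))) (half m)
    (d * CGamma (half m + (z' + / 2)) + CGamma (half m + (z + / 2)) * d')
    (/ wt z z' (- (m + 1)))) as [e He].
  - now apply Rinv_0_lt_compat.
  - rewrite RtoC_inv, <- Ew by lra. rewrite !Eh, !CGamma_recip by auto.
    assert (Em : forall s, s - RtoC (IZR (- (m + 1))) = s + RtoC (IZR (m + 1)))
      by (intros s; rewrite opp_IZR, RtoC_opp; ring).
    rewrite !Em. assert (R1 := recip_Gamma_neq0 _ N). assert (R2 := recip_Gamma_neq0 _ N').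
    field. auto.
  - exact (Cder_mult _ _ _ _ _ Hd Hd').
  - destruct (Cder_Cexp_linear (/ 2 * RtoC (ln xi)) (half m)) as [f Hf].
    eexists. unfold psi_factor. apply Cder_mult.
    + apply Cder_mult; [apply Cder_const|].
      eapply Cder_ext; [|apply He]. intros y. cbv beta. f_equal. now rewrite !Cplus_assoc.
    + eapply Cder_ext; [|apply Hf]. intros y. cbv beta. unfold Rcpow. f_equal. field.
Qed.

(** * Decay in [a] *)

Lemma finitely_many_bounds (f : nat -> C -> R) (N : nat) :
  (forall k, exists d M, (0 < d) /\ forall h, Cmod h < d -> (f k h <= M)) ->
  exists d M, (0 < d) /\ (0 <= M) /\
    forall k h, (k < N)%nat -> Cmod h < d -> (f k h <= M).
Proof.
  intros H. induction N as [|N (d & M & Hd & HM & IH)].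
  - exists 1%R, 0%R. split; [lra|]. split; [lra|]. intros k h Hk. lia.
  - destruct (H N) as (d' & M' & Hd' & H').
    exists (Rmin d d'), (Rmax M M').
    assert (L1 := Rmin_l d d'). assert (L2 := Rmin_r d d').
    assert (X1 := Rmax_l M M'). assert (X2 := Rmax_r M M').
    split; [now apply Rmin_pos|]. split; [lra|].
    intros k h Hk Hh. destruct (Nat.eq_dec k N) as [->|].
    + specialize (H' h ltac:(lra)). lra.
    + specialize (IH k h ltac:(lia) ltac:(lra)). lra.
Qed.

(** For [x] near [x0], [psi_a(x)] decays geometrically in [a], uniformly in [x]: it is
    governed by the amplitude times 1/Gamma(x+a+1), whose consecutive ratio tends to
    the square root of [xi]. *)
Lemma psi_core_decay (xi : R) (z z' x0 : C) : (0 < xi < 1) -> admissible z z' ->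
  exists q M delta, (0 < q < 1) /\ (0 <= M) /\ (0 < delta) /\
  forall j h, Cmod h < delta ->
    (Cmod (psi_core xi z z' (Z.of_nat j) (x0 + h)%C) <= M * q ^ j).
Proof.
  intros Hxi H.
  set (s := sqrt xi). assert (Hs : 0 < s) by (apply sqrt_lt_R0; lra).
  assert (Hss : (s * s = xi)%R) by (apply sqrt_sqrt; lra).
  assert (Hs1 : s < 1) by nra.
  set (q := ((1 + s) / 2)%R). assert (Hq : s < q < 1) by (unfold q; lra).
  set (rho := (q / s)%R). assert (Hrho : 1 < rho) by (apply Rlt_div_r; lra).
  assert (Hrs : (rho * s = q)%R) by (unfold rho; field; lra).
  assert (Hrx : rho * xi < 1) by (rewrite <- Hss, <- Rmult_assoc, Hrs; nra).
  clearbody rho.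
  set (K := (Cmod x0 + Cmod z + Cmod z' + 4)%R).
  assert (P1 := Cmod_ge_0 x0). assert (P2 := Cmod_ge_0 z). assert (P3 := Cmod_ge_0 z').
  assert (HK : 0 <= K) by (unfold K; lra).
  destruct (reg_series_shift_bound xi K rho Hxi HK Hrho Hrx) as (N1 & L & HL & Hreg).
  destruct (linear_ratio_bound K rho HK Hrho) as (N2 & _ & _ & HN2).
  set (N := (N1 + N2)%nat).
  set (c := fun h => x0 + h + RtoC (3 / 2)).
  assert (Hc : forall h, Cmod h < 1 -> (Cmod (c h) <= K)).
  { intros h Hh. unfold c. tri.
    tri_l.
    rewrite Cmod_pos; unfold K; lra. }
  assert (Hz1 : forall s, (Cmod s <= Cmod z + Cmod z') -> (Cmod (1 - s) <= K)).
  { intros t Ht. unfold Cminus. tri.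
    rewrite Cmod_opp, Cmod_1. unfold K. lra. }
  set (v := fun j h => (Cmod (amp xi z z' (Z.of_nat j))
    * Cmod (recip_Gamma (c h + INR j)))%R).
  assert (Hv0 : forall j h, (0 <= v j h))
    by (intros j h; apply Rmult_le_pos; apply Cmod_ge_0).
  assert (Hstep : forall j h, (N <= j)%nat -> Cmod h < 1 -> (v (S j) h <= q * v j h)).
  { intros j h Hj Hh. unfold v.
    destruct (HN2 j ltac:(lia) (1 - z) (c h) ltac:(apply Hz1; lra) (Hc h Hh)) as [Z B1].
    destruct (HN2 j ltac:(lia) (1 - z') (c h) ltac:(apply Hz1; lra) (Hc h Hh)) as [_ B2].
    rewrite Cmod_div in B1, B2 by auto.
    set (u := Cmod (c h + INR j)) in *.
    assert (Hu : 0 < u) by now apply Cmod_gt_0.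
    apply Rle_div_l in B1; auto. apply Rle_div_l in B2; auto.
    destruct (jac_spec z z' (Z.of_nat j) H) as [J EJ].
    rewrite <- INR_IZR_INZ in EJ.
    assert (BJ : jac z z' (Z.of_nat j) <= (rho * u) * (rho * u)).
    { rewrite <- (Rabs_pos_eq (jac z z' (Z.of_nat j))), <- Cmod_R, <- EJ, Cmod_mult by lra.
      apply Rmult_le_compat; auto using Cmod_ge_0.
      - now replace (RtoC (INR j) + 1 - z) with (1 - z + INR j) by ring.
      - now replace (RtoC (INR j) + 1 - z') with (1 - z' + INR j) by ring. }
    rewrite Nat2Z.inj_succ. unfold Z.succ. rewrite amp_succ, Cmod_mult, Cmod_R by (auto; lra).
    assert (Ha : Rabs (alpha xi z z' (Z.of_nat j)) <= q * u).
    { unfold alpha. rewrite Rabs_pos_eq by apply sqrt_pos.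
      rewrite sqrt_mult by lra. fold s.
      assert (sqrt (jac z z' (Z.of_nat j)) <= rho * u).
      { rewrite <- (sqrt_square (rho * u)) by nra. now apply sqrt_le_1_alt. }
      replace (q * u)%R with (s * (rho * u))%R by (rewrite <- Hrs; ring).
      apply Rmult_le_compat_l; lra. }
    rewrite <- (recip_Gamma_S (c h + INR j)), Cmod_mult. fold u.
    rewrite RtoC_INR_S, Cplus_assoc.
    set (A := Cmod (amp xi z z' (Z.of_nat j))). set (G := Cmod (recip_Gamma _)).
    assert (PA : 0 <= A) by apply Cmod_ge_0. assert (PG : 0 <= G) by apply Cmod_ge_0.
    replace (q * (A * (u * G)))%R with (A * (q * u) * G)%R by ring.
    apply Rmult_le_compat_r; auto. now apply Rmult_le_compat_l. }
  assert (Hcore : forall j h, (N <= j)%nat -> Cmod h < 1 ->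
    (Cmod (psi_core xi z z' (Z.of_nat j) (x0 + h)%C) <= L * v j h)).
  { intros j h Hj Hh. unfold psi_core, reg, v. rewrite Cmod_mult.
    replace (L * (Cmod (amp xi z z' (Z.of_nat j)) * Cmod (recip_Gamma (c h + INR j))))%R
      with (Cmod (amp xi z z' (Z.of_nat j)) * (L * Cmod (recip_Gamma (c h + INR j))))%R
      by ring.
    apply Rmult_le_compat_l; [apply Cmod_ge_0|].
    assert (Eh : half (Z.of_nat j) = RtoC (INR j) + / 2).
    { unfold half. rewrite <- INR_IZR_INZ, RtoC_plus, RtoC_inv by lra. reflexivity. }
    rewrite Eh.
    replace (- z + (RtoC (INR j) + / 2) + / 2) with (1 - z + INR j) by field.
    replace (x0 + h + (RtoC (INR j) + / 2) + 1) with (c h + INR j).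
    - apply Hreg; auto; [lia|apply Hz1; lra|].
      tri.
      tri_l.
      eapply Rle_trans; [apply Rplus_le_compat_r, Rplus_le_compat_r, Cmod_triangle|].
      replace (/ 2) with (RtoC (/ 2)) by (rewrite RtoC_inv by lra; reflexivity).
      rewrite Cmod_pos; unfold K; lra.
    - unfold c. rewrite RtoC_div by lra. field. }
  destruct (Cder_recip_Gamma (x0 + RtoC (3 / 2) + INR N)) as [dG HG].
  destruct (Cder_local_bounds _ _ _ HG) as (d1 & M1 & Hd1 & HM1 & B1).
  destruct (finitely_many_bounds
    (fun j h => Cmod (psi_core xi z z' (Z.of_nat j) (x0 + h))) N) as (d2 & M2 & Hd2 & HM2 & B2).
  { intros j. destruct (Cder_psi_core xi z z' (Z.of_nat j) x0 Hxi) as [d Hd].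
    destruct (Cder_local_bounds _ _ _ Hd) as (e & Me & He & _ & Be).
    exists e, Me. split; auto. intros h Hh. now apply Be. }
  set (A := Cmod (amp xi z z' (Z.of_nat N))). assert (PA : 0 <= A) by apply Cmod_ge_0.
  set (delta := Rmin 1 (Rmin d1 d2)).
  assert (Hdelta : 0 < delta) by (repeat apply Rmin_pos; lra).
  assert (D1 : delta <= 1) by apply Rmin_l.
  assert (D2 : delta <= d1) by (eapply Rle_trans; [apply Rmin_r|apply Rmin_l]).
  assert (D3 : delta <= d2) by (eapply Rle_trans; [apply Rmin_r|apply Rmin_r]).
  assert (Hqp : forall n, (0 < q ^ n)) by (intros; apply pow_lt; lra).
  assert (HLAM : 0 <= L * (A * M1)) by (repeat apply Rmult_le_pos; auto).
  exists q, ((L * (A * M1) + M2) / q ^ N)%R, delta.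
  split; [lra|]. split.
  { apply Rmult_le_pos; [lra|]. left. now apply Rinv_0_lt_compat. }
  split; auto. intros j h Hh.
  destruct (lt_dec j N) as [Lt|Ge].
  - eapply Rle_trans; [apply B2; auto; lra|].
    assert (q ^ N <= q ^ j).
    { replace N with (j + (N - j))%nat by lia. rewrite pow_add.
      rewrite <- (Rmult_1_r (q ^ j)) at 2. apply Rmult_le_compat_l; [left; apply Hqp|].
      rewrite <- (pow1 (N - j)). apply pow_incr. lra. }
    apply Rle_trans with ((L * (A * M1) + M2) / q ^ N * q ^ N)%R.
    + replace ((L * (A * M1) + M2) / q ^ N * q ^ N)%R with (L * (A * M1) + M2)%R; [lra|].
      field. apply Rgt_not_eq, Hqp.
    + apply Rmult_le_compat_l; auto. apply Rmult_le_pos; [lra|].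
      left. now apply Rinv_0_lt_compat.
  - eapply Rle_trans; [apply Hcore; [lia|lra]|].
    assert (Hv : v j h * q ^ N <= A * M1 * q ^ j).
    { assert (Hj : (N <= j)%nat) by lia. clear Ge. induction Hj as [|j Hj IH].
      - apply Rmult_le_compat_r; [left; apply Hqp|].
        unfold v. fold A. apply Rmult_le_compat_l; auto.
        replace (c h + INR N) with (x0 + RtoC (3 / 2) + INR N + h)
          by (unfold c; ring).
        apply B1. lra.
      - simpl. specialize (Hstep j h Hj ltac:(lra)).
        apply Rle_trans with (q * (v j h * q ^ N))%R.
        + rewrite <- Rmult_assoc. apply Rmult_le_compat_r; [left; apply Hqp|auto].
        + replace (A * M1 * (q * q ^ j))%R with (q * (A * M1 * q ^ j))%R by ring.
          apply Rmult_le_compat_l; lra. }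
    apply Rle_trans with (L * (A * M1 * q ^ j / q ^ N))%R.
    + apply Rmult_le_compat_l; auto. now apply (proj1 (Rle_div_r (v j h) _ _ (Hqp N))).
    + assert (0 <= M2 * (q ^ j / q ^ N)).
      { apply Rmult_le_pos; auto. apply Rmult_le_pos; [left; apply Hqp|].
        left. now apply Rinv_0_lt_compat. }
      replace ((L * (A * M1) + M2) / q ^ N * q ^ j)%R
        with (L * (A * M1 * q ^ j / q ^ N) + M2 * (q ^ j / q ^ N))%R
        by (unfold Rdiv; ring).
      lra.
Qed.

(** * Christoffel-Darboux summation *)

(** [reg_series_recurrence] times the amplitude at [k]; the amplitudes are normalised so
    that the two off-diagonal coefficients are values of one sequence [alpha]. *)
Lemma psi_core_three_term (xi : R) (z z' : C) (k : Z) (x : C) :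
  (0 < xi < 1) -> admissible z z' ->
  RtoC (alpha xi z z' (k - 1)) * psi_core xi z z' (k - 1) x =
  (RtoC (1 - xi) * x + (half k + (half k - z - z') * RtoC xi)) * psi_core xi z z' k x
  - RtoC (alpha xi z z' k) * psi_core xi z z' (k + 1) x.
Proof.
  intros Hxi H.
  assert (E1 := amp_succ xi z z' (k - 1) (proj1 Hxi) H).
  replace (k - 1 + 1)%Z with k in E1 by lia.
  assert (E2 := amp_succ xi z z' k (proj1 Hxi) H).
  assert (Eh : half (k - 1) = half k - 1).
  { replace k with (k - 1 + 1)%Z at 2 by lia. rewrite half_succ. ring. }
  destruct (jac_spec z z' k H) as [J EJ].
  assert (Ea : RtoC (alpha xi z z' k) * RtoC (alpha xi z z' k)
    = RtoC xi * ((half k + / 2 - z) * (half k + / 2 - z'))).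
  { rewrite <- RtoC_mult. unfold alpha. rewrite sqrt_sqrt, RtoC_mult, <- EJ by nra.
    unfold half. rewrite RtoC_plus, RtoC_inv by lra. field. }
  unfold psi_core. rewrite E2.
  assert (R := reg_series_recurrence xi (- z + half (k - 1) + / 2) (x + z' + / 2)
    (x + half (k - 1) + 1) Hxi).
  fold (reg xi z z' (k - 1) x) in R.
  replace (- z + half (k - 1) + / 2 + 1) with (- z + half k + / 2) in R by (rewrite Eh; ring).
  replace (x + half (k - 1) + 1 + 1) with (x + half k + 1) in R by (rewrite Eh; ring).
  fold (reg xi z z' k x) in R.
  replace (- z + half k + / 2 + 1) with (- z + half (k + 1) + / 2) in R
    by (rewrite half_succ; ring).
  replace (x + half k + 1 + 1) with (x + half (k + 1) + 1) in R by (rewrite half_succ; ring).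
  fold (reg xi z z' (k + 1) x) in R.
  rewrite Eh in R.
  replace (RtoC (alpha xi z z' (k - 1)) * (amp xi z z' (k - 1) * reg xi z z' (k - 1) x))
    with (amp xi z z' k * reg xi z z' (k - 1) x) by (rewrite E1; ring).
  replace (RtoC (alpha xi z z' k)
      * (amp xi z z' k * RtoC (alpha xi z z' k) * reg xi z z' (k + 1) x))
    with (amp xi z z' k * (RtoC (alpha xi z z' k) * RtoC (alpha xi z z' k))
      * reg xi z z' (k + 1) x) by ring.
  rewrite R, Ea, RtoC_minus. field.
Qed.

Definition CD_boundary (xi : R) (z z' : C) (x y : C) (k : Z) : C :=
  RtoC (alpha xi z z' k) *
  (psi_core xi z z' k x * psi_core xi z z' (k + 1) y
   - psi_core xi z z' (k + 1) x * psi_core xi z z' k y).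

(** The three-term relation at [x] times psi_a(y), minus the same with [x] and [y]
    exchanged: the terms in psi_a(x) psi_a(y) leave the factor [x - y], the others
    telescope. *)
Lemma Christoffel_Darboux (xi : R) (z z' x y : C) (n : nat) :
  (0 < xi < 1) -> admissible z z' ->
  RtoC (1 - xi) * (x - y) *
    Csum (fun k => psi_core xi z z' (Z.of_nat k) x * psi_core xi z z' (Z.of_nat k) y) n
  = CD_boundary xi z z' x y (-1) - CD_boundary xi z z' x y (Z.of_nat n - 1).
Proof.
  intros Hxi H. induction n as [|n IH].
  - cbn [Csum]. simpl (Z.of_nat 0 - 1)%Z. ring.
  - cbn [Csum]. rewrite Cmult_plus_distr_l, IH.
    replace (Z.of_nat (S n) - 1)%Z with (Z.of_nat n) by lia.
    set (k := Z.of_nat n). unfold CD_boundary at 2 4.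
    replace (k - 1 + 1)%Z with k by lia.
    assert (Ex := psi_core_three_term xi z z' k x Hxi H).
    assert (Ey := psi_core_three_term xi z z' k y Hxi H).
    set (px := psi_core xi z z' k x) in *. set (py := psi_core xi z z' k y) in *.
    set (mx := psi_core xi z z' (k - 1) x) in *. set (my := psi_core xi z z' (k - 1) y) in *.
    set (qx := psi_core xi z z' (k + 1) x) in *. set (qy := psi_core xi z z' (k + 1) y) in *.
    set (a := RtoC (alpha xi z z' (k - 1))) in *. set (b := RtoC (alpha xi z z' k)) in *.
    replace (a * (mx * py - px * my)) with ((a * mx) * py - px * (a * my)) by ring.
    rewrite Ex, Ey. ring.
Qed.

Lemma Cmod_alpha_le (xi : R) (z z' : C) : (0 < xi < 1) -> admissible z z' ->
  exists L, (0 <= L) /\ forall j : nat,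
    (Cmod (RtoC (alpha xi z z' (Z.of_nat j))) <= L * (INR j + 1)).
Proof.
  intros Hxi H. set (L := (1 + Cmod z + Cmod z')%R).
  assert (P1 := Cmod_ge_0 z). assert (P2 := Cmod_ge_0 z').
  exists L. split; [unfold L; lra|]. intros j.
  assert (Pj := pos_INR j).
  rewrite Cmod_R. unfold alpha. rewrite Rabs_pos_eq by apply sqrt_pos.
  destruct (jac_spec z z' (Z.of_nat j) H) as [J EJ]. rewrite <- INR_IZR_INZ in EJ.
  assert (B : forall t, (Cmod t <= Cmod z + Cmod z') ->
    (Cmod (RtoC (INR j) + 1 - t) <= L * (INR j + 1))).
  { intros t Ht. unfold Cminus. tri.
    rewrite Cmod_opp, <- RtoC_plus, Cmod_pos by lra. unfold L. nra. }
  assert (BJ : jac z z' (Z.of_nat j) <= L * (INR j + 1) * (L * (INR j + 1))).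
  { rewrite <- (Rabs_pos_eq (jac z z' (Z.of_nat j))), <- Cmod_R, <- EJ, Cmod_mult by lra.
    apply Rmult_le_compat; try apply Cmod_ge_0; apply B; lra. }
  assert (PL : 0 <= L * (INR j + 1)) by (apply Rmult_le_pos; [unfold L|]; lra).
  rewrite <- (sqrt_square (L * (INR j + 1))) by auto.
  apply sqrt_le_1_alt. nra.
Qed.

Lemma linear_times_geometric (q : R) : (0 < q < 1) ->
  exists M, (0 <= M) /\ forall n, ((INR n + 1) * q ^ n <= M).
Proof.
  intros Hq.
  destruct (INR_unbounded (/ (1 - q))) as [N HN].
  destruct (ratio_bound_le (fun n => (INR n + 1) * q ^ n)%R 1 N) as (M & HM & B).
  - lra.
  - intros n. apply Rmult_le_pos; [assert (P := pos_INR n); lra|]. apply pow_le. lra.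
  - intros n Hn. apply le_INR in Hn. rewrite S_INR. simpl.
    assert (Hp : 0 < q ^ n) by (apply pow_lt; lra).
    assert (1 <= (1 - q) * (INR n + 1)).
    { replace 1%R with ((1 - q) * / (1 - q))%R at 1 by (field; lra).
      apply Rmult_le_compat_l; lra. }
    replace ((INR n + 1 + 1) * (q * q ^ n))%R with ((INR n + 1 + 1) * q * q ^ n)%R by ring.
    rewrite Rmult_1_l. apply Rmult_le_compat_r; [lra|]. nra.
  - exists M. split; auto. intros n. specialize (B n). rewrite pow1 in B. lra.
Qed.

(** [alpha] grows linearly, whereas psi_a decays geometrically. *)
Lemma CD_boundary_vanishes (xi : R) (z z' x y : C) : (0 < xi < 1) -> admissible z z' ->
  Clim eventually (fun n => CD_boundary xi z z' x y (Z.of_nat n - 1)) 0.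
Proof.
  intros Hxi H.
  destruct (psi_core_decay xi z z' x Hxi H) as (q1 & M1 & d1 & Hq1 & HM1 & Hd1 & B1).
  destruct (psi_core_decay xi z z' y Hxi H) as (q2 & M2 & d2 & Hq2 & HM2 & Hd2 & B2).
  destruct (Cmod_alpha_le xi z z' Hxi H) as (L & HL & BL).
  destruct (linear_times_geometric q1 Hq1) as (T & HT & BT).
  assert (Z0 : forall d, (0 < d) -> (Cmod 0 < d)) by (intros; now rewrite Cmod_0).
  assert (Bx : forall j, (Cmod (psi_core xi z z' (Z.of_nat j) x) <= M1 * q1 ^ j)).
  { intros j. rewrite <- (Cplus_0_r x). apply B1. auto. }
  assert (By : forall j, (Cmod (psi_core xi z z' (Z.of_nat j) y) <= M2 * q2 ^ j)).
  { intros j. rewrite <- (Cplus_0_r y). apply B2. auto. }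
  set (K := (2 * (L * T * M1 * M2))%R).
  assert (HK : 0 <= K) by (unfold K; repeat apply Rmult_le_pos; auto; lra).
  assert (Main : forall j, (Cmod (CD_boundary xi z z' x y (Z.of_nat j)) <= K * q2 ^ j)).
  { intros j. unfold CD_boundary. rewrite Cmod_mult.
    replace (Z.of_nat j + 1)%Z with (Z.of_nat (S j)) by lia.
    assert (Hp1 : 0 < q1 ^ j) by (apply pow_lt; lra).
    assert (Hp2 : 0 < q2 ^ j) by (apply pow_lt; lra).
    assert (X0 := Bx j). assert (X1 := Bx (S j)). assert (Y0 := By j). assert (Y1 := By (S j)).
    assert (X1' : Cmod (psi_core xi z z' (Z.of_nat (S j)) x) <= M1 * q1 ^ j).
    { eapply Rle_trans; [apply X1|]. apply Rmult_le_compat_l; auto. simpl. nra. }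
    assert (Y1' : Cmod (psi_core xi z z' (Z.of_nat (S j)) y) <= M2 * q2 ^ j).
    { eapply Rle_trans; [apply Y1|]. apply Rmult_le_compat_l; auto. simpl. nra. }
    assert (Bd : Cmod (psi_core xi z z' (Z.of_nat j) x * psi_core xi z z' (Z.of_nat (S j)) y
      - psi_core xi z z' (Z.of_nat (S j)) x * psi_core xi z z' (Z.of_nat j) y)
      <= 2 * (M1 * q1 ^ j * (M2 * q2 ^ j))).
    { unfold Cminus. tri.
      rewrite Cmod_opp, !Cmod_mult.
      assert (Cmod (psi_core xi z z' (Z.of_nat j) x) * Cmod (psi_core xi z z' (Z.of_nat (S j)) y)
        <= M1 * q1 ^ j * (M2 * q2 ^ j)) by (apply Rmult_le_compat; auto using Cmod_ge_0).
      assert (Cmod (psi_core xi z z' (Z.of_nat (S j)) x) * Cmod (psi_core xi z z' (Z.of_nat j) y)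
        <= M1 * q1 ^ j * (M2 * q2 ^ j)) by (apply Rmult_le_compat; auto using Cmod_ge_0).
      lra. }
    apply Rle_trans with (L * (INR j + 1) * (2 * (M1 * q1 ^ j * (M2 * q2 ^ j))))%R.
    - apply Rmult_le_compat; auto using Cmod_ge_0.
    - replace (L * (INR j + 1) * (2 * (M1 * q1 ^ j * (M2 * q2 ^ j))))%R
        with (2 * (L * M1 * M2) * q2 ^ j * ((INR j + 1) * q1 ^ j))%R by ring.
      replace (K * q2 ^ j)%R with (2 * (L * M1 * M2) * q2 ^ j * T)%R by (unfold K; ring).
      apply Rmult_le_compat_l; auto.
      apply Rmult_le_pos; [repeat apply Rmult_le_pos; auto; lra|lra]. }
  intros eps Heps.
  assert (He : 0 < eps / (K + 1)) by (apply Rdiv_lt_0_compat; lra).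
  destruct (pow_lt_1_zero q2 ltac:(rewrite Rabs_pos_eq; lra) _ He) as [N HN].
  exists (S N). intros [|n] Hn; [lia|].
  replace (Z.of_nat (S n) - 1)%Z with (Z.of_nat n) by lia.
  replace (CD_boundary xi z z' x y (Z.of_nat n) - 0)
    with (CD_boundary xi z z' x y (Z.of_nat n)) by ring.
  eapply Rle_lt_trans; [apply Main|].
  specialize (HN n ltac:(lia)).
  assert (Hp2 : 0 < q2 ^ n) by (apply pow_lt; lra).
  rewrite Rabs_pos_eq in HN by lra.
  apply Rlt_div_r in HN; [|lra]. nra.
Qed.

Lemma psi_core_kernel (xi : R) (z z' x y : C) : (0 < xi < 1) -> admissible z z' ->
  x <> y ->
  Cis_series (fun k => psi_core xi z z' (Z.of_nat k) x * psi_core xi z z' (Z.of_nat k) y)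
    (CD_boundary xi z z' x y (-1) / (RtoC (1 - xi) * (x - y))).
Proof.
  intros Hxi H Hxy. apply Cis_series_Clim.
  assert (N1 : RtoC (1 - xi) <> 0) by (apply RtoC_neq0; lra).
  assert (N2 : x - y <> 0).
  { intros E. apply Hxy. replace x with ((x - y) + y) by ring. rewrite E. apply Cplus_0_l. }
  assert (Hl := CD_boundary_vanishes xi z z' x y Hxi H).
  apply Clim_ext with (fun n => / (RtoC (1 - xi) * (x - y)) *
    (CD_boundary xi z z' x y (-1) + RtoC (-1) * CD_boundary xi z z' x y (Z.of_nat n - 1))).
  - apply eventually_filter.
  - intros n.
    replace (CD_boundary xi z z' x y (-1)
      + RtoC (-1) * CD_boundary xi z z' x y (Z.of_nat n - 1))
      with (CD_boundary xi z z' x y (-1) - CD_boundary xi z z' x y (Z.of_nat n - 1)) by ring.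
    rewrite <- Christoffel_Darboux by auto. field. auto.
  - replace (CD_boundary xi z z' x y (-1) / (RtoC (1 - xi) * (x - y)))
      with (/ (RtoC (1 - xi) * (x - y)) * (CD_boundary xi z z' x y (-1) + RtoC (-1) * 0))
      by (field; auto).
    apply Clim_scal; [apply eventually_filter|].
    apply Clim_plus; try apply eventually_filter.
    + apply Clim_const, eventually_filter.
    + apply Clim_scal; auto. apply eventually_filter.
Qed.

(** The diagonal, as the limit of the off-diagonal identity: the decay of [psi_a] is
    uniform near the diagonal, so the series converges to the diagonal series, while
    the closed form converges to a Wronskian. *)
Lemma psi_core_kernel_diag (xi : R) (z z' x dm dp : C) :
  (0 < xi < 1) -> admissible z z' ->
  Cder (psi_core xi z z' (-1)) x dm -> Cder (psi_core xi z z' 0) x dp ->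
  Cis_series (fun k => psi_core xi z z' (Z.of_nat k) x * psi_core xi z z' (Z.of_nat k) x)
    (RtoC (alpha xi z z' (-1)) / RtoC (1 - xi)
     * (dm * psi_core xi z z' 0 x - dp * psi_core xi z z' (-1) x)).
Proof.
  intros Hxi H Hm Hp.
  assert (N1 : RtoC (1 - xi) <> 0) by (apply RtoC_neq0; lra).
  destruct (psi_core_decay xi z z' x Hxi H) as (q & M & delta & Hq & HM & Hdelta & B).
  assert (B0 : forall j, (Cmod (psi_core xi z z' (Z.of_nat j) x) <= M * q ^ j)).
  { intros j. rewrite <- (Cplus_0_r x). apply B. rewrite Cmod_0. auto. }
  set (bound := fun j => (M * M * q ^ j)%R).
  assert (Hbound : ex_series bound).
  { apply (ex_series_scal_l (M * M)%R (fun j => q ^ j)%R). apply ex_series_geom.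
    rewrite Rabs_pos_eq; lra. }
  assert (Bh : forall j h, Cmod h < delta ->
    (Cmod (psi_core xi z z' (Z.of_nat j) (x + h)%C * psi_core xi z z' (Z.of_nat j) x)
      <= bound j)).
  { intros j h Hh. rewrite Cmod_mult. unfold bound.
    assert (Hp1 : 0 < q ^ j) by (apply pow_lt; lra).
    assert (Hp2 : q ^ j <= 1) by (rewrite <- (pow1 j); apply pow_incr; lra).
    apply Rle_trans with (M * q ^ j * (M * q ^ j))%R.
    - apply Rmult_le_compat; auto using Cmod_ge_0.
    - replace (M * q ^ j * (M * q ^ j))%R with (M * M * q ^ j * q ^ j)%R by ring.
      rewrite <- (Rmult_1_r (M * M * q ^ j)) at 2. apply Rmult_le_compat_l; auto.
      apply Rmult_le_pos; nra. }
  set (s0 := fun j => psi_core xi z z' (Z.of_nat j) x * psi_core xi z z' (Z.of_nat j) x).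
  set (sh := fun h j => psi_core xi z z' (Z.of_nat j) (x + h) * psi_core xi z z' (Z.of_nat j) x).
  assert (Bs0 : forall j, (Cmod (s0 j) <= bound j)).
  { intros j. unfold s0. rewrite <- (Cplus_0_r x) at 1. apply Bh. rewrite Cmod_0. auto. }
  assert (L1 : Clim Cpunct (fun h => CSeries (sh h)) (CSeries s0)).
  { apply (Tannery Cpunct) with bound; auto.
    - exists delta. split; auto. intros h [_ Hh] j. now apply Bh.
    - intros j. unfold sh, s0. apply Clim_mult; try apply Cpunct_filter.
      + destruct (Cder_psi_core xi z z' (Z.of_nat j) x Hxi) as [d Hd].
        apply (Cder_cont _ _ _ Hd).
      + apply Clim_const, Cpunct_filter. }
  set (a := RtoC (alpha xi z z' (-1)) / RtoC (1 - xi)).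
  assert (L2 : Clim Cpunct (fun h => CSeries (sh h))
    (a * (dm * psi_core xi z z' 0 x + RtoC (-1) * (dp * psi_core xi z z' (-1) x)))).
  { apply Clim_ext_loc with (fun h => a *
      ((psi_core xi z z' (-1) (x + h) - psi_core xi z z' (-1) x) / h * psi_core xi z z' 0 x
       + RtoC (-1) * ((psi_core xi z z' 0 (x + h) - psi_core xi z z' 0 x) / h
         * psi_core xi z z' (-1) x))).
    - apply Cpunct_filter.
    - exists delta. split; auto. intros h [Hh0 Hh].
      assert (Nh : h <> 0) by now apply Cmod_gt_0.
      symmetry. apply CSeries_unique.
      + apply Csummable_le with bound; auto. intros j. now apply Bh.
      + replace (a * _) with (CD_boundary xi z z' (x + h) x (-1) / (RtoC (1 - xi) * (x + h - x))).
        * apply psi_core_kernel; auto. intros E. apply Nh.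
          replace h with (x + h - x) by ring. rewrite E. ring.
        * unfold CD_boundary, a. simpl (-1 + 1)%Z.
          replace (x + h - x) with h by ring. field. auto.
    - apply Clim_scal; [apply Cpunct_filter|]. apply Clim_plus; try apply Cpunct_filter.
      + apply Clim_mult; [apply Cpunct_filter|apply Hm|apply Clim_const, Cpunct_filter].
      + apply Clim_scal; [apply Cpunct_filter|].
        apply Clim_mult; [apply Cpunct_filter|apply Hp|apply Clim_const, Cpunct_filter]. }
  assert (E := Clim_unique Cpunct _ _ _ L1 L2).
  replace (a * (dm * psi_core xi z z' 0 x - dp * psi_core xi z z' (-1) x)) with (CSeries s0).
  - apply CSeries_correct. apply Csummable_le with bound; auto.
  - rewrite E. ring.
Qed.

Lemma Cis_series_ext (u w : nat -> C) (v : C) :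
  (forall n, u n = w n) -> Cis_series u v -> Cis_series w v.
Proof. intros E. apply is_series_ext. exact E. Qed.

Lemma Cis_series_scal (c : C) (u : nat -> C) (v : C) :
  Cis_series u v -> Cis_series (fun k => c * u k) (c * v).
Proof.
  rewrite !Cis_series_Clim. intros H.
  apply Clim_ext with (fun n => c * Csum u n); [apply eventually_filter| |].
  - intros n. rewrite Cmult_comm, <- Csum_scal_r. apply Csum_ext. intros. ring.
  - apply Clim_scal; auto. apply eventually_filter.
Qed.

Lemma Cis_derive_Cder (f : C -> C) (x d : C) : Cder f x d -> Cis_derive f x d.
Proof.
  intros H. split; [apply is_linear_scal_l|].
  intros x' Hx'. assert (E0 : x = x') by exact (@is_filter_lim_locally_unique C_AbsRing
    (AbsRing_NormedModule C_AbsRing) x x' Hx'). subst x'.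
  intros eps. destruct (H eps (cond_pos eps)) as (e & He & He').
  apply locally_C. apply locally_Cmod. exists e. split; auto. intros y Hy.
  change (Cmod (f y - f x - (y - x) * d) <= eps * Cmod (y - x)).
  destruct (Ceq_dec (y - x) 0) as [E|E].
  - assert (Ey : y = x) by (replace y with ((y - x) + x) by ring; rewrite E; apply Cplus_0_l).
    rewrite Ey. replace (f x - f x - (x - x) * d) with (RtoC 0) by ring.
    replace (x - x) with (RtoC 0) by ring. rewrite Cmod_0. lra.
  - assert (Hp : 0 < Cmod (y - x)) by now apply Cmod_gt_0.
    specialize (He' (y - x) (conj Hp Hy)).
    replace (x + (y - x)) with y in He' by ring.
    replace (f y - f x - (y - x) * d) with (((f y - f x) / (y - x) - d) * (y - x))
      by (field; auto).
    rewrite Cmod_mult. apply Rmult_le_compat_r; lra.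
Qed.

Theorem proposition3p10 (xi : R) (z z' : C)
  (hxi : (0 < xi < 1)%R)
  (hz : principal_series z z' \/ complementary_series z z') :
  let psi_m := psi z z' xi (half (-1)) in
  let psi_p := psi z z' xi (half 0) in
  let c := Csqrt (z * z' * RtoC xi) / RtoC (1 - xi) in
  (forall m n : Z, m <> n ->
     let x := half m in
     let y := half n in
     is_kernel z z' xi x y
       (c * ((psi_m x * psi_p y - psi_p x * psi_m y) / (x - y))))
  /\
  (forall m : Z,
     let x := half m in
     exists dm dp : C,
       Cis_derive psi_m x dm /\ Cis_derive psi_p x dp /\
       is_kernel z z' xi x x (c * (dm * psi_p x - dp * psi_m x))).
Proof.
  intros psi_m psi_p c.
  assert (H := series_admissible z z' hz).
  assert (Hpsi : forall k x, psi z z' xi (half k) x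
    = psi_factor xi z z' x * psi_core xi z z' k x)
    by (intros k x; now apply psi_factorisation).
  assert (Hc : c = RtoC (alpha xi z z' (-1)) / RtoC (1 - xi)).
  { unfold c. f_equal. destruct (jac_spec z z' (-1) H) as [J EJ].
    replace (z * z' * RtoC xi) with (RtoC (xi * jac z z' (-1))).
    - apply Csqrt_pos. nra.
    - rewrite RtoC_mult, <- EJ. ring. }
  assert (N1 : RtoC (1 - xi) <> 0) by (apply RtoC_neq0; lra).
  split.
  - intros m n Hmn x y.
    assert (Hxy : x <> y).
    { intros E. apply Hmn. apply RtoC_inj in E. apply eq_IZR. lra. }
    assert (N2 : x - y <> 0).
    { intros E. apply Hxy. replace x with ((x - y) + y) by ring. rewrite E. apply Cplus_0_l. }
    assert (S := Cis_series_scal (psi_factor xi z z' x * psi_factor xi z z' y) _ _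
      (psi_core_kernel xi z z' x y hxi H Hxy)).
    unfold is_kernel.
    replace (c * ((psi_m x * psi_p y - psi_p x * psi_m y) / (x - y))) with
      (psi_factor xi z z' x * psi_factor xi z z' y
       * (CD_boundary xi z z' x y (-1) / (RtoC (1 - xi) * (x - y)))).
    + eapply Cis_series_ext; [|apply S]. intros k. cbv beta. rewrite !Hpsi. ring.
    + rewrite Hc. unfold psi_m, psi_p, CD_boundary. rewrite !Hpsi.
      simpl (-1 + 1)%Z. field. auto.
  - intros m x.
    destruct (Cder_psi_factor xi z z' m hxi H) as [df Hf].
    destruct (Cder_psi_core xi z z' (-1) x hxi) as [em Hm].
    destruct (Cder_psi_core xi z z' 0 x hxi) as [ep Hp].
    exists (df * psi_core xi z z' (-1) x + psi_factor xi z z' x * em),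
      (df * psi_core xi z z' 0 x + psi_factor xi z z' x * ep).
    split; [|split].
    + apply Cis_derive_Cder. eapply Cder_ext; [|exact (Cder_mult _ _ _ _ _ Hf Hm)].
      intros y. symmetry. apply Hpsi.
    + apply Cis_derive_Cder. eapply Cder_ext; [|exact (Cder_mult _ _ _ _ _ Hf Hp)].
      intros y. symmetry. apply Hpsi.
    + assert (S := Cis_series_scal (psi_factor xi z z' x * psi_factor xi z z' x) _ _
        (psi_core_kernel_diag xi z z' x em ep hxi H Hm Hp)).
      unfold is_kernel.
      (* the derivative of the common factor drops out of the Wronskian *)
      replace (c * _) with (psi_factor xi z z' x * psi_factor xi z z' x *
        (RtoC (alpha xi z z' (-1)) / RtoC (1 - xi)
          * (em * psi_core xi z z' 0 x - ep * psi_core xi z z' (-1) x))).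
      * eapply Cis_series_ext; [|apply S]. intros k. cbv beta. rewrite !Hpsi. ring.
      * rewrite Hc. unfold psi_m, psi_p. rewrite !Hpsi. field. auto.
Qed.
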